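(* There is an absolute constant $C>0$ such that for every squarefree integer $q\ge 16$, every primitive Dirichlet character $\chi \pmod q$, and every real $x\ge 1$, $$ \left| S_\chi(x) \right| \le C\, \sqrt{q} \, (\log q) \left(\left(\frac{\log \log \log q}{\log \log q}\right)^{1/2} + \left(\frac{(\log \log \log q)^2 \log \big(\mathcal{P}(q) \, d(q)\big)}{\log q}\right)^{1/4} \right). $$
   Context: For a Dirichlet character $\chi$ and real $x$, $S_\chi(x) := \sum_{n\le x}\chi(n)$, the sum being over positive integers $n\le x$. $\mathcal{P}(n)$ denotes the largest prime factor of $n$, and $d(n)$ denotes the number of positive divisors of $n$. *)

(* Defs.v *)
From HB Require Import structures.
From mathcomp Require Import all_boot all_order all_algebra.
From mathcomp Require Import all_classical all_reals all_analysis.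
From mathcomp Require Import complex.
Set Implicit Arguments.
Unset Strict Implicit.
Unset Printing Implicit Defensive.
Import Order.TTheory GRing.Theory Num.Theory.
Local Open Scope ring_scope.
Local Open Scope complex_scope.

(* chi 1 = 1 follows from the last two fields. *)
Record dirichlet_char (R : realType) (q : nat) := DirichletChar {
  dirichlet_fun :> int -> R[i];
  dirichlet_periodic : forall n : int, dirichlet_fun (n + q%:Z) = dirichlet_fun n;
  dirichlet_mul : forall m n : int,
    dirichlet_fun (m * n) = dirichlet_fun m * dirichlet_fun n;
  dirichlet_support : forall n : int,
    (dirichlet_fun n != 0) = coprimez n q%:Z }.

Definition induced_by (R : realType) (q d : nat)
    (chi : dirichlet_char R q) (psi : dirichlet_char R d) : Prop :=
  forall n : int, coprimez n q%:Z -> chi n = psi n.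

Definition primitive (R : realType) (q : nat) (chi : dirichlet_char R q) : Prop :=
  forall d : nat, (d %| q)%N -> (d < q)%N ->
    ~ exists psi : dirichlet_char R d, induced_by chi psi.

(* For x < 1 the range is empty, since then Num.truncn x = 0. *)
Definition char_sum (R : realType) (q : nat) (chi : dirichlet_char R q) (x : R)
    : R[i] :=
  \sum_(1 <= n < (Num.truncn x).+1) chi n%:Z.

Definition squarefree (n : nat) : Prop :=
  forall d : nat, (d ^ 2 %| n)%N -> d = 1%N.

Definition num_divisors (n : nat) : nat := size (divisors n).

(* Main.v *)
(** Expanding chi in additive characters through its Gauss sum and summing by
    parts bounds S_chi by sqrt q (1 + log N + mu log q), as soon as every twist
    of chi by an additive character has sums at most mu N on all intervals of
    length at most N.  To get such a saving mu with N = Y ^ 6, write q as a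
    product of at most k + 2 factors, one of them, m, between Y ^ 2 and Y ^ 3 and
    the others at most Y ^ 2.  Differencing by multiples of one factor removes it
    from the modulus (the q-analogue of van der Corput's method); what remains
    in the end is the average over all shifts of complete sums of iterated
    differences of the component of chi modulo m.  These averages factor over
    the primes p dividing m, where Weil's bound for multiplicative character
    sums saves sqrt p.  Every differencing step takes a square root of the saving,
    so the saving at the end is a 2 ^ (k + 2)-th root.  With eps the bracket in the
    theorem, k ~ 1 / eps and Y ~ q ^ (1 / k), this root is at most eps.

    Weil's bound is obtained from Stepanov's method over the extensions F_(p^n),
    n even, and from the polynomial L-function: its reciprocal roots have all
    their even power sums of order p ^ (n / 2), hence are at most sqrt p. *)

Require Import Defs.
From HB Require Import structures.
From mathcomp Require Import all_boot all_order all_algebra.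
From mathcomp Require Import all_classical all_reals all_analysis.
From mathcomp Require Import cyclic separable finfield closed_field.
From mathcomp Require Import zify ring lra complex.
Set Implicit Arguments.
Unset Strict Implicit.
Unset Printing Implicit Defensive.
Import Order.TTheory GRing.Theory Num.Theory.
Local Open Scope ring_scope.

(** * Stepanov's method *)

(** Differencing is averaged over all shifts modulo m rather than over chosen good ones: the average
    is multiplicative in m, so degenerate shifts have to be controlled only modulo each prime, where
    they are few. Weil's bound is needed for products of shifted characters; one factor of exponent
    exactly one makes the L-function a polynomial, and differencing keeps such a factor except at
    degenerate shifts. Even degrees n = 2 s make p ^ n the square of the integer p ^ s, which fixes
    the parameters in Stepanov's method.

    The bracket eps acts twice. Its first term gives 1 / eps <= sqrt(log log q), so that 2 ^ k is
    negligible against log q. Its second term gives log(P(q) d(q)) <= eps ^ 4 log q: all primes of q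
    are then below Y, so they can be grouped into factors of nearly prescribed size, and the powers
    of 2 lost at each prime are absorbed by a power of d(q) far below Y. When eps is bounded below,
    the same expansion with a trivial saving, the Polya-Vinogradov inequality, suffices. *)

Lemma nderivnM (K : comNzRingType) (p q : {poly K}) (n : nat) :
  (p * q)^`N(n) = \sum_(i < n.+1) p^`N(i) * q^`N(n - i).
Proof.
elim/poly_ind: p n => [|p c IH] n.
  rewrite mul0r big1 ?linear0 // => i _.
  by rewrite linear0 mul0r.
case: n => [|n].
  by rewrite big_ord_recl big_ord0 !nderivn0 addr0.
have -> : (p * 'X + c%:P) * q = (p * q) * 'X + 0%:P + c *: q.
  by rewrite polyC0 addr0 mulrDl mul_polyC -!mulrA [q * _]mulrC.
rewrite nderivnD nderivnMXaddC nderivnZ !IH [RHS]big_ord_recl /= subn0 nderivn0.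
rewrite (big_ord_recl n.+1) /= subn0 nderivn0.
rewrite [in RHS](eq_bigr (fun i : 'I_n.+1 => p^`N(i) * q^`N(n - i)
    + p^`N(i.+1) * q^`N(n - i) * 'X)); last first.
  by move=> i _; rewrite -[bump 0 i]/(i.+1) subSS nderivnMXaddC mulrDl mulrAC.
rewrite big_split /= -mulr_suml -mul_polyC.
rewrite [X in _ + (_ + X) * _ + _](eq_bigr (fun i : 'I_n.+1 => p^`N(i.+1) * q^`N(n - i))) //.
ring.
Qed.

Section Stepanov.
Variable K : fieldType.
Implicit Types f g r : {poly K}.

Lemma dvdp_sum (I : Type) (s : seq I) (P : pred I) (F : I -> {poly K}) f :
  (forall i, P i -> f %| F i) -> f %| \sum_(i <- s | P i) F i.
Proof.
move=> H; apply: (big_ind (fun u => f %| u)) => [|u v|i /H //]; [exact: dvdp0|exact: dvdp_add].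
Qed.

Lemma dvdp_nderivn_exp f (a l : nat) : f ^+ (a - l) %| (f ^+ a)^`N(l).
Proof.
elim: a l => [|a IH] l; first by rewrite sub0n expr0 dvd1p.
rewrite exprS nderivnM; apply: dvdp_sum => i _.
case: (posnP i) => [->|i0].
  rewrite nderivn0 subn0; case: (leqP l a) => la.
    by rewrite subSn // exprS dvdp_mul.
  by rewrite (eqP (_ : (a.+1 - l)%N == 0%N)) ?subn_eq0 // expr0 dvd1p.
apply: dvdp_mull; apply: dvdp_trans (IH _); apply: dvdp_exp2l.
have := ltn_ord i; lia.
Qed.

Lemma dvdp_nderivn_expM f r (a l : nat) : f ^+ (a - l) %| (f ^+ a * r)^`N(l).
Proof.
rewrite nderivnM; apply: dvdp_sum => i _.
apply: dvdp_mulr; apply: dvdp_trans (dvdp_nderivn_exp _ _ _); apply: dvdp_exp2l.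
have := ltn_ord i; lia.
Qed.

(** Taylor expansion at x. Hasse derivatives are used because the order of vanishing needed later is
    not bounded by the characteristic, and iterated ordinary derivatives would lose
    multiplicities. *)
Lemma dvdp_nderivn_root f (x : K) (l : nat) :
  (forall i, (i < l)%N -> (f^`N(i)).[x] = 0) -> ('X - x%:P) ^+ l %| f.
Proof.
move=> H.
have := @nderiv_taylor _ f^:P x%:P ('X - x%:P) (mulrC _ _).
rewrite size_map_polyC addrC subrK -[f^:P.['X]]/(f \Po 'X) comp_polyXr => ->.
apply: dvdp_sum => i _; rewrite nderivn_map horner_map /=.
case: (ltnP i l) => il; first by rewrite H // mul0r dvdp0.
by rewrite dvdp_mull ?dvdp_exp2l.
Qed.

Lemma kernel_exists (T U : finType) (a : T -> U -> K) : (#|U| < #|T|)%N ->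
  exists u : T -> K, (exists i, u i != 0) /\ forall j, \sum_i u i * a i j = 0.
Proof.
move=> lt; pose A := \matrix_(i < #|T|, j < #|U|) a (enum_val i) (enum_val j).
have kn0 : kermx A != 0.
  rewrite -mxrank_eq0 mxrank_ker -lt0n subn_gt0.
  exact: leq_ltn_trans (rank_leq_col A) lt.
have [i rn0] : exists i, row i (kermx A) != 0.
  apply/existsP; apply: contraNT kn0 => /existsPn H.
  by apply/eqP/row_matrixP => i; rewrite row0; apply/eqP; move: (H i); rewrite negbK.
set v := row i (kermx A) in rn0.
have vA : v *m A = 0 by apply/sub_kermxP; rewrite row_sub.
exists (fun t => v 0 (enum_rank t)); split.
  have [k vk] : exists k, v 0 k != 0.
    apply/existsP; apply: contraNT rn0 => /existsPn H.
    by apply/eqP/rowP => k; rewrite [RHS]mxE; apply/eqP; move: (H k); rewrite negbK.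
  by exists (enum_val k); rewrite enum_valK.
move=> j; have E : (v *m A) 0 (enum_rank j) = 0 by rewrite vA mxE.
rewrite -[RHS]E mxE [RHS](reindex (@enum_rank T)) /=; last exact/onW_bij/enum_rank_bij.
by apply: eq_bigr => t _; rewrite [A _ _]mxE !enum_rankK.
Qed.

(* As Q = D * e + 1, the monomials of lowest degree coming from the various (i, j, v)
   have distinct degrees Q * j + D * i + v: induct on that degree. *)
Lemma stepanov_indep (Q e D J : nat) g (r : nat -> nat -> {poly K}) :
  Q = (D * e).+1 -> g.[0] != 0 ->
  (forall i j, (size (r i j) <= D)%N) ->
  \sum_(i < e) \sum_(j < J) r i j * 'X^(Q * j) * ('X * g) ^+ (D * i) = 0 ->
  forall i j, (i < e)%N -> (j < J)%N -> r i j = 0.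
Proof.
move=> QE g0 sr sum0.
suff H s : forall i j v, (i < e)%N -> (j < J)%N -> (Q * j + D * i + v)%N = s -> (r i j)`_v = 0.
  by move=> i j ie jJ; apply/polyP => v; rewrite (H _ _ _ _ ie jJ erefl) coef0.
elim/ltn_ind: s => s IH i0 j0 v0 ie jJ Es.
case: (leqP D v0) => vD.
  by rewrite nth_default // (leq_trans (sr _ _)).
have coefE i j : (i < e)%N -> (j < J)%N ->
  (r i j * 'X^(Q * j) * ('X * g) ^+ (D * i))`_s =
  if (i == i0) && (j == j0) then (r i j)`_v0 * g.[0] ^+ (D * i) else 0.
  move=> ie' jJ'.
  have -> : r i j * 'X^(Q * j) * ('X * g) ^+ (D * i) = 'X^(Q * j + D * i) * (r i j * g ^+ (D * i)).
    by rewrite exprD exprMn; ring.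
  rewrite coefXnM; case: ltnP => ss.
    case: ifP => // /andP[/eqP ii /eqP jj]; subst i j; lia.
  rewrite coefM; set t := (s - _)%N.
  have small (v : 'I_t.+1) : (v < t)%N -> (r i j)`_v = 0.
    by move=> vt; apply: (IH _ _ i j v ie' jJ' erefl); lia.
  rewrite big_ord_recr /= big1 ?add0r ?subnn; last first.
    by move=> v _; rewrite (small (widen_ord (leqnSn _) v)) ?mul0r //=.
  case: ifP => [/andP[/eqP ii /eqP jj]|neq].
    have -> : t = v0 by rewrite /t ii jj; lia.
    by rewrite -horner_coef0 horner_exp ii.
  case: (leqP D t) => tD; first by rewrite nth_default ?mul0r // (leq_trans (sr _ _)).
  exfalso; move/negP: neq; apply.
  have s1 : (Q * j + (D * i + t) = Q * j0 + (D * i0 + v0))%N by rewrite /t; lia.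
  have b1 : (D * i + t < Q)%N.
    have : (D * i.+1 <= D * e)%N by rewrite leq_mul2l ie' orbT.
    rewrite mulnS; lia.
  have b2 : (D * i0 + v0 < Q)%N.
    have : (D * i0.+1 <= D * e)%N by rewrite leq_mul2l ie orbT.
    rewrite mulnS; lia.
  have jE : j = j0.
    have := congr1 (fun x => x %/ Q)%N s1.
    by rewrite !(mulnC Q) !divnMDl ?QE // -QE !divn_small // !addn0.
  have s2 : (D * i + t = D * i0 + v0)%N by move: s1; rewrite jE => /addnI.
  have iE : i = i0.
    have := congr1 (fun x => x %/ D)%N s2.
    by rewrite !(mulnC D) !divnMDl ?(leq_ltn_trans _ vD) // !divn_small // !addn0.
  by rewrite iE jE !eqxx.
have := congr1 (fun p : {poly K} => p`_s) sum0; rewrite /= coef0 coef_sum.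
rewrite (bigD1 (Ordinal ie)) //= [X in _ + X]big1 ?addr0; last first.
  move=> i ii; rewrite coef_sum big1 // => j _; rewrite coefE //.
  by case: ifP => // /andP[/eqP E _]; move: ii; rewrite -val_eqE /= E eqxx.
rewrite coef_sum (bigD1 (Ordinal jJ)) //= [X in _ + X]big1 ?addr0; last first.
  move=> j jj; rewrite coefE //.
  by case: ifP => // /andP[_ /eqP E]; move: jj; rewrite -val_eqE /= E eqxx.
rewrite coefE // !eqxx /= => /eqP; rewrite mulf_eq0 => /orP[/eqP //|].
by rewrite expf_eq0 (negPf g0) andbF.
Qed.

Lemma dvdp_coprime_prod (I : eqType) (A : seq I) (F : I -> {poly K}) f :
  uniq A -> {in A &, forall x y, x != y -> coprimep (F x) (F y)} ->
  {in A, forall x, F x %| f} -> \prod_(x <- A) F x %| f.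
Proof.
elim: A => [|x A IH] /=; first by rewrite big_nil dvd1p.
move=> /andP[xA uA] cop div; rewrite big_cons Gauss_dvdp; last first.
  elim: A xA uA {IH div} cop => [|y A IH]; first by rewrite big_nil coprimep1.
  rewrite inE negb_or => /andP[xy xA] /= /andP[_ uA] cop.
  rewrite big_cons coprimepMr cop ?inE ?eqxx ?orbT //= IH // => u v.
  by rewrite !inE => uA' vA; apply: cop; rewrite !inE orbCA ?uA' ?vA ?orbT.
rewrite div ?inE ?eqxx //= IH // => [u v uA' vA|u uA'].
  by apply: cop; rewrite inE ?uA' ?vA orbT.
by apply: div; rewrite inE uA' orbT.
Qed.

(* The auxiliary polynomial R = sum of u_t f ^ (l + D i) X ^ v X ^ (Q j) has, on A, the
   values and Hasse derivatives of a polynomial of small degree (X ^ Q = x and f ^ D = z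
   there), so linear algebra makes it vanish to order l at every point of A. *)
Lemma stepanov (Q e D m l J : nat) g (z : K) (A : seq K) (f := 'X * g) :
  (forall x : K, ('X - x%:P) ^+ Q = 'X^Q - (x ^+ Q)%:P) ->
  Q = (D * e).+1 -> g.[0] != 0 -> (size g <= m)%N -> (0 < J)%N ->
  uniq A -> {in A, forall x, [/\ x ^+ Q = x, f.[x] != 0 & f.[x] ^+ D = z]} ->
  (l <= Q)%N -> (l * (D + l * m + J) < e * J * D)%N ->
  (size A * l <= m * (l + D * e) + D + Q * J)%N.
Proof.
move=> frob QE g0 sg J0 uA PA lQ cnt.
have gn0 : g != 0 by apply: contraNneq g0 => ->; rewrite horner0.
have fn0 : f != 0 by rewrite mulf_neq0 ?polyX_eq0.
have sf : ((size f).-1 <= m)%N by rewrite size_mul ?polyX_eq0 // size_polyX.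
pose B := (D + l * m + J)%N.
(* The forced power of [f] is divided out. On [A] that power is [f ^+ (l - k)] times [f ^+ (D * i)],
   the latter being [z ^+ i], so only a polynomial of degree below [B] has to vanish. *)
pose s i v k := (f ^+ (l + D * i) * 'X^v)^`N(k) %/ f ^+ (l + D * i - k).
have sE i v k : (f ^+ (l + D * i) * 'X^v)^`N(k) = s i v k * f ^+ (l + D * i - k).
  by rewrite divpK // dvdp_nderivn_expM.
have ss i v k : (k < l)%N -> (v < D)%N -> (size (s i v k) <= D + l * m)%N.
  move=> kl vD; rewrite size_divp ?expf_neq0 // size_exp.
  have : (size (f ^+ (l + D * i) * 'X^v)^`N(k) <= (size f).-1 * (l + D * i) + v.+1)%N.
    apply: leq_trans (size_poly _ _) _; apply: leq_trans (leq_subr _ _) _.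
    rewrite size_mulXn ?expf_neq0 //.
    rewrite -[size (f ^+ _)]prednK; last by rewrite size_poly_gt0 expf_neq0.
    by rewrite size_exp addnC addSnnS.
  set w := size _; move: sf; set mf := _.-1 => sf sw.
  have : (mf * k <= l * m)%N by rewrite mulnC leq_mul // ltnW.
  have : (mf * (l + D * i) = mf * (l + D * i - k) + mf * k)%N.
    by rewrite -mulnDr subnK //; lia.
  lia.
(* [T] indexes the unknown coefficients, [U] the conditions: [B] coefficients for each order of
   differentiation below [l]. The last hypothesis says that there are fewer conditions than
   unknowns. *)
pose T : finType := ('I_e * 'I_J * 'I_D)%type; pose U : finType := ('I_l * 'I_B)%type.
pose a (t : T) (w : U) := (z ^+ t.1.1 *: ('X^(t.1.2) * s t.1.1 t.2 w.1))`_(w.2).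
have [|u [[t0 ut0] u0]] := @kernel_exists T U a.
  by rewrite !card_prod !card_ord.
pose r (i j : nat) : {poly K} :=
  \sum_(t : T | (t.1.1 == i :> nat) && (t.1.2 == j :> nat)) u t *: 'X^(t.2).
have sr i j : (size (r i j) <= D)%N.
  apply: leq_trans (size_sum _ _ _) _; apply/bigmax_leqP => t _.
  by apply: leq_trans (size_scale_leq _ _) _; rewrite size_polyXn.
pose R0 := \sum_(i < e) \sum_(j < J) r i j * 'X^(Q * j) * f ^+ (D * i).
have R0n0 : R0 != 0.
  apply: contraNneq ut0 => /(stepanov_indep QE g0 sr)/(_ t0.1.1 t0.1.2).
  move=> /(_ (ltn_ord _) (ltn_ord _)) /(congr1 (fun p : {poly K} => p`_(t0.2))) /=.
  rewrite coef0 coef_sum (bigD1 t0) ?eqxx //= coefZ coefXn eqxx mulr1 big1 ?addr0 => [->//|].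
  move=> [[i j] v] /= /andP[/andP[/eqP/val_inj -> /eqP/val_inj ->]] neq.
  rewrite coefZ coefXn; case: eqP => [/val_inj E|_]; last by rewrite mulr0.
  by move: neq; rewrite -E; case: (t0) => [[? ?] ?] /=; rewrite eqxx.
clearbody f.
pose R := f ^+ l * R0.
have Rn0 : R != 0 by rewrite mulf_neq0 ?expf_neq0.
have Rsum : R = \sum_(t : T) u t *: (f ^+ (l + D * t.1.1) * 'X^(t.2)) * ('X^Q) ^+ (t.1.2).
  rewrite /R /R0 mulr_sumr (partition_big (fun t : T => t.1.1) xpredT) //=.
  apply: eq_bigr => i _; rewrite mulr_sumr (partition_big (fun t : T => t.1.2) xpredT) //=.
  apply: eq_bigr => j _; rewrite /r !mulr_suml mulr_sumr.
  apply: eq_big => [t|t]; first by rewrite -!val_eqE.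
  move=> /andP[/eqP -> /eqP ->].
  by rewrite -!mul_polyC exprM [f ^+ (l + _)]exprD; ring.
have divR x : x \in A -> ('X - x%:P) ^+ l %| R.
  move=> xA; have [xQ fx fz] := PA x xA.
  (* [R'] is [R] with ['X^Q] replaced by its value x. The difference is divisible by ['X^Q - x],
     which is the [Q]-th power of ['X - x], and [l <= Q]. *)
  pose R' := \sum_(t : T) (u t * x ^+ t.1.2) *: (f ^+ (l + D * t.1.1) * 'X^(t.2)).
  have -> : R = (R - R') + R' by rewrite subrK.
  apply: dvdp_add.
    rewrite Rsum /R' -sumrB; apply: dvdp_sum => t _.
    rewrite mulrC.
    rewrite (_ : (u t * x ^+ t.1.2) *: _ = x%:P ^+ t.1.2 * (u t *: (f ^+ (l + D * t.1.1) * 'X^(t.2)))); last first.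
      by rewrite -!mul_polyC polyCM polyC_exp; ring.
    rewrite -mulrBl dvdp_mulr // subrXX; apply: dvdp_mulr.
    by have <- : ('X - x%:P) ^+ Q = 'X^Q - x%:P; [rewrite frob xQ | apply: dvdp_exp2l].
  apply: dvdp_nderivn_root => k kl.
  pose V := \sum_(t : T) u t *: (z ^+ t.1.1 *: ('X^(t.1.2) * s t.1.1 t.2 k)).
  have V0 : V = 0.
    apply/polyP => n; rewrite coef0; case: (ltnP n B) => nB.
      rewrite -[RHS](u0 (Ordinal kl, Ordinal nB)) coef_sum.
      by apply: eq_bigr => t _; rewrite coefZ.
    rewrite nth_default //; apply: leq_trans nB; apply: leq_trans (size_sum _ _ _) _.
    apply/bigmax_leqP => t _; do 2 apply: leq_trans (size_scale_leq _ _) _.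
    apply: leq_trans (size_polyMleq _ _) _; rewrite size_polyXn /=.
    by rewrite addnC leq_add ?ss ?ltn_ord // ltnW ?ltn_ord.
  rewrite linear_sum horner_sum /=.
  transitivity (f.[x] ^+ (l - k) * V.[x]); last by rewrite V0 horner0 mulr0.
  rewrite horner_sum mulr_sumr; apply: eq_bigr => t _.
  rewrite linearZ /= sE 3!hornerZ 2!hornerM hornerXn horner_exp.
  have -> : (l + D * t.1.1 - k = (l - k) + D * t.1.1)%N by lia.
  by rewrite exprD exprM fz; ring.
have : \prod_(x <- A) ('X - x%:P) ^+ l %| R.
  apply: dvdp_coprime_prod => // x y xA yA xy.
  by rewrite coprimep_expl ?coprimep_expr // coprimep_XsubC root_XsubC eq_sym.
move=> /(dvdp_leq Rn0); rewrite prodrXl.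
have -> : size ((\prod_(x <- A) ('X - x%:P)) ^+ l) = (size A * l).+1.
  rewrite -[LHS]prednK ?size_exp ?size_prod_XsubC // size_poly_gt0.
  by rewrite expf_neq0 // monic_neq0 // monic_prod_XsubC.
move=> lt; apply: leq_trans (ltnW lt) _; rewrite Rsum.
apply: leq_trans (size_sum _ _ _) _; apply/bigmax_leqP => t _.
rewrite -scalerAl; apply: leq_trans (size_scale_leq _ _) _; rewrite -exprM.
apply: leq_trans (size_polyMleq _ _) _; rewrite size_polyXn addnS /=.
have h1 : (size (f ^+ (l + D * t.1.1) * 'X^(t.2))%R <= m * (l + D * e) + D)%N.
  apply: leq_trans (size_polyMleq _ _) _; rewrite size_polyXn addnS /=.
  have : (size (f ^+ (l + D * t.1.1)) <= (m * (l + D * e)).+1)%N.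
    apply: leq_trans (size_poly_exp_leq _ _) _; rewrite ltnS leq_mul //.
    by rewrite leq_add2l leq_mul2l ltnW ?orbT.
  by move=> h; apply: leq_trans (leq_add h (leqnn _)) _; rewrite addSnnS leq_add2l ltn_ord.
apply: leq_trans (leq_add h1 (leqnn _)) _.
by rewrite leq_add2l leq_mul2l ltnW ?orbT.
Qed.

End Stepanov.

(** * The L-function of a multiplicative character *)

Lemma dvdp_prod_XsubC_count (K : fieldType) (s r : seq K) :
  (\prod_(y <- s) ('X - y%:P) %| \prod_(z <- r) ('X - z%:P)) <->
  (forall x, count_mem x s <= count_mem x r)%N.
Proof.
split=> [dvd x|/count_subseqP[t /perm_to_subseq[u pu] pt]].
  rewrite -!mu_prod_XsubC mup_geq ?monic_neq0 ?monic_prod_XsubC //.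
  by apply: dvdp_trans dvd; rewrite -mup_geq // monic_neq0 ?monic_prod_XsubC.
by rewrite (perm_big _ pu) big_cat /= (perm_big _ pt) dvdp_mulIl.
Qed.

Section Frobenius.
Variables (F : finFieldType) (K : closedFieldType) (iota : {rmorphism F -> K}).
Hypothesis Fprime : prime #|F|.
Local Notation q := #|F|.

Definition frob (x : K) := x ^+ q.

Lemma pchar_ext : q \in [pchar K].
Proof.
rewrite (fmorph_pchar iota); apply: (@card_finPcharP _ _ 1) => //.
Qed.

Lemma exprDn_card (A : comNzRingType) (x y : A) n : q \in [pchar A] ->
  (x + y) ^+ (q ^ n) = x ^+ (q ^ n) + y ^+ (q ^ n).
Proof.
move=> Aq; apply: exprDn_pchar.
by rewrite pnatX pnatE // Aq.
Qed.

Lemma exprBn_card (A : comNzRingType) (x y : A) n : q \in [pchar A] ->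
  (x - y) ^+ (q ^ n) = x ^+ (q ^ n) - y ^+ (q ^ n).
Proof.
move=> Aq; have := exprDn_card (x - y) y n Aq; rewrite subrK => ->.
by rewrite addrK.
Qed.

Lemma XsubC_exp_card (x : K) n : ('X - x%:P) ^+ (q ^ n) = 'X^(q ^ n) - (x ^+ (q ^ n))%:P.
Proof. by rewrite exprBn_card ?polyC_exp // pchar_poly pchar_ext. Qed.

Lemma iter_frob n x : iter n frob x = x ^+ (q ^ n).
Proof. by elim: n => [|n IH]; rewrite ?expr1 //= IH /frob -exprM expnSr. Qed.

Lemma frobB : {morph frob : x y / x - y}.
Proof. by move=> x y; rewrite /frob -[q]expn1 exprBn_card // pchar_ext. Qed.

Lemma frob_inj : injective frob.
Proof.
move=> x y /eqP; rewrite -subr_eq0 -frobB expf_eq0 subr_eq0.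
by move=> /andP[_ /eqP].
Qed.

Lemma frob_fixP x : reflect (exists a, iota a = x) (frob x == x).
Proof.
apply: (iffP eqP) => [fx|[a <-]]; last by rewrite /frob -rmorphXn expf_card.
have := congr1 (fun p => (map_poly iota p).[x]) (finField_genPoly F).
rewrite /= rmorph_prod rmorphB /= rmorphXn /= map_polyX !hornerE [x ^+ _]fx subrr.
move/esym/eqP; rewrite horner_prod prodf_seq_eq0 => /hasP[a _] /=.
by rewrite rmorphB /= map_polyX map_polyC !hornerE subr_eq0 => /eqP; exists a.
Qed.

Lemma card_exp_gt1 n : (0 < n)%N -> (1 < q ^ n)%N.
Proof. by move=> n0; rewrite -[X in (X < _)%N](expn0 q) ltn_exp2l ?prime_gt1. Qed.

(* The points of F_(q^n) inside K. *)
Definition ext_points n : seq K := sval (closed_field_poly_normal ('X^(q ^ n) - 'X)).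

Lemma ext_pointsE n : (0 < n)%N -> 'X^(q ^ n) - 'X = \prod_(z <- ext_points n) ('X - z%:P).
Proof.
move=> n0; rewrite /ext_points; case: closed_field_poly_normal => r /= E.
rewrite {1}E (_ : lead_coef _ = 1) ?scale1r // lead_coefDl ?lead_coefXn //.
by rewrite size_polyN size_polyX size_polyXn ltnS card_exp_gt1.
Qed.

Lemma mem_ext_points n x : (0 < n)%N -> (x \in ext_points n) = (iter n frob x == x).
Proof.
move=> n0; rewrite iter_frob -root_prod_XsubC -ext_pointsE //.
by rewrite rootE !hornerE subr_eq0.
Qed.

Lemma uniq_ext_points n : (0 < n)%N -> uniq (ext_points n).
Proof.
move=> n0; rewrite -separable_prod_XsubC -ext_pointsE // unlock.
rewrite derivB derivXn derivX -mulr_natr natrX.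
have -> : q%:R = 0 :> {poly K}.
  by apply/eqP; rewrite -(dvdn_pcharf (p := q)) // pchar_poly pchar_ext.
by rewrite expr0n eqn0Ngt n0 mulr0 sub0r -(scaleN1r (1 : {poly K})) coprimepZr ?oppr_eq0 ?oner_neq0 ?coprimep1.
Qed.

Lemma size_ext_points n : (0 < n)%N -> size (ext_points n) = (q ^ n)%N.
Proof.
move=> n0; apply/succn_inj; rewrite -(size_prod_XsubC _ id) -ext_pointsE //.
rewrite size_polyDl ?size_polyXn //.
by rewrite size_polyN size_polyX ltnS card_exp_gt1.
Qed.

End Frobenius.

(** * Orbits of an injective map inside an invariant multiset *)

Lemma sum_count_mem_undup (T : eqType) (s : seq T) :
  (\sum_(x <- undup s) count_mem x s = size s)%N.
Proof.
elim: s => [|a s IH] /=; first by rewrite big_nil.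
have E : (\sum_(x <- undup (a :: s)) (a == x) = 1)%N.
  rewrite (bigD1_seq a) ?mem_undup ?inE ?eqxx ?undup_uniq //= big1 // => x.
  by rewrite eq_sym => /negPf ->.
have -> : (\sum_(x <- undup (a :: s)) ((a == x) + count_mem x s) = 1 + \sum_(x <- undup (a :: s)) count_mem x s)%N.
  by rewrite big_split /= E.
rewrite add1n; congr _.+1; rewrite -{}IH /=; case: ifP => // as_.
by rewrite big_cons (count_memPn _) ?as_.
Qed.

Section Orbits.
Local Open Scope nat_scope.
Variables (T : eqType) (phi : T -> T).
Hypothesis phi_inj : injective phi.

Lemma iter_inj_eq i x y : iter i phi x = iter i phi y -> x = y.
Proof. by elim: i => //= i IH /phi_inj. Qed.

Section Period.
Variables (x : T) (m : nat).
Hypothesis m_gt0 : 0 < m.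
Hypothesis per_m : iter m phi x = x.
Hypothesis min_m : forall i, 0 < i -> iter i phi x = x -> m <= i.

Lemma iter_period_mul e : iter (m * e) phi x = x.
Proof. by elim: e => [|e IH]; rewrite ?muln0 // mulnS addnC iterD per_m. Qed.

Lemma iter_period j : (iter j phi x == x) = (m %| j).
Proof.
rewrite {1}(divn_eq j m) addnC mulnC iterD iter_period_mul.
rewrite /dvdn; case: posnP => [->|j0]; first by rewrite eqxx.
apply/eqP => /min_m -/(_ j0); rewrite leqNgt ltn_mod m_gt0 //.
Qed.

Lemma uniq_traject_period : uniq (traject phi x m).
Proof.
rewrite -(map_inj_uniq (f := id)) // map_id; apply/(uniqP x) => i j.
rewrite !inE size_traject => im jm; rewrite !nth_traject //.
wlog ij : i j im jm / i <= j => [H E|].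
  case: (leqP i j) => [ij|/ltnW ji]; [exact: H | exact/esym/H].
rewrite -(subnKC ij) iterD => /iter_inj_eq E.
case: (posnP (j - i)) => [|ji0]; first lia.
have := min_m ji0 (esym E); lia.
Qed.

Lemma count_traject_mul y e :
  count_mem y (traject phi x (m * e)) = e * (y \in traject phi x m).
Proof.
elim: e => [|e IH]; first by rewrite muln0.
rewrite mulnS addnC trajectD count_cat IH iter_period_mul mulSn addnC.
by rewrite count_uniq_mem ?uniq_traject_period.
Qed.

End Period.

Variable r : seq T.
Hypothesis r_inv : forall y, count_mem (phi y) r = count_mem y r.

Lemma count_iter i y : count_mem (iter i phi y) r = count_mem y r.
Proof. by elim: i => //= i <-. Qed.

Lemma exists_period x : x \in r -> exists2 m, 0 < m & iter m phi x = x.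
Proof.
move=> xr; have sub : {subset traject phi x (size r).+1 <= r}.
  move=> _ /trajectP[i _ ->]; by rewrite -has_pred1 has_count count_iter -has_count has_pred1.
have [|] := boolP (uniq (traject phi x (size r).+1)).
  by move/uniq_leq_size => /(_ _ sub); rewrite size_traject ltnn.
rewrite looping_uniq negbK => /trajectP[i ilt E].
exists (size r - i); first by rewrite subn_gt0.
by apply: (@iter_inj_eq i); rewrite -iterD subnKC // ltnW.
Qed.

Lemma min_period x : x \in r -> exists m, [/\ 0 < m, iter m phi x = x &
  forall i, 0 < i -> iter i phi x = x -> m <= i].
Proof.
move=> /exists_period[m m0 per].
have ex : exists k, (0 < k) && (iter k phi x == x) by exists m; rewrite m0 per eqxx.
exists (ex_minn ex); case: ex_minnP => k /andP[k0 /eqP kx] kmin; split => // i i0 ix.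
by apply: kmin; rewrite i0 ix eqxx.
Qed.

(** A return time j is a multiple m e of the minimal period m of x, and [traject phi x j] then runs
    e times through the orbit. By invariance all points of the orbit have the multiplicity of x in
    [r], so this fits into [r] exactly when e is at most that multiplicity; the bound [size r] on j
    cuts nothing off. *)
Lemma count_orbit_le x : x \in r ->
  \sum_(1 <= j < (size r).+1) ((iter j phi x == x) &&
    all (fun y => count_mem y (traject phi x j) <= count_mem y r) (traject phi x j)) = count_mem x r.
Proof.
move=> xr; have [m [m0 per min]] := min_period xr.
set c := count_mem x r.
have mc_le : m * c <= size r.
  have : exists2 s, subseq s r & perm_eq (traject phi x (m * c)) s.
    apply/count_subseqP => y; rewrite count_traject_mul //.
    case: (boolP (y \in _)) => [/trajectP[i _ ->]|_]; last by rewrite muln0.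
    by rewrite count_iter muln1.
  by case=> s /size_subseq sz /perm_size E; move: sz; rewrite -E size_traject.
have E j : 0 < j -> ((iter j phi x == x) &&
    all (fun y => count_mem y (traject phi x j) <= count_mem y r) (traject phi x j))
    = (m %| j) && (j <= m * c).
  move=> j0; rewrite (iter_period m0 per min); case: (boolP (m %| j)) => //= /dvdnP[e je].
  subst j; rewrite mulnC leq_pmul2l //.
  have e0 : 0 < e by move: j0; case: (e).
  apply/allP/idP => [H|ec y].
    have := H x; rewrite count_traject_mul //.
    have -> : x \in traject phi x m by case: (m) m0 => //= k _; rewrite inE eqxx.
    rewrite muln1; apply; have : 0 < m * e by rewrite muln_gt0 m0.
    by case: (m * e) => //= k _; rewrite inE eqxx.
  move=> /trajectP[i _ ->]; rewrite count_traject_mul // count_iter.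
  by case: (_ \in _); rewrite ?muln0 ?muln1.
rewrite (@big_cat_nat _ _ _ (m * c).+1) //=.
rewrite [X in (_ + X)%N]big1_seq ?addn0; last first.
  move=> j /andP[_]; rewrite mem_index_iota => /andP[j1 _].
  by rewrite E ?(leq_trans _ j1) // [_ <= m * c]leqNgt j1 andbF.
rewrite -[RHS](mulKn c m0) divn_count_dvd; apply: eq_big_nat => j /andP[j0 jc].
by rewrite E // -ltnS jc andbT.
Qed.

End Orbits.

Lemma map_traject (T : Type) (f : T -> T) x n : map f (traject f x n) = traject f (f x) n.
Proof. by elim: n x => //= n IH x; rewrite IH. Qed.

Section MonicPolys.
Variable F : finFieldType.

(** Encoding by the lower coefficients turns a sum over monic polynomials of degree n into a sum
    over a finite additive group, in which adding a fixed polynomial of lower degree is a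
    bijection. *)
Definition monic_of n (v : 'rV[F]_n) : {poly F} := 'X^n + rVpoly v.

Lemma size_rVpoly_le n (v : 'rV[F]_n) : (size (rVpoly v) <= n)%N.
Proof. exact: size_poly. Qed.

Lemma size_monic_of n (v : 'rV[F]_n) : size (monic_of v) = n.+1.
Proof. by rewrite size_polyDl size_polyXn ?ltnS ?size_rVpoly_le. Qed.

Lemma monic_of_monic n (v : 'rV[F]_n) : monic_of v \is monic.
Proof.
by rewrite monicE lead_coefDl ?lead_coefXn // size_polyXn ltnS size_rVpoly_le.
Qed.

Lemma monic_of_inj n : injective (@monic_of n).
Proof. by move=> u v /addrI /(can_inj rVpolyK). Qed.

Lemma monic_ofP n (g : {poly F}) : g \is monic -> size g = n.+1 -> monic_of (poly_rV (g - 'X^n) : 'rV_n) = g.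
Proof.
move=> gm sg.
have sz : (size (g - 'X^n)%R <= n)%N.
  apply/leq_sizeP => i; rewrite leq_eqVlt => /orP[/eqP <-|ni].
    rewrite coefB coefXn eqxx; apply/eqP; rewrite subr_eq0.
    by move: gm; rewrite monicE /lead_coef sg.
  rewrite coefB coefXn (gtn_eqF ni) subr0; apply: nth_default; by rewrite sg.
by rewrite /monic_of (poly_rV_K sz) addrC subrK.
Qed.

Lemma sum_monic_mul (V : nmodType) (W : {poly F} -> V) n j (P : {poly F}) :
  P \is monic -> size P = j.+1 -> (j <= n)%N ->
  \sum_(h : 'rV[F]_(n - j)) W (P * monic_of h) =
  \sum_(g : 'rV[F]_n | P %| monic_of g) W (monic_of g).
Proof.
move=> Pm sP jn; symmetry.
have Pn0 : P != 0 by rewrite monic_neq0.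
have sM (h : 'rV[F]_(n - j)) : size (P * monic_of h) = n.+1.
  by rewrite size_Mmonic ?monic_of_monic // sP size_monic_of addSn addnS /= subnKC.
have mM (h : 'rV[F]_(n - j)) : P * monic_of h \is monic by rewrite monicMl ?monic_of_monic.
rewrite (reindex_onto (fun h : 'rV[F]_(n - j) => poly_rV (P * monic_of h - 'X^n))
   (fun g => poly_rV (monic_of g %/ P - 'X^(n - j)))) /=; last first.
  move=> g Pg; apply: monic_of_inj; rewrite monic_ofP //.
  have gE : P * (monic_of g %/ P) = monic_of g by rewrite mulrC divpK.
  rewrite monic_ofP //.
    by rewrite -(monicMl _ Pm) gE monic_of_monic.
  by rewrite size_divp // size_monic_of sP subSn.
apply: eq_big => h; rewrite monic_ofP ?dvdp_mulIl //.
by rewrite mulKp //= ; apply/eqP; apply: monic_of_inj; rewrite monic_ofP ?monic_of_monic ?size_monic_of.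
Qed.

End MonicPolys.

Section LFunction.
Variables (F : finFieldType) (K : closedFieldType) (iota : {rmorphism F -> K}).
Hypothesis Fprime : prime #|F|.
Local Notation q := #|F|.
Local Notation frob := (@frob F K).
Local Notation ext_points := (@ext_points F K).
Variables (C : comNzRingType) (chi : F -> C) (E : F -> nat).
Hypothesis chi1 : chi 1 = 1.
Hypothesis chiM : {morph chi : x y / x * y}.

(* For the monic g = prod_i (X - x_i) and chi multiplicative, this is
   prod_i chi (prod_b (b - x_i) ^ E b): a completely multiplicative function of g. *)
Definition eval_wt (g : {poly F}) : C := \prod_b chi g.[b] ^+ E b.

Lemma eval_wtM g h : eval_wt (g * h) = eval_wt g * eval_wt h.
Proof. by rewrite -big_split; apply: eq_bigr => b _; rewrite /= hornerM chiM exprMn. Qed.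

Lemma eval_wt1 : eval_wt 1 = 1.
Proof. by rewrite /eval_wt big1 // => b _; rewrite hornerC chi1 expr1n. Qed.

(** The coefficient of T ^ n in the L-function, the sum of [eval_wt g] T ^ (deg g) over all monic
    g. *)
Definition Lcoef n : C := \sum_(v : 'rV[F]_n) eval_wt (monic_of v).

Definition Fp_preimage (y : K) : F := odflt 0 [pick a | iota a == y].

Lemma Fp_preimageK y : frob y = y -> iota (Fp_preimage y) = y.
Proof.
move=> /eqP /(frob_fixP iota) [a ay]; rewrite /Fp_preimage; case: pickP => [b /eqP //|].
by move/(_ a); rewrite ay eqxx.
Qed.

Lemma Fp_preimage0 : Fp_preimage 0 = 0.
Proof.
apply: (fmorph_inj iota); rewrite Fp_preimageK ?rmorph0 //.
by rewrite /frob expr0n; case: #|F| (prime_gt0 Fprime).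
Qed.

(** When x lies in F_(q^n), this is its characteristic polynomial over F: a power of the minimal
    polynomial, whose value at b in F is the norm of b - x. *)
Definition orbpoly n x : {poly K} := \prod_(y <- traject frob x n) ('X - y%:P).
Definition orbpolyF n x : {poly F} := map_poly Fp_preimage (orbpoly n x).

Lemma map_frob_prod (s : seq K) :
  map_poly (pFrobenius_aut (pchar_ext iota Fprime)) (\prod_(y <- s) ('X - y%:P)) =
  \prod_(y <- map frob s) ('X - y%:P).
Proof.
rewrite rmorph_prod big_map; apply: eq_bigr => y _.
by rewrite rmorphB /= map_polyX map_polyC.
Qed.

Lemma map_orbpolyF n x : iter n frob x = x -> map_poly iota (orbpolyF n x) = orbpoly n x.
Proof.
move=> per; rewrite /orbpolyF; apply/polyP => i.
rewrite coef_map /= coef_map_id0 ?Fp_preimage0 // Fp_preimageK //.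
have : map_poly (pFrobenius_aut (pchar_ext iota Fprime)) (orbpoly n x) = orbpoly n x.
  rewrite map_frob_prod map_traject /=; case: n per => // n per.
  by rewrite /orbpoly trajectSr -iterSr per trajectS; apply: perm_big; rewrite perm_rcons.
by move=> /(congr1 (fun p : {poly K} => p`_i)); rewrite coef_map.
Qed.

Lemma size_orbpoly n x : size (orbpoly n x) = n.+1.
Proof. by rewrite size_prod_XsubC size_traject. Qed.

Lemma size_orbpolyF n x : iter n frob x = x -> size (orbpolyF n x) = n.+1.
Proof. by move=> per; rewrite -(size_map_poly iota) map_orbpolyF // size_orbpoly. Qed.

Lemma orbpolyF_monic n x : iter n frob x = x -> orbpolyF n x \is monic.
Proof.
by move=> per; rewrite -(map_monic iota) map_orbpolyF // monic_prod_XsubC.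
Qed.

(** The character sum over F_(q^n), expressed through norms. These are the coefficients of T L' /
    L. *)
Definition Lsum n : C := \sum_(x <- ext_points n) eval_wt (orbpolyF n x).

(* This replaces the Euler product: grouping x by Frobenius orbits, it says that the
   sum of deg P over the prime powers P ^ e dividing g is deg g. *)
Lemma count_orbpolyF_dvd n (g : {poly F}) : (0 < n)%N -> g \is monic -> size g = n.+1 ->
  (\sum_(1 <= j < n.+1) \sum_(x <- ext_points j) (orbpolyF j x %| g)%R = n)%N.
Proof.
move=> n0 gm sg; have [r rE] := closed_field_poly_normal (map_poly iota g).
have {}rE : map_poly iota g = \prod_(z <- r) ('X - z%:P).
  by rewrite {1}rE lead_coef_map (eqP gm) rmorph1 scale1r.
have sr : size r = n.
  by have := congr1 (fun p : {poly K} => size p) rE; rewrite /= size_map_poly sg size_prod_XsubC => -[].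
have r_inv y : count_mem (frob y) r = count_mem y r.
  have fixg : map_poly (pFrobenius_aut (pchar_ext iota Fprime)) (map_poly iota g) = map_poly iota g.
    by apply/polyP => i; rewrite !coef_map /= pFrobenius_autE -rmorphXn expf_card.
  have : perm_eq (map frob r) r by apply: prod_XsubC_eq; rewrite -map_frob_prod -rE fixg.
  move/permP => <-; rewrite count_map; apply: eq_count => z /=.
  by rewrite (inj_eq (frob_inj iota Fprime)).
rewrite -[RHS]sr -sum_count_mem_undup.
transitivity (\sum_(x <- undup r) \sum_(1 <= j < (size r).+1) ((iter j frob x == x) &&
    all (fun y => count_mem y (traject frob x j) <= count_mem y r) (traject frob x j)))%N; last first.
  by apply: eq_big_seq => x; rewrite mem_undup => xr; exact: (count_orbit_le (frob_inj iota Fprime) r_inv xr).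
rewrite exchange_big /= sr; apply: eq_big_nat => j /andP[j0 jn].
have dvdE x : iter j frob x = x -> (orbpolyF j x %| g)%R =
    all (fun y => (count_mem y (traject frob x j) <= count_mem y r)%N) (traject frob x j).
  move=> per; rewrite -(dvdp_map iota) map_orbpolyF // rE.
  apply/idP/allP => [/dvdp_prod_XsubC_count H y _ //|H].
  apply/dvdp_prod_XsubC_count => y.
  case: (boolP (y \in traject frob x j)) => [/H //|/count_memPn -> //].
have -> : (\sum_(x <- ext_points j) (orbpolyF j x %| g)%R =
  \sum_(x <- ext_points j | (orbpolyF j x %| g)%R) 1)%N by rewrite [RHS]big_mkcond /=; apply: eq_bigr => x _; case: ifP.
have -> : (\sum_(x <- undup r) ((iter j frob x == x) &&
    all (fun y => count_mem y (traject frob x j) <= count_mem y r) (traject frob x j)) =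
  \sum_(x <- undup r | (iter j frob x == x) &&
    all (fun y => count_mem y (traject frob x j) <= count_mem y r) (traject frob x j)) 1)%N.
  by rewrite [RHS]big_mkcond /=; apply: eq_bigr => x _; case: ifP.
rewrite -(big_filter (ext_points j)) -(big_filter (undup r)); apply: perm_big; apply: uniq_perm.
- by rewrite filter_uniq // (uniq_ext_points iota).
- by rewrite filter_uniq // undup_uniq.
move=> x; rewrite !mem_filter mem_undup mem_ext_points //.
case: eqP => [per|_]; last by rewrite andbF.
rewrite andbT /= dvdE //; case: (boolP (all _ _)) => //= /allP H.
have xt : x \in traject frob x j by case: (j) j0 => //= k _; rewrite inE eqxx.
by apply/esym; rewrite -has_pred1 has_count (leq_trans _ (H _ xt)) // -has_count has_pred1.
Qed.

(** The logarithmic derivative of L, coefficientwise: n = deg g is expanded by [count_orbpolyF_dvd],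
    the sums are exchanged, and each orbit polynomial dividing g is split off by multiplicativity of
    [eval_wt]. *)
Lemma Lcoef_rec n : (0 < n)%N ->
  n%:R * Lcoef n = \sum_(1 <= j < n.+1) Lsum j * Lcoef (n - j).
Proof.
move=> n0.
transitivity (\sum_(1 <= j < n.+1) \sum_(x <- ext_points j)
   \sum_(v : 'rV[F]_n | orbpolyF j x %| monic_of v) eval_wt (monic_of v)); last first.
  apply: eq_big_nat => j /andP[j0 jn]; rewrite /Lsum mulr_suml.
  apply: eq_big_seq => x; rewrite mem_ext_points // => /eqP per.
  rewrite -(@sum_monic_mul _ _ eval_wt n j) ?orbpolyF_monic ?size_orbpolyF //.
  by rewrite mulr_sumr; apply: eq_bigr => v _; rewrite eval_wtM.
under eq_bigr do under eq_bigr do rewrite big_mkcond.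
under eq_bigr do rewrite exchange_big.
rewrite exchange_big mulr_sumr; apply: eq_bigr => v _ /=.
rewrite -{1}(@count_orbpolyF_dvd n (monic_of v)) ?monic_of_monic ?size_monic_of //.
rewrite natr_sum mulr_suml; apply: eq_bigr => j _.
rewrite natr_sum mulr_suml; apply: eq_bigr => x _.
by case: (_ %| _); rewrite ?mul1r ?mul0r.
Qed.

End LFunction.

(** * The L-function is a polynomial *)

Section Vanish.
Variables (F : finFieldType) (C : numDomainType) (chi : F -> C) (E : F -> nat).
Hypothesis chi_sum : \sum_v chi v = 0.
Variables (b0 : F) (s : nat).
Hypothesis Eb0 : E b0 = 1%N.
Hypothesis supp : (#|[pred b | E b != 0%N]| <= s)%N.

(* Adding t *: h, where h vanishes at all b != b0 with E b != 0, permutes the monic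
   polynomials of degree n and moves only the value at b0, where chi sums to zero. *)
Lemma Lcoef_eq0 n : (s <= n)%N -> Lcoef chi E n = 0.
Proof.
move=> sn; pose h := \prod_(b | (E b != 0%N) && (b != b0)) ('X - b%:P).
have sh : (size h <= n)%N.
  rewrite /h -big_filter size_prod_XsubC size_filter -sum1_count sum1_card.
  apply: leq_trans sn; apply: leq_trans supp.
  rewrite [X in (_ <= X)%N](cardD1 b0) inE Eb0 /= add1n ltnS subset_leq_card //.
  by apply/fintype.subsetP => b; rewrite !inE andbC.
have hb0 : h.[b0] != 0.
  rewrite horner_prod prodf_seq_neq0; apply/allP => b _; apply/implyP => /andP[_ bb].
  by rewrite !hornerE subr_eq0 eq_sym.
have hb b : E b != 0%N -> b != b0 -> h.[b] = 0.
  move=> Eb bb; rewrite horner_prod (bigD1 b) ?Eb ?bb //=.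
  by rewrite !hornerE subrr mul0r.
have shift t : Lcoef chi E n = \sum_(v : 'rV[F]_n) eval_wt chi E (monic_of v + t *: h).
  rewrite /Lcoef (reindex_inj (addIr (t *: poly_rV h))) /=; apply: eq_bigr => v _.
  by rewrite /monic_of linearD linearZ /= poly_rV_K // addrA.
have : #|F|%:R * Lcoef chi E n = 0.
  rewrite mulr_natl -sumr_const; under eq_bigr => t _ do rewrite (shift t).
  rewrite exchange_big big1 // => v _ /=.
  transitivity (\sum_t (\prod_(b | b != b0) chi (monic_of v).[b] ^+ E b) * chi ((monic_of v).[b0] + t * h.[b0])).
    apply: eq_bigr => t _; rewrite /eval_wt (bigD1 b0) //= Eb0 expr1 !hornerE mulrC; congr (_ * _).
    apply: eq_bigr => b bb; rewrite !hornerE.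
    by have [->|Eb] := eqVneq (E b) 0%N; rewrite ?expr0 // hb // mulr0 addr0.
  rewrite -mulr_sumr; apply/eqP; rewrite mulf_eq0; apply/orP; right; apply/eqP.
  rewrite -[RHS]chi_sum [RHS](reindex (fun t => (monic_of v).[b0] + t * h.[b0])) //=.
  exists (fun u => (u - (monic_of v).[b0]) / h.[b0]) => t _ /=.
    by rewrite addrC addKr mulfK.
  by rewrite divfK // addrC subrK.
move/eqP; rewrite mulf_eq0 pnatr_eq0 => /orP[/eqP F0|/eqP //].
by move: (max_card (pred1 b0)); rewrite card1 F0.
Qed.

End Vanish.

(** * Character sums over the extensions of even degree *)

Section LsumBound.
Variables (F : finFieldType) (K : closedFieldType) (iota : {rmorphism F -> K}).
Hypothesis Fprime : prime #|F|.
Local Notation q := #|F|.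
Local Notation frob := (@frob F K).
Local Notation ext_points := (@ext_points F K).
Variable E : F -> nat.
Hypothesis E0 : E 0 = 1%N.

Definition orbit_val n (x : K) : F := \prod_b (orbpolyF iota n x).[b] ^+ E b.

(** Chosen so that ['X * g] is the product of all [(b - 'X) ^+ E b]: as [E 0 = 1], zero contributes
    a single factor -X, whence the sign. This simple zero at 0 is what [stepanov_indep] asks for. *)
Let g : {poly K} := - \prod_(b : F | b != 0) ((iota b)%:P - 'X) ^+ E b.

Lemma g_neq0 : g.[0] != 0.
Proof.
rewrite hornerN oppr_eq0 horner_prod prodf_seq_neq0; apply/allP => b _; apply/implyP => b0.
by rewrite horner_exp !hornerE subr0 expf_neq0 // fmorph_eq0.
Qed.

Lemma XgE : 'X * g = \prod_b ((iota b)%:P - 'X) ^+ E b.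
Proof. by rewrite (bigD1 0) //= E0 expr1 rmorph0 sub0r mulrN mulNr. Qed.

Lemma geom_sum_card n : (q ^ n = ((\sum_(i < n) q ^ i) * q.-1).+1)%N.
Proof.
by rewrite mulnC -predn_exp prednK // expn_gt0 prime_gt0.
Qed.

Lemma orbpoly_horner c n x : frob c = c -> (orbpoly F n x).[c] = (c - x) ^+ (\sum_(i < n) q ^ i)%N.
Proof.
move=> cc; elim: n x => [|n IH] x; first by rewrite /orbpoly !big_nil big_ord0 hornerE.
rewrite /orbpoly /= big_cons hornerM !hornerE [X in _ * X]IH.
have -> : c - frob x = (c - x) ^+ q by rewrite -[in LHS]cc -(frobB iota).
rewrite -exprM -exprS big_ord_recl expn0 add1n; congr (_ ^+ _.+1).
by rewrite big_distrr; apply: eq_bigr => i _; rewrite /= -expnS.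
Qed.

Lemma iota_orbit_val n x : iter n frob x = x -> iota (orbit_val n x) = ('X * g).[x] ^+ (\sum_(i < n) q ^ i)%N.
Proof.
move=> per; rewrite XgE horner_prod -prodrXl rmorph_prod; apply: eq_bigr => b _.
rewrite rmorphXn -horner_map map_orbpolyF // horner_exp exprAC; congr (_ ^+ _).
rewrite !hornerE; apply: orbpoly_horner.
by apply/eqP/frob_fixP; exists b.
Qed.

(** On F_(q^n) the condition [orbit_val n x = z] says f(x) ^ D = z for f = ['X * g] and D = (q^n -
    1) / (q - 1), the situation of [stepanov]. Vanishing to order (q - 1) q^(s - 1) gives the
    expected q^n / (q - 1) with an error of order q^s for fixed q and g. *)
Lemma stepanov_card n s z (A := [seq x <- ext_points n | orbit_val n x == z]) :
  z != 0 -> n = s.*2 -> (1 < s)%N ->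
  (size A * q.-1 <= q ^ n + (size g * q + q * (3 * size g + 4)) * q ^ s)%N.
Proof.
move=> z0 ns s1; set m := size g.
set D := (\sum_(i < n) q ^ i)%N; set e := q.-1.
have q1 : (1 < q)%N by apply: prime_gt1.
(* With J = l' + c the term e l' D occurs on both sides of the count of conditions and unknowns. The
   surplus c e D, close to c T ^ 2, has to exceed errors of at most (m + 1) T ^ 2 + c T, and c = 2 m
   + 3 suffices for T >= 4. *)
set l' := (q ^ s.-1)%N; set T := (q ^ s)%N; set c := (2 * m + 3)%N.
have QE : (q ^ n = (D * e).+1)%N by rewrite -geom_sum_card.
have TE : (T = q * l')%N by rewrite /T /l' -expnS prednK // ltnW.
have QT : (q ^ n = T * T)%N by rewrite ns -addnn expnD.
have l0 : (0 < l')%N by rewrite expn_gt0 ltnW.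
have T4 : (4 <= T)%N.
  have h : (2 ^ 2 <= q ^ 2)%N by rewrite leq_exp2r.
  by apply: leq_trans h _; rewrite leq_exp2l.
have lT : (e * l' <= T)%N by rewrite TE leq_mul2r leq_pred orbT.
have n0 : (0 < n)%N by rewrite ns double_gt0 ltnW.
have D0 : (0 < D)%N.
  by rewrite lt0n; apply: contraTneq (card_exp_gt1 Fprime n0) => D0; rewrite QE D0.
have uA : uniq A by rewrite filter_uniq // (uniq_ext_points iota).
have PA : {in A, forall x, [/\ x ^+ (q ^ n) = x, ('X * g).[x] != 0 & ('X * g).[x] ^+ D = iota z]}.
  move=> x; rewrite mem_filter mem_ext_points // => /andP[/eqP wx /eqP per].
  have fx := iota_orbit_val per; rewrite wx in fx.
  split=> //; first by rewrite -iter_frob.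
  apply: contra_neq z0 => f0; apply: (fmorph_inj iota); rewrite fx rmorph0 f0.
  by rewrite expr0n -/D eqn0Ngt D0.
have lQ : (e * l' <= q ^ n)%N by rewrite QT (leq_trans lT) // leq_pmulr // ltnW // (leq_trans _ T4).
have De : (D * e = (T * T).-1)%N by rewrite -QT QE.
have cnt : (e * l' * (D + e * l' * m + (l' + c)) < e * (l' + c) * D)%N.
  set L := (e * l')%N.
  have -> : (L * (D + L * m + (l' + c)) = l' * (D * e) + (L * L * m + L * (l' + c)))%N.
    by rewrite /L; ring.
  have -> : (e * (l' + c) * D = l' * (D * e) + c * (D * e))%N by ring.
  rewrite ltn_add2l De.
  have h1 : (L * L * m <= T * T * m)%N by rewrite leq_mul2r leq_mul ?orbT.
  have h2 : (L * l' <= T * T)%N by rewrite leq_mul // TE leq_pmull // ltnW.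
  have h3 : (L * c <= T * c)%N by rewrite leq_mul2r lT orbT.
  have h4 : (4 * T <= T * T)%N by rewrite leq_mul2r T4 orbT.
  rewrite mulnDr; apply: leq_ltn_trans (leq_add h1 (leq_add h2 h3)) _.
  have : (c * (4 * T) <= c * (T * T))%N by rewrite leq_mul2l h4 orbT.
  have : (c * 16 <= c * (T * T))%N by rewrite leq_mul2l (leq_trans _ h4) ?orbT // (leq_mul2l 4 4) T4.
  have -> : (c * (T * T).-1 = c * (T * T) - c)%N by rewrite -subn1 mulnBr muln1.
  have e1 : (c * (T * T) = 2 * (T * T * m) + 3 * (T * T))%N by rewrite /c; ring.
  have e2 : (c * (4 * T) = 4 * (T * c))%N by ring.
  have h5 : (16 <= T * T)%N by rewrite (leq_trans _ h4) // (leq_mul2l 4 4) T4.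
  move: e1 e2 h5; move: (c * (4 * T))%N (c * (T * T))%N (T * c)%N (T * T * m)%N => a1 a2 a3 a4; clear; lia.
have := stepanov (XsubC_exp_card iota Fprime ^~ n) QE g_neq0 (leqnn _) _ uA PA lQ cnt.
rewrite addn_gt0 l0 => /(_ isT) H.
have : (size A * e * l' <= (T * T + (m * q + q * (3 * m + 4)) * T) * l')%N.
  apply: leq_trans (_ : m * (e * l' + D * e) + D + q ^ n * (l' + c) <= _)%N.
    by rewrite -mulnA.
  have h1 : (D * e <= T * T)%N by rewrite De leq_pred.
  have h2 : (D <= T * T)%N by apply: leq_trans h1; rewrite leq_pmulr // /e -ltnS prednK // ltnW.
  have h3 : (e <= q)%N by apply: leq_pred.
  have TTE : (T * T = T * q * l')%N by rewrite {2}TE mulnA.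
  have h4 : (m * (e * l') <= m * (q * T * l'))%N.
    rewrite leq_mul2l leq_mul2r (leq_trans h3) ?orbT // leq_pmulr // (leq_trans _ T4) //.
  apply: leq_trans (_ : m * (q * T * l') + m * (T * T) + T * T + T * T * (l' + c) <= _)%N.
    rewrite QT leq_add // leq_add // mulnDr leq_add // leq_mul2l h1 orbT //.
  rewrite mulnDr TTE /c; nia.
by rewrite leq_pmul2r // QT.
Qed.

Lemma orbit_val0_card n (A := [seq x <- ext_points n | orbit_val n x == 0]) : (0 < n)%N ->
  (size A <= (size g).+1)%N.
Proof.
move=> n0; have f0 : 'X * g != 0.
  by rewrite mulf_neq0 ?polyX_eq0 //; apply: contraNneq g_neq0 => ->; rewrite horner0.
apply: (@leq_trans (size ('X * g)%R)); last first.
  by apply: leq_trans (size_polyMleq _ _) _; rewrite size_polyX.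
apply/ltnW/max_poly_roots => //; last first.
  by rewrite filter_uniq // (uniq_ext_points iota).
apply/allP => x; rewrite mem_filter mem_ext_points // => /andP[/eqP wx /eqP per].
have := iota_orbit_val per; rewrite wx rmorph0 => /esym/eqP; rewrite expf_eq0 rootE.
by move=> /andP[].
Qed.

Variables (C : numFieldType) (chi : F -> C).
Hypothesis chi0 : chi 0 = 0.
Hypothesis chi1 : chi 1 = 1.
Hypothesis chiM : {morph chi : x y / x * y}.
Hypothesis chi_le1 : forall x, `|chi x| <= 1.
Hypothesis chi_sum : \sum_v chi v = 0.

Lemma LsumE n : Lsum iota chi E n = \sum_z chi z * (size [seq x <- ext_points n | orbit_val n x == z])%:R.
Proof.
transitivity (\sum_(x <- ext_points n) chi (orbit_val n x)).
  apply: eq_bigr => x _; rewrite /eval_wt /orbit_val (big_morph chi chiM chi1).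
  apply: eq_bigr => b _; elim: (E b) => [|k IH]; first by rewrite !expr0 chi1.
  by rewrite !exprS IH chiM.
rewrite (partition_big (orbit_val n) xpredT) //=; apply: eq_bigr => z _.
rewrite (eq_bigr (fun=> chi z)) => [|x /eqP -> //].
by rewrite big_const_seq iter_addr_0 mulr_natr size_filter.
Qed.

(** Stepanov's method bounds the fibres of [orbit_val] only from above. As the fibres partition
    F_(q^n), a bound a <= b + c may be used in the form |a - b| <= 2 c + b - a, whose sum is
    controlled by the total q^n. Subtracting the mean from each fibre is free because [chi] sums to
    zero. *)
Lemma Lsum_bound : exists B : nat, forall s, (1 < s)%N ->
  `|Lsum iota chi E s.*2| <= (B * q ^ s)%:R.
Proof.
set m := size g; set B := (m * q + q * (3 * m + 4))%N.
exists (2 * B + m.+1)%N => s s1; set n := s.*2.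
pose N z := size [seq x <- ext_points n | orbit_val n x == z].
have n0 : (0 < n)%N by rewrite double_gt0 ltnW.
have NB z : z != 0 -> (N z * q.-1 <= q ^ n + B * q ^ s)%N.
  by move=> z0; apply: stepanov_card.
have N0 : (N 0%R <= m.+1)%N by apply: orbit_val0_card.
have q1 : (1 < q)%N by apply: prime_gt1.
have sumN : (\sum_(z | z != 0%R) N z + N 0%R = q ^ n)%N.
  rewrite addnC -(bigD1 (0 : F) (P := xpredT)) //= -(size_ext_points K Fprime n0).
  rewrite -sum1_size (partition_big (orbit_val n) xpredT) //=.
  by apply: eq_bigr => z _; rewrite /N size_filter sum1_count.
have card0 : #|[pred z : F | z != 0]| = q.-1 by rewrite (cardC1 (0 : F)).
have e0 : 0 < (q.-1)%:R :> C by rewrite ltr0n -ltnS prednK // ltnW.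
rewrite -(ler_pM2l e0) -{1}(ger0_norm (ltW e0)) -normrM.
have -> : (q.-1)%:R * Lsum iota chi E n =
   \sum_(z | z != 0) chi z * ((N z * q.-1)%:R - (q ^ n)%:R).
  have -> : \sum_(z | z != 0) chi z * ((N z * q.-1)%:R - (q ^ n)%:R) =
      \sum_(z | z != 0) chi z * (N z * q.-1)%:R - (\sum_(z | z != 0) chi z) * (q ^ n)%:R.
    by rewrite mulr_suml -sumrB; apply: eq_bigr => z _; rewrite mulrBr.
  have -> : \sum_(z | z != 0) chi z = 0.
    by move: chi_sum; rewrite (bigD1 (0 : F)) //= chi0 add0r.
  rewrite mul0r subr0 LsumE (bigD1 (0 : F)) //= chi0 mul0r add0r mulr_sumr.
  by apply: eq_bigr => z _; rewrite /N natrM; ring.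
have bnd z : z != 0 -> `|chi z * ((N z * q.-1)%:R - (q ^ n)%:R)| <=
   (2 * (B * q ^ s))%:R + (q ^ n)%:R - (N z * q.-1)%:R.
  move=> /NB; move: (N z * q.-1)%N (q ^ n)%N (B * q ^ s)%N => a b c abc.
  rewrite normrM; apply: le_trans (_ : `|a%:R - b%:R| <= _).
    by rewrite ler_piMl.
  case: (leqP b a) => ba.
    rewrite -natrB // normr_nat -natrD -natrB ?ler_nat; lia.
  rewrite distrC -natrB ?(ltnW ba) // normr_nat -natrD -natrB ?ler_nat; lia.
apply: le_trans (ler_norm_sum _ _ _) _; apply: le_trans (ler_sum _ bnd) _.
rewrite sumrB sumr_const card0 -natr_sum -big_distrl /=.
rewrite -natrD -mulrnA -natrB; last first.
  rewrite mulnDl; apply: leq_trans (leq_addl _ _); rewrite leq_mul2r; apply/orP; right.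
  by rewrite -sumN leq_addr.
rewrite -natrM ler_nat -mulnBl mulnC leq_mul2l; apply/orP; right.
rewrite -sumN addnA addnAC addnK mulnDl leq_add //.
  by rewrite mulnA.
by apply: leq_trans N0 _; rewrite leq_pmulr // expn_gt0 ltnW.
Qed.

End LsumBound.

(** * Newton's identities and the size of reciprocal roots *)

Lemma newton_prod (C : comNzRingType) (w : seq C) (L := \prod_(z <- w) (1 - z *: 'X)) n :
  n%:R * L`_n = - \sum_(1 <= j < n.+1) (\sum_(z <- w) z ^+ j) * L`_(n - j).
Proof.
rewrite {}/L; elim: w n => [|z w IH] n.
  rewrite big_nil big1 ?oppr0 => [|j _]; last by rewrite big_nil mul0r.
  by rewrite coef1; case: n => [|n]; rewrite ?mul0r ?mulr0.
rewrite big_cons; set L := \prod_(_ <- w) _ in IH *.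
have cE k : ((1 - z *: 'X) * L)`_k = L`_k - z * (if k is k'.+1 then L`_k' else 0).
  rewrite mulrBl mul1r -scalerAl coefB coefZ coefXM.
  by case: k.
case: n => [|n]; first by rewrite big_geq // mul0r oppr0.
transitivity (- ((\sum_(1 <= j < n.+2) (\sum_(y <- w) y ^+ j) * L`_(n.+1 - j))
   - z * (\sum_(1 <= j < n.+1) (\sum_(y <- w) y ^+ j) * L`_(n - j)) + z * L`_n)).
  have -> : \sum_(1 <= j < n.+2) (\sum_(y <- w) y ^+ j) * L`_(n.+1 - j) = - (n.+1%:R * L`_n.+1).
    by rewrite IH opprK.
  have -> : \sum_(1 <= j < n.+1) (\sum_(y <- w) y ^+ j) * L`_(n - j) = - (n%:R * L`_n).
    by rewrite IH opprK.
  by rewrite cE -(natr1 n); ring.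
congr (- _); symmetry.
under eq_bigr => j _ do rewrite big_cons mulrDl addrC.
rewrite big_split /=; congr (_ + _).
  rewrite big_nat_recr //= [in RHS]big_nat_recr //= !subnn cE mulr0 subr0 [RHS]addrAC.
  congr (_ + _).
  rewrite mulr_sumr -sumrB; apply: eq_big_nat => j /andP[j1 jn].
  by rewrite subSn // cE; ring.
rewrite big_nat_recr //= subnn cE mulr0 subr0.
pose u j := - (z ^+ j * L`_(n.+1 - j)).
rewrite (eq_big_nat _ _ (F2 := fun j => u j.+1 - u j)); last first.
  by move=> j /andP[j1 jn]; rewrite /u subSn // cE exprSr subSS; ring.
by rewrite telescope_sumr // /u subnn subSS subn0 expr1; ring.
Qed.

(** As [c 0 = 1], the recursion determines S from c. By Newton's identities, minus the power sums of
    the reciprocal roots of the polynomial with coefficients c obey the same recursion; the constant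
    term 1 excludes the root 0. *)
Lemma power_sums_of_rec (C : numClosedFieldType) (c S : nat -> C) (s : nat) :
  c 0%N = 1 -> (forall n, (s <= n)%N -> c n = 0) ->
  (forall n, (0 < n)%N -> n%:R * c n = \sum_(1 <= j < n.+1) S j * c (n - j)%N) ->
  exists w : seq C, (size w < s)%N /\ forall n, (0 < n)%N -> S n = - \sum_(z <- w) z ^+ n.
Proof.
move=> c0 cs rec; pose L := \poly_(i < s) c i.
have cE n : L`_n = c n by rewrite coef_poly; case: ltnP => // /cs.
have L0 : L.[0] = 1 by rewrite horner_coef0 cE.
have Ln0 : L != 0 by apply: contra_eq_neq L0 => ->; rewrite horner0 eq_sym oner_eq0.
have [r rE] := closed_field_poly_normal L.
have r0 z : z \in r -> z != 0.
  move=> zr; apply: contra_eq_neq L0 => z0.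
  have -> : L.[0] = 0.
    rewrite rE hornerZ (_ : _.[0] = 0) ?mulr0 //.
    by apply/rootP; rewrite root_prod_XsubC -z0.
  by rewrite eq_sym oner_eq0.
have LE : L = \prod_(z <- [seq z^-1 | z <- r]) (1 - z *: 'X).
  rewrite big_map rE.
  have E : \prod_(z <- r) ('X - z%:P) = (\prod_(z <- r) (- z)) *: \prod_(z <- r) (1 - z^-1 *: 'X).
    rewrite -scaler_prod; apply: eq_big_seq => z /r0 z0.
    by rewrite -!mul_polyC mulrBr mulr1 mulrA -polyCM mulNr divff // !polyCN polyC1 mulN1r opprK addrC.
  have K : (lead_coef L) * \prod_(z <- r) (- z) = 1.
    rewrite -[RHS]L0 {2}rE E !hornerZ horner_prod [X in _ * (_ * X)]big1 ?mulr1 // => z _.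
    by rewrite hornerD hornerN hornerZ hornerX hornerC mulr0 subr0.
  by rewrite E scalerA K scale1r.
exists [seq z^-1 | z <- r]; split.
  rewrite size_map.
  have : (size L <= s)%N by apply: size_poly.
  by rewrite rE size_scale ?lead_coef_eq0 // size_prod_XsubC.
move=> n; elim/ltn_ind: n => n IH n0.
have := rec n n0; have := newton_prod [seq z^-1 | z <- r] n; rewrite -LE cE => ->.
rewrite -sumrN big_nat_recr //= [X in _ = X]big_nat_recr //= !subnn cE c0 !mulr1.
rewrite (eq_big_nat _ _ (F2 := fun j => S j * c (n - j)%N)) => [/addrI <- //|j /andP[j1 jn]].
by rewrite cE IH // mulNr.
Qed.

Lemma seq_max (R : numDomainType) (T : eqType) (f : T -> R) (s : seq T) (x : T) :
  (forall y, f y \is Num.real) -> x \in s ->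
  exists2 z, z \in s & {in s, forall y, f y <= f z}.
Proof.
move=> fr; elim: s x => // a s IH x _.
case: s IH => [_|b s IH]; first by exists a => [|y]; rewrite ?inE ?eqxx // => /eqP ->.
have [|z zs zmax] := IH b; first by rewrite inE eqxx.
case/orP: (real_leVge (fr a) (fr z)) => az.
  exists z => [|y]; first by rewrite inE zs orbT.
  by rewrite inE => /orP[/eqP -> //|]; apply: zmax.
exists a => [|y]; first by rewrite inE eqxx.
by rewrite inE => /orP[/eqP -> //|/zmax yz]; apply: le_trans az.
Qed.

Lemma archi_complex (R : realType) (D : R[i]) : (forall T : nat, T%:R <= D) -> False.
Proof.
move=> H.
have {}H T : T%:R <= complex.Re D.
  have := H T; rewrite -(rmorph_nat (real_complex R)) lecE => /andP[_].
  by rewrite /=.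
have D0 : 0 <= complex.Re D by have := H 0%N.
by have := archi_boundP D0; rewrite ltNge H.
Qed.

(* If z0 of maximal modulus had |z0| ^ 2 > Q, the sums over k < T of the power sums
   divided by z0 ^ (2 k) would stay bounded, while the z with z ^ 2 = z0 ^ 2 contribute
   at least T. *)
Lemma power_sums_bound (R : realType) (w : seq R[i]) (B Q : nat) : (0 < Q)%N ->
  (forall k, (1 < k)%N -> `|\sum_(z <- w) z ^+ k.*2| <= (B * Q ^ k)%:R) ->
  {in w, forall z, `|z| ^+ 2 <= Q%:R}.
Proof.
move=> Q0 H z1 z1w.
have [z0 z0w zmax] := @seq_max _ _ (fun z : R[i] => `|z|) w z1 (fun y => normr_real y) z1w.
apply: le_trans (_ : `|z0| ^+ 2 <= _); first by rewrite lerXn2r ?nnegrE ?normr_ge0 // zmax.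
have Qr : Q%:R \is @Num.real R[i] by rewrite realn.
have zr : `|z0| ^+ 2 \is Num.real by rewrite rpredX ?normr_real.
rewrite real_leNgt //; apply/negP => lt.
have Qp : 0 < Q%:R :> R[i] by rewrite ltr0n.
have z0p : 0 < `|z0| ^+ 2 by apply: lt_trans lt.
have z0n : z0 != 0 by apply: contraTneq z0p => ->; rewrite normr0 expr0n ltxx.
pose u z := (z / z0) ^+ 2.
pose r := Q%:R / `|z0| ^+ 2.
have r1 : 0 < 1 - r by rewrite subr_gt0 ltr_pdivrMr ?mul1r.
have r0 : 0 <= r by rewrite divr_ge0 // ltW.
have geom (v : R[i]) T : (1 - v) * \sum_(k < T) v ^+ k = 1 - v ^+ T.
  by rewrite -[1 - v ^+ T]opprB subrX1 -mulNr opprB.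
have u1 z : z \in w -> `|u z| <= 1.
  move=> zw; rewrite normrX exprn_ile1 // normrM normfV ler_pdivrMr ?normr_gt0 // mul1r.
  exact: zmax.
pose D := B%:R / (1 - r) + \sum_(z <- w | u z != 1) 2 / `|1 - u z|.
apply: (@archi_complex R D) => T.
pose A := \sum_(k < T) \sum_(z <- w) u z ^+ (k + 2).
have Ale : `|A| <= B%:R / (1 - r).
  apply: le_trans (ler_norm_sum _ _ _) _.
  apply: le_trans (_ : \sum_(k < T) B%:R * r ^+ k <= _).
    apply: ler_sum => k _; apply: le_trans (_ : B%:R * r ^+ (k + 2) <= _).
      have -> : \sum_(z <- w) u z ^+ (k + 2) = (\sum_(z <- w) z ^+ (k + 2).*2) / z0 ^+ (k + 2).*2.
        by rewrite mulr_suml; apply: eq_bigr => z _; rewrite /u -exprM mul2n exprMn exprVn.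
      rewrite normrM normfV ler_pdivrMr ?normr_gt0 ?expf_neq0 //.
      apply: le_trans (H _ _) _; first by rewrite addn2.
      rewrite normrX -mul2n exprM -mulrA -exprMn divfK ?gt_eqF //.
      by rewrite natrM natrX.
    rewrite ler_wpM2l ?ler0n // exprD ler_piMr ?exprn_ge0 // exprn_ile1 //.
    by rewrite -subr_ge0 ltW.
  rewrite -mulr_sumr ler_wpM2l ?ler0n // -(ler_pM2l r1) geom divff ?gt_eqF //.
  by rewrite gerBl exprn_ge0.
have AE : A = (\sum_(z <- w | u z == 1) T%:R) + \sum_(z <- w | u z != 1) \sum_(k < T) u z ^+ (k + 2).
  rewrite /A exchange_big /= (bigID (fun z => u z == 1)) /=; congr (_ + _).
  apply: eq_bigr => z /eqP ->; under eq_bigr do rewrite expr1n.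
  by rewrite sumr_const card_ord.
have Gle : `|\sum_(z <- w | u z != 1) \sum_(k < T) u z ^+ (k + 2)| <= \sum_(z <- w | u z != 1) 2 / `|1 - u z|.
  apply: le_trans (ler_norm_sum _ _ _) _.
  rewrite big_seq_cond [X in _ <= X]big_seq_cond; apply: ler_sum => z /andP[zw uz].
  have nz : 0 < `|1 - u z| by rewrite normr_gt0 subr_eq0 eq_sym.
  rewrite ler_pdivlMr // -normrM.
  have -> : (\sum_(k < T) u z ^+ (k + 2)) * (1 - u z) = u z ^+ 2 * (1 - u z ^+ T).
    have -> : \sum_(k < T) u z ^+ (k + 2) = u z ^+ 2 * \sum_(k < T) u z ^+ k.
      by rewrite mulr_sumr; apply: eq_bigr => k _; rewrite exprD mulrC.
    by rewrite -(geom (u z) T); ring.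
  rewrite normrM; apply: le_trans (_ : 1 * (1 + 1) <= _); last by rewrite mul1r.
  apply: ler_pM => //; first by rewrite normrX exprn_ile1 // u1.
  by apply: le_trans (ler_normB _ _) _; rewrite normr1 lerD2l normrX exprn_ile1 // u1.
have Tle : T%:R <= \sum_(z <- w | u z == 1) T%:R :> R[i].
  rewrite (big_rem z0) //= /u divff // expr1n eqxx lerDl; apply: sumr_ge0 => *.
  by rewrite ler0n.
have S0 : 0 <= \sum_(z <- w | u z == 1) T%:R :> R[i] by apply: le_trans Tle; rewrite ler0n.
apply: le_trans Tle _; rewrite -(ger0_norm S0).
have -> : \sum_(z <- w | u z == 1) T%:R = A - \sum_(z <- w | u z != 1) \sum_(k < T) u z ^+ (k + 2).
  by rewrite AE addrK.
by apply: le_trans (ler_normB _ _) _; rewrite lerD.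
Qed.

(** * Weil's bound for multiplicative characters *)

Section Weil.
Variables (R : realType) (F : finFieldType).
Hypothesis Fprime : prime #|F|.
Variable chi : F -> R[i].
Hypothesis chi0 : chi 0 = 0.
Hypothesis chi1 : chi 1 = 1.
Hypothesis chiM : {morph chi : x y / x * y}.
Variable a : F.
Hypothesis chia0 : a != 0.
Hypothesis chia : chi a != 1.

Lemma mulchar_norm_le1 x : `|chi x| <= 1.
Proof.
have [->|x0] := eqVneq x 0; first by rewrite chi0 normr0.
have cX n : chi (x ^+ n) = chi x ^+ n.
  by elim: n => [|n IH]; rewrite ?chi1 // !exprS chiM IH.
have q1 : (1 < #|F|)%N by apply: prime_gt1.
have : chi x ^+ #|F|.-1 = 1.
  have e : x ^+ #|F|.-1 = 1.
    by apply: (mulfI x0); rewrite mulr1 -exprS prednK ?expf_card // ltnW.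
  by rewrite -cX e chi1.
move=> /(congr1 Num.norm); rewrite normrX normr1 => /eqP.
by rewrite pexprn_eq1 ?normr_ge0 // => /orP[/eqP|/eqP -> //]; move: q1; case: #|F| => [|[]].
Qed.

Lemma mulchar_sum : \sum_v chi v = 0.
Proof.
have : chi a * \sum_v chi v = \sum_v chi v.
  rewrite mulr_sumr [RHS](reindex_inj (mulfI chia0)) /=.
  by apply: eq_bigr => v _; rewrite chiM.
move/eqP; rewrite -subr_eq0 -{2}[\sum_v _]mul1r -mulrBl mulf_eq0 subr_eq0.
by rewrite (negPf chia) => /eqP.
Qed.

(** The monic polynomials of degree one are the X - x, so the sum is the coefficient of T in the
    L-function: minus the sum of fewer than s reciprocal roots, each at most sqrt p in modulus.
    [E 0 = 1] stands in for the usual condition that the argument of [chi] is not a perfect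
    power. *)
Theorem weil_mulchar (E : F -> nat) (s : nat) : E 0 = 1%N -> (#|[pred b | E b != 0%N]| <= s)%N ->
  `|\sum_x \prod_b chi (b - x) ^+ E b| <= s%:R * sqrtC #|F|%:R.
Proof.
move=> E0 supp.
have [K [iota _]] := countable_algebraic_closure F.
have s0 : (0 < s)%N.
  by apply: leq_trans supp; apply/card_gt0P; exists 0; rewrite inE E0.
have L0 : Lcoef chi E 0 = 1.
  rewrite /Lcoef (big_pred1 0) => [|v]; last by rewrite /= [v]thinmx0 eqxx.
  rewrite /monic_of linear0 addr0 expr0 eval_wt1 //.
have rec := Lcoef_rec iota Fprime E chiM.
have [w [sw wE]] := power_sums_of_rec L0 (Lcoef_eq0 mulchar_sum E0 supp) rec.
have [B HB] := Lsum_bound iota Fprime E0 chi0 chi1 chiM mulchar_norm_le1 mulchar_sum.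
have bnd : {in w, forall z, `|z| ^+ 2 <= #|F|%:R}.
  apply: (@power_sums_bound _ _ B); first exact: prime_gt0.
  by move=> k k1; rewrite -normrN -wE ?double_gt0 ?HB // ltnW.
have -> : \sum_x \prod_b chi (b - x) ^+ E b = Lcoef chi E 1.
  rewrite /Lcoef (reindex (fun x : F => const_mx (- x) : 'rV_1)) /=; last first.
    exists (fun v : 'rV_1 => - v 0 0) => [x _|v _]; first by rewrite mxE opprK.
    by apply/rowP => i; rewrite mxE opprK ord1.
  apply: eq_bigr => x _; apply: eq_bigr => b _; congr (chi _ ^+ _).
  rewrite /monic_of hornerD hornerXn expr1; congr (_ + _).
  have -> : rVpoly (const_mx (- x) : 'rV_1) = (- x)%:P.
    apply/polyP => i; rewrite coef_rVpoly coefC; case: insubP => [j _ <-|].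
      by rewrite mxE ord1.
    by case: i.
  by rewrite hornerC.
have := rec 1%N isT; rewrite mul1r big_nat1 subnn L0 mulr1 => ->.
rewrite wE // normrN; apply: le_trans (ler_norm_sum _ _ _) _.
apply: le_trans (_ : \sum_(z <- w) sqrtC #|F|%:R <= _).
  rewrite big_seq_cond [X in _ <= X]big_seq_cond; apply: ler_sum => z /andP[zw _].
  by rewrite expr1 -[`|z|]sqrCK ?ler_sqrtC ?nnegrE ?exprn_ge0 ?ler0n ?bnd.
rewrite big_const_seq iter_addr_0 count_predT -[_ *+ size w]mulr_natl ler_wpM2r ?sqrtC_ge0 ?ler0n //.
by rewrite ler_nat ltnW.
Qed.

End Weil.

(** * Van der Corput differencing *)

Local Notation nrm := Normc.normc.

Section Norm.
Variable R : realType.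
Implicit Types z w : R[i].

Lemma nrmE z : `|z| = (nrm z)%:C%C. Proof. by []. Qed.

Lemma nrm_ge0 z : 0 <= nrm z.
Proof. by rewrite -lecR -nrmE normr_ge0. Qed.

Lemma nrmM z w : nrm (z * w) = nrm z * nrm w.
Proof. exact: Normc.normcM. Qed.

Lemma nrm0 : nrm (0 : R[i]) = 0. Proof. exact: Normc.normc0. Qed.
Lemma nrm1 : nrm (1 : R[i]) = 1. Proof. exact: Normc.normc1. Qed.

Lemma nrmN z : nrm (- z) = nrm z.
Proof. by apply: complexI; rewrite -!nrmE normrN. Qed.

Lemma nrmX z n : nrm (z ^+ n) = nrm z ^+ n.
Proof. by elim: n => [|n IH]; rewrite ?nrm1 // !exprS nrmM IH. Qed.

Lemma nrmV z : nrm z^-1 = (nrm z)^-1.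
Proof. exact: Normc.normcV. Qed.

Lemma nrm_nat n : nrm (n%:R : R[i]) = n%:R.
Proof. by apply: complexI; rewrite -nrmE normr_nat rmorph_nat. Qed.

Lemma nrmD z w : nrm (z + w) <= nrm z + nrm w.
Proof. by rewrite -lecR rmorphD /= -!nrmE ler_normD. Qed.

Lemma nrm_sum (I : Type) (r : seq I) (P : pred I) (f : I -> R[i]) :
  nrm (\sum_(i <- r | P i) f i) <= \sum_(i <- r | P i) nrm (f i).
Proof.
elim/big_rec2: _ => [|i y1 y2 _ h]; first by rewrite nrm0.
by apply: le_trans (nrmD _ _) _; rewrite lerD2l.
Qed.

Lemma nrmJ z : nrm (z^*)%C = nrm z.
Proof. by apply: complexI; rewrite -!nrmE normcJ. Qed.

Lemma conjM z w : (z * w)^*%C = z^*%C * w^*%C.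
Proof. exact: rmorphM. Qed.

Lemma conj_sum (I : Type) (r : seq I) (P : pred I) (f : I -> R[i]) :
  (\sum_(i <- r | P i) f i)^*%C = \sum_(i <- r | P i) (f i)^*%C.
Proof. exact: rmorph_sum. Qed.

Lemma mulcJ z : z * (z^*)%C = ((nrm z) ^+ 2)%:C%C.
Proof. by rewrite -sqr_normc nrmE rmorphXn. Qed.

End Norm.

Lemma sqr_sum_le (R : realFieldType) (n : nat) (x : nat -> R) :
  (\sum_(i < n) x i) ^+ 2 <= n%:R * \sum_(i < n) x i ^+ 2.
Proof.
set S := \sum_(i < n) x i.
case: n @S => [|n] S; first by rewrite /S big_ord0 expr0n mul0r.
have n0 : 0 < n.+1%:R :> R by rewrite ltr0n.
have : 0 <= \sum_(i < n.+1) (n.+1%:R * x i - S) ^+ 2 by apply: sumr_ge0 => i _; apply: sqr_ge0.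
have -> : \sum_(i < n.+1) (n.+1%:R * x i - S) ^+ 2 = n.+1%:R * (n.+1%:R * (\sum_(i < n.+1) x i ^+ 2) - S ^+ 2).
  transitivity (\sum_(i < n.+1) (n.+1%:R ^+ 2 * x i ^+ 2 + (- 2 * n.+1%:R * S) * x i + S ^+ 2)).
    by apply: eq_bigr => i _; ring.
  rewrite !big_split /= -!mulr_sumr -/S sumr_const card_ord -mulr_natl; ring.
by rewrite pmulr_rge0 // subr_ge0.
Qed.

Section VDC.
Variable R : realType.
Local Notation C := R[i].
Implicit Types F G : int -> C.

Definition interval_sum F (a : int) (L : nat) : C := \sum_(0 <= i < L) F (a + i%:Z).
Definition sums_bounded F (N : nat) (B : R) := forall a L, (L <= N)%N -> nrm (interval_sum F a L) <= B.
Definition diff_mul (h : int) F : int -> C := fun n => F n * (F (n + h))^*%C.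

Lemma sums_bounded_ge0 F N B : sums_bounded F N B -> 0 <= B.
Proof. by move=> /(_ 0 0%N isT); rewrite /interval_sum big_geq // nrm0. Qed.

Lemma sum_nat_supp (V : nmodType) (u : nat -> V) lo hi x y :
  (lo <= x)%N -> (y <= hi)%N -> (x <= hi)%N -> (forall j, ~~ ((x <= j) && (j < y))%N -> u j = 0) ->
  \sum_(lo <= j < hi) u j = \sum_(x <= j < y) u j.
Proof.
move=> lx yh xh u0; rewrite (@big_cat_nat _ _ _ x) //= [X in X + _]big_nat_cond big1 ?add0r; last first.
  by move=> j /andP[/andP[_ jx] _]; apply: u0; rewrite leqNgt jx.
case: (leqP x y) => xy; last first.
  rewrite [RHS]big_geq ?(ltnW xy) // big_nat_cond big1 // => j /andP[/andP[xj _] _].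
  by apply: u0; rewrite xj /= -leqNgt (leq_trans (ltnW xy)).
rewrite (@big_cat_nat _ _ _ y) //= [X in _ + X]big_nat_cond [X in _ + X]big1 ?addr0 //.
by move=> j /andP[/andP[yj _] _]; apply: u0; rewrite negb_and -leqNgt yj orbT.
Qed.

(** In truncated subtraction [(h - k) + (k - h)] is the distance between h and k, and a given
    distance occurs for at most two k. *)
Lemma sum_dist_le (B : nat -> R) H h : (forall l, 0 <= B l) -> (h < H)%N ->
  \sum_(0 <= k < H) B ((h - k) + (k - h))%N <= 2 * \sum_(0 <= l < H) B l.
Proof.
move=> B0 hH; have sub x y : (x <= y)%N -> \sum_(0 <= l < x) B l <= \sum_(0 <= l < y) B l.
  by move=> xy; rewrite [leRHS](@big_cat_nat _ _ _ x) //= lerDl sumr_ge0.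
rewrite (@big_cat_nat _ _ _ h) ?(ltnW hH) //= mulr2n mulrDl !mul1r; apply: lerD.
  rewrite big_nat_rev /= add0n.
  apply: le_trans (_ : \sum_(0 <= l < h) B l.+1 <= _).
    rewrite le_eqVlt; apply/orP; left; apply/eqP; apply: eq_big_nat => i /andP[_ ih].
    congr B; lia.
  apply: le_trans (sub h.+1 H hH); rewrite [leRHS]big_nat_recl //= lerDr //.
rewrite -{1}[h]add0n big_addn.
apply: le_trans (sub (H - h)%N H (leq_subr _ _)).
rewrite le_eqVlt; apply/orP; left; apply/eqP; apply: eq_big_nat => i _; congr B; lia.
Qed.

(** Shifting by a multiple of q does not change F, so the sum is an average over [H] shifts in which
    only G moves. Cauchy-Schwarz over the position removes F, and the opened square consists of
    correlations of G at distances l q. As [H * q <= N], at most 2 N positions matter, and each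
    distance occurs at most twice per shift: hence the constant 4. *)
Lemma vdc_step F G q H N (B : nat -> R) : (0 < H)%N -> (H * q <= N)%N ->
  (forall n, F (n + q%:Z) = F n) -> (forall n, nrm (F n) <= 1) ->
  (forall l, (l < H)%N -> sums_bounded (diff_mul (l * q)%N%:Z G) N (B l)) ->
  sums_bounded (fun n => F n * G n) N (Num.sqrt (4 * N%:R * ((\sum_(0 <= l < H) B l) / H%:R))).
Proof.
move=> H0 HqN Fq F1 HB a L LN; set S := interval_sum _ a L.
pose W := (H * q + L)%N.
(* Starting [H * q] before a keeps all shifted positions nonnegative when counted from b; [v] is G
   cut off to the original interval. *)
pose b : int := a - (H * q)%N%:Z.
pose v i : C := if (H * q <= i < W)%N then G (b + i%:Z) else 0.
pose f i : C := F (b + i%:Z).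
have fper i h : f (i + h * q)%N = f i.
  elim: h => [|h IH]; first by rewrite addn0.
  by rewrite -IH /f mulSn addnCA PoszD addrCA addrC Fq; congr F; rewrite PoszD addrA.
have SE h : (h < H)%N -> \sum_(0 <= i < W) f i * v (i + h * q)%N = S.
  move=> hH; transitivity (\sum_(0 <= i < W) (f (i + h * q)%N * v (i + h * q)%N)).
    by apply: eq_bigr => i _; rewrite fper.
  have hq : (h * q <= H * q)%N by rewrite leq_mul2r ltnW ?orbT.
  transitivity (\sum_(h * q <= j < W + h * q) f j * v j).
    by rewrite -[in RHS](add0n (h * q)%N) big_addn addnK.
  rewrite (@sum_nat_supp _ _ _ _ (H * q)%N W) ?leq_addr //; last 2 first.
  - by rewrite (leq_trans (leq_addr L _)) // leq_addr.
  - by move=> j /negPf jn; rewrite /v jn mulr0.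
  rewrite -{1}[(H * q)%N]add0n big_addn /W addKn; apply: eq_big_nat => i /andP[_ iL].
  rewrite /v /f leq_addl /= addnC ltn_add2l iL /b.
  by rewrite PoszD addrA subrK.
pose V i := \sum_(0 <= h < H) v (i + h * q)%N.
have HS : H%:R * S = \sum_(0 <= i < W) f i * V i.
  under eq_bigr do rewrite mulr_sumr.
  rewrite exchange_big_nat /= mulr_natl -[H in LHS]subn0 -sumr_const_nat.
  by apply: eq_big_nat => h /andP[_ /SE].
have B0 l : (l < H)%N -> 0 <= B l by move=> /HB /sums_bounded_ge0.
pose c h k := \sum_(0 <= i < W) v (i + h * q)%N * (v (i + k * q)%N)^*%C.
have cle h k : (h <= k)%N -> (k < H)%N -> nrm (c h k) <= B (k - h)%N.
  move=> hk kH; have lH : (k - h < H)%N by apply: leq_ltn_trans kH; apply: leq_subr.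
  have hq : (h * q <= H * q)%N by rewrite leq_mul2r ltnW ?orbT // (leq_ltn_trans hk).
  set l := (k - h)%N in lH *.
  have -> : c h k = \sum_(h * q <= j < W + h * q) v j * (v (j + l * q)%N)^*%C.
    rewrite -[in RHS](add0n (h * q)%N) big_addn addnK; apply: eq_bigr => i _.
    by congr (_ * (v _)^*%C); rewrite -addnA -mulnDl /l subnKC.
  rewrite (@sum_nat_supp _ _ _ _ (H * q)%N (W - l * q)%N) //; last 3 first.
  - by apply: leq_trans (leq_subr _ _) _; apply: leq_addr.
  - by rewrite (leq_trans (leq_addr L _)) // leq_addr.
  - move=> j; rewrite negb_and /v => /orP[/negPf -> /=|jl]; first by rewrite mul0r.
    have -> : (j + l * q < W)%N = false by apply/negbTE; move: jl; rewrite -!leqNgt; lia.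
    by rewrite andbF conjc0 mulr0.
  have := HB l lH a (L - l * q)%N (leq_trans (leq_subr _ _) LN).
  congr (nrm _ <= _); rewrite /interval_sum -{1}[(H * q)%N]add0n big_addn /W.
  have -> : (H * q + L - l * q - H * q = L - l * q)%N by lia.
  apply: eq_big_nat => i /andP[_ iL]; rewrite /diff_mul /v leq_addl /=.
  have -> : (i + H * q < H * q + L)%N by lia.
  have -> : (H * q <= i + H * q + l * q < H * q + L)%N by lia.
  congr (G _ * (G _)^*%C); rewrite /b !PoszD; ring.
have cle' h k : (h < H)%N -> (k < H)%N -> nrm (c h k) <= B ((h - k) + (k - h))%N.
  move=> hH kH; case: (leqP h k) => hk.
    by have := cle h k hk kH; rewrite -subn_eq0 in hk; rewrite (eqP hk).
  have -> : c h k = (c k h)^*%C.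
    by rewrite /c rmorph_sum; apply: eq_bigr => i _; rewrite rmorphM /= conjcK mulrC.
  rewrite nrmJ; have := cle k h (ltnW hk) hH.
  by have /eqP -> : (k - h == 0)%N; rewrite ?addn0 // subn_eq0 ltnW.
have V2 : \sum_(0 <= i < W) nrm (V i) ^+ 2 <= H%:R * (2 * \sum_(0 <= l < H) B l).
  rewrite -lecR; apply: le_trans (_ : `|\sum_(0 <= h < H) \sum_(0 <= k < H) c h k| <= _).
    rewrite le_eqVlt; apply/orP; left; apply/eqP.
    have -> : \sum_(0 <= h < H) \sum_(0 <= k < H) c h k = (\sum_(0 <= i < W) nrm (V i) ^+ 2)%:C%C.
      rewrite rmorph_sum /=; under [RHS]eq_bigr do rewrite -mulcJ /V rmorph_sum mulr_suml.
      rewrite [RHS]exchange_big_nat /=; apply: eq_bigr => h _.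
      rewrite exchange_big_nat /=; apply: eq_bigr => i _.
      by rewrite mulr_sumr.
    by rewrite ger0_norm // lecR sumr_ge0 // => i _; apply: sqr_ge0.
  rewrite nrmE lecR; apply: le_trans (nrm_sum _ _ _) _.
  apply: le_trans (_ : \sum_(0 <= h < H) (2 * \sum_(0 <= l < H) B l) <= _); last first.
    by rewrite sumr_const_nat subn0 -[_ *+ H]mulr_natl.
  apply: ler_sum_nat => h /andP[_ hH]; apply: le_trans (nrm_sum _ _ _) _.
  pose B' l := if (l < H)%N then B l else 0.
  apply: le_trans (_ : \sum_(0 <= k < H) B' ((h - k) + (k - h))%N <= _).
    apply: ler_sum_nat => k /andP[_ kH]; rewrite /B'.
    have -> : (h - k + (k - h) < H)%N by lia.
    exact: cle'.
  apply: le_trans (sum_dist_le _ hH) _; first by move=> l; rewrite /B'; case: ifP => // /B0.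
  by rewrite ler_wpM2l // ler_sum_nat // => l /andP[_ lH]; rewrite /B' lH.
have S2 : (H%:R * nrm S) ^+ 2 <= W%:R * (H%:R * (2 * \sum_(0 <= l < H) B l)).
  rewrite -[X in (X * nrm S) ^+ 2]nrm_nat -nrmM HS.
  apply: le_trans (_ : (\sum_(i < W) nrm (V i)) ^+ 2 <= _).
    rewrite lerXn2r ?nnegrE ?nrm_ge0 ?sumr_ge0 //= => [i _|]; first exact: nrm_ge0.
    rewrite big_mkord; apply: le_trans (nrm_sum _ _ _) _; apply: ler_sum => i _.
    by rewrite nrmM ler_piMl ?nrm_ge0 // /f F1.
  apply: le_trans (sqr_sum_le W (fun i => nrm (V i))) _; rewrite ler_wpM2l ?ler0n //.
  by move: V2; rewrite big_mkord.
have Hp : 0 < H%:R :> R by rewrite ltr0n.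
have sB : 0 <= \sum_(0 <= l < H) B l.
  by rewrite big_nat_cond sumr_ge0 // => l /andP[/andP[_ /B0]].
have W2 : W%:R <= 2 * N%:R :> R by rewrite -natrM ler_nat mul2n -addnn leq_add.
rewrite -[nrm S]ger0_norm ?nrm_ge0 // -sqrtr_sqr ler_wsqrtr //.
rewrite mulrA ler_pdivlMr // -(ler_pM2l Hp).
have -> : H%:R * (nrm S ^+ 2 * H%:R) = (H%:R * nrm S) ^+ 2 by ring.
apply: le_trans S2 _.
have -> : H%:R * (4 * N%:R * \sum_(0 <= l < H) B l) = (2 * N%:R) * (H%:R * (2 * \sum_(0 <= l < H) B l)) by ring.
by rewrite ler_wpM2r // mulr_ge0 // ?ler0n // mulr_ge0.
Qed.

End VDC.

(** * Iterated differencing and averages over shifts *)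

Definition periodic (T : Type) (m : nat) (F : int -> T) := forall n, F (n + m%:Z) = F n.

Lemma periodic_mul (T : Type) m (F : int -> T) n k : periodic m F -> F (n + m%:Z * k) = F n.
Proof.
move=> pF; have nat_case (j : nat) x : F (x + m%:Z * j%:Z) = F x.
  elim: j => [|j IH]; first by rewrite mulr0 addr0.
  by rewrite -addn1 PoszD mulrDr mulr1 addrA pF IH.
case: k => k; first exact: nat_case.
by rewrite NegzE mulrN -[in RHS](subrK (m%:Z * k.+1%:Z) n) nat_case.
Qed.

Lemma periodic_modz (T : Type) m (F : int -> T) n : periodic m F -> F (n %% m%:Z)%Z = F n.
Proof. by move=> pF; rewrite {2}(divz_eq n m) addrC mulrC periodic_mul. Qed.

Lemma sum_periodic_affine (V : nmodType) (G : int -> V) (b a : nat) (c : int) :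
  (0 < b)%N -> coprime a b -> periodic b G ->
  \sum_(0 <= j < b) G (c + (a * j)%N%:Z) = \sum_(0 <= j < b) G j%:Z.
Proof.
case: b => // b _ cop pG; rewrite !big_mkord.
pose r (n : int) : 'I_b.+1 := inord `|(n %% b.+1%:Z)%Z|%N.
have rE n : (r n)%:Z = (n %% b.+1%:Z)%Z.
  rewrite inordK ?gez0_abs ?modz_ge0 //.
  by rewrite -ltz_nat gez0_abs ?modz_ge0 ?ltz_pmod.
have inj : injective (fun j : 'I_b.+1 => r (c + (a * j)%N%:Z)).
  move=> j k /(congr1 (fun i : 'I_b.+1 => (i%:Z : int))); rewrite !rE => /eqP.
  rewrite eqz_mod_dvd opprD addrACA subrr add0r !PoszM -mulrBr => dv.
  have : (b.+1%:Z %| (j%:Z - k%:Z))%Z.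
    move: dv; rewrite Gauss_dvdzr //; by rewrite coprimezE /= coprime_sym.
  rewrite -eqz_mod_dvd !modz_small ?ltz_nat ?ltn_ord ?lez_nat //.
  by move=> /eqP [] /val_inj.
rewrite [RHS](reindex_inj inj) /=; apply: eq_bigr => j _.
by rewrite rE periodic_modz.
Qed.

Section Iteration.
Variable R : realType.
Local Notation C := R[i].
Implicit Types F G : int -> C.

Definition iter_sqrt k (x : R) := iter k Num.sqrt x.

Lemma iter_sqrt_ge0 k x : 0 <= x -> 0 <= iter_sqrt k x.
Proof. by case: k => //= k _; apply: sqrtr_ge0. Qed.

Lemma iter_sqrt_le k x y : 0 <= x -> x <= y -> iter_sqrt k x <= iter_sqrt k y.
Proof. by move=> x0 xy; elim: k => //= k IH; apply: ler_wsqrtr. Qed.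

(** Concavity of the 2 ^ k-th root, by Cauchy-Schwarz, one square root at a time. *)
Lemma iter_sqrt_avg k m (x : nat -> R) : (0 < m)%N -> (forall l, 0 <= x l) ->
  (\sum_(0 <= l < m) iter_sqrt k (x l)) / m%:R <= iter_sqrt k ((\sum_(0 <= l < m) x l) / m%:R).
Proof.
move=> m0 x0; have mp : 0 < m%:R :> R by rewrite ltr0n.
elim: k => //= k IH; rewrite -[leLHS]ger0_norm; last first.
  by rewrite divr_ge0 // sumr_ge0 // => l _; apply: sqrtr_ge0.
rewrite -sqrtr_sqr ler_wsqrtr //; apply: le_trans IH.
rewrite expr_div_n ler_pdivrMr ?exprn_gt0 // [m%:R ^+ 2]expr2 mulrA divfK ?gt_eqF //.
rewrite !big_mkord mulrC; apply: le_trans (sqr_sum_le m (fun i => Num.sqrt (iter_sqrt k (x i)))) _.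
rewrite ler_wpM2l ?ler0n //; apply: ler_sum => i _.
by rewrite sqr_sqrtr ?iter_sqrt_ge0.
Qed.

Lemma sums_bounded_le F N B B' : B <= B' -> sums_bounded F N B -> sums_bounded F N B'.
Proof. by move=> BB bF a L LN; apply: le_trans BB; apply: bF. Qed.

Lemma eq_sums_bounded F G N B : F =1 G -> sums_bounded F N B -> sums_bounded G N B.
Proof.
move=> FG bF a L LN; have -> : interval_sum G a L = interval_sum F a L by apply: eq_bigr => i _.
exact: bF.
Qed.

Lemma sums_bounded_unit c F N B : nrm c = 1 -> sums_bounded F N B -> sums_bounded (fun n => c * F n) N B.
Proof. by move=> c1 bF a L LN; rewrite /interval_sum -mulr_sumr nrmM c1 mul1r; apply: bF. Qed.

Lemma periodic_diff_mul m h F : periodic m F -> periodic m (diff_mul h F).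
Proof. by move=> pF n; rewrite /diff_mul addrAC !pF. Qed.

Lemma diff_mul_le1 h F : (forall n, nrm (F n) <= 1) -> forall n, nrm (diff_mul h F n) <= 1.
Proof. by move=> F1 n; rewrite nrmM nrmJ mulr_ile1 ?nrm_ge0. Qed.

Lemma eq_diff_mul h F G : F =1 G -> diff_mul h F =1 diff_mul h G.
Proof. by move=> FG n; rewrite /diff_mul !FG. Qed.

(* The average, over all k-tuples of shifts modulo m, of the normalised complete sums of
   the k-fold differences of F. *)
Fixpoint mean_diff k F (m : nat) : R :=
  if k is k'.+1 then (\sum_(0 <= l < m) mean_diff k' (diff_mul l%:Z F) m) / m%:R
  else nrm (interval_sum F 0 m) / m%:R.

Lemma eq_mean_diff k F G m : F =1 G -> mean_diff k F m = mean_diff k G m.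
Proof.
elim: k F G => [|k IH] F G FG /=.
  by congr (nrm _ / _); apply: eq_bigr => i _.
by congr (_ / _); apply: eq_bigr => l _; apply: IH; apply: eq_diff_mul.
Qed.

Lemma mean_diff_ge0 k F m : 0 <= mean_diff k F m.
Proof.
elim: k F => [|k IH] F /=; first by rewrite divr_ge0 ?nrm_ge0.
by rewrite divr_ge0 // sumr_ge0.
Qed.

Lemma periodic_mean_diff k F m : periodic m F -> periodic m (fun h => mean_diff k (diff_mul h F) m).
Proof. by move=> pF h; apply: eq_mean_diff => n; rewrite /diff_mul addrA pF. Qed.

Lemma mean_diff_affine k F m q : (0 < m)%N -> coprime q m -> periodic m F ->
  \sum_(0 <= l < m) mean_diff k (diff_mul (l * q)%N%:Z F) m = \sum_(0 <= l < m) mean_diff k (diff_mul l%:Z F) m.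
Proof.
move=> m0 cop pF; rewrite -(sum_periodic_affine 0 m0 cop (periodic_mean_diff k pF)).
by apply: eq_bigr => l _; rewrite add0r mulnC.
Qed.

Lemma interval_sum_cat F a L1 L2 : interval_sum F a (L1 + L2) = interval_sum F a L1 + interval_sum F (a + L1%:Z) L2.
Proof.
rewrite /interval_sum (@big_cat_nat _ _ _ L1) ?leq_addr //=; congr (_ + _).
rewrite -{1}[L1]add0n big_addn addKn; apply: eq_bigr => i _.
by rewrite addnC PoszD addrA.
Qed.

Lemma interval_sum_le F a L : (forall n, nrm (F n) <= 1) -> nrm (interval_sum F a L) <= L%:R.
Proof.
move=> F1; apply: le_trans (nrm_sum _ _ _) _.
apply: le_trans (ler_sum _ (fun i _ => F1 _)) _.
by rewrite sumr_const_nat subn0.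
Qed.

Lemma sums_bounded_complete F m N : (0 < m)%N -> periodic m F -> (forall n, nrm (F n) <= 1) ->
  sums_bounded F N (N%:R * mean_diff 0 F m + m%:R).
Proof.
move=> m0 pF F1 a L LN; have mp : 0 < m%:R :> R by rewrite ltr0n.
have full b : interval_sum F b m = interval_sum F 0 m.
  have := @sum_periodic_affine _ F m 1 b m0 (coprime1n m) pF.
  rewrite /interval_sum; under eq_bigr do rewrite mul1n.
  by move=> ->; apply: eq_bigr => i _; rewrite add0r.
have blocks t b : interval_sum F b (t * m)%N = t%:R * interval_sum F 0 m.
  elim: t b => [|t IH] b; first by rewrite mul0n mul0r /interval_sum big_geq.
  by rewrite mulSn interval_sum_cat full IH -natr1 mulrDl mul1r addrC.
rewrite (divn_eq L m) interval_sum_cat blocks; apply: le_trans (nrmD _ _) _.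
rewrite nrmM nrm_nat; apply: lerD.
  rewrite /= mulrA [_ / _]mulrAC ler_wpM2r ?nrm_ge0 // ler_pdivlMr // -natrM ler_nat.
  by apply: leq_trans LN; apply: leq_divM.
by apply: le_trans (interval_sum_le _ _ F1) _; rewrite ler_nat ltnW // ltn_mod.
Qed.

Fixpoint factor_prod (l : seq (nat * (int -> C))) G : int -> C :=
  if l is p :: l' then fun n => p.2 n * factor_prod l' G n else G.

(** [m * p.1 <= N] leaves room for m shifts by multiples of the period [p.1]; coprimality makes
    these shifts run once through the residues modulo m. *)
Fixpoint admissible (m N : nat) (l : seq (nat * (int -> C))) : Prop :=
  if l is p :: l' then [/\ periodic p.1 p.2, forall n, nrm (p.2 n) <= 1, (m * p.1 <= N)%N,
      coprime p.1 m & admissible m N l'] else True.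

Definition diff_mul_seq h (l : seq (nat * (int -> C))) := [seq (p.1, diff_mul h p.2) | p <- l].

Lemma admissible_diff_mul_seq m N h l : admissible m N l -> admissible m N (diff_mul_seq h l).
Proof.
elim: l => //= p l IH [pp p1 mp cp /IH ok]; split=> //; first exact: periodic_diff_mul.
exact: diff_mul_le1.
Qed.

Lemma diff_mul_factor_prod h l G : diff_mul h (factor_prod l G) =1 factor_prod (diff_mul_seq h l) (diff_mul h G).
Proof.
elim: l => //= p l IH n; rewrite -IH /diff_mul /= rmorphM /=; ring.
Qed.

(** Each step uses m shifts by multiples of the period of the head, so its average runs over all
    residues modulo m and is one level of [mean_diff]. The prefactor reproduces itself: the square
    root of 4 N times 4 N x is 4 N times that of x. The term m / N pays for the incomplete last
    period and is unchanged by averaging. *)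
Theorem vdc_iter m N l G : (0 < m)%N -> (0 < N)%N -> admissible m N l -> periodic m G ->
  (forall n, nrm (G n) <= 1) ->
  sums_bounded (factor_prod l G) N (4 * N%:R * iter_sqrt (size l) (mean_diff (size l) G m + m%:R / N%:R)).
Proof.
move=> m0 N0; have mp : 0 < m%:R :> R by rewrite ltr0n.
have Np : 0 < N%:R :> R by rewrite ltr0n.
move En: (size l) => n; elim: n l G En => [|n IH] [|[q F] l] //= G.
  move=> _ _ pG G1; apply: (sums_bounded_le _ (sums_bounded_complete (N := N) m0 pG G1)); rewrite /=.
  have -> : N%:R * (nrm (interval_sum G 0 m) / m%:R) + m%:R = N%:R * (nrm (interval_sum G 0 m) / m%:R + m%:R / N%:R).
    by field; rewrite !gt_eqF.
  rewrite -mulrA ler_peMl //; last by rewrite ler1n.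
  by rewrite mulr_ge0 ?ler0n // addr_ge0 // divr_ge0 ?nrm_ge0 ?ler0n.
move=> [En] [pF F1 mq cop ok] pG G1.
set x := fun h : nat => mean_diff n (diff_mul (h * q)%N%:Z G) m + m%:R / N%:R.
have x0 h : 0 <= x h by rewrite addr_ge0 ?mean_diff_ge0 // divr_ge0 ?ler0n.
apply: (sums_bounded_le _ (vdc_step m0 mq pF F1 (B := fun h => 4 * N%:R * iter_sqrt n (x h)) _)); last first.
  move=> h hm; apply: eq_sums_bounded (fsym (diff_mul_factor_prod _ _ _)) _.
  by apply: IH; [rewrite size_map | exact: admissible_diff_mul_seq | exact: periodic_diff_mul | exact: diff_mul_le1].
rewrite -mulr_sumr.
have -> : 4 * N%:R * (4 * N%:R * (\sum_(0 <= i < m) iter_sqrt n (x i)) / m%:R) =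
   (4 * N%:R) ^+ 2 * ((\sum_(0 <= i < m) iter_sqrt n (x i)) / m%:R) by ring.
have N4 : 0 <= 4 * N%:R :> R by rewrite mulr_ge0 ?ler0n.
rewrite sqrtrM ?exprn_ge0 // sqrtr_sqr (ger0_norm N4).
rewrite ler_wpM2l // ler_wsqrtr //.
apply: le_trans (iter_sqrt_avg _ m0 x0) _; apply: iter_sqrt_le.
  by rewrite divr_ge0 ?ler0n // sumr_ge0.
rewrite /x big_split /= mean_diff_affine // sumr_const_nat subn0 mulrDl lerD2l.
by rewrite -(mulr_natr (m%:R / N%:R) m) mulfK ?gt_eqF.
Qed.

(** One further differencing, with step 1: e(n) times the conjugate of e(n + h) does not depend on
    n, so the additive twist turns into a constant of modulus one at the price of one square
    root. *)
Theorem vdc_twist m N l G (e : int -> C) : (0 < m)%N -> (m <= N)%N -> admissible m N l -> periodic m G ->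
  (forall n, nrm (G n) <= 1) -> (forall n k, e (n + k) = e n * e k) -> (forall n, nrm (e n) = 1) ->
  sums_bounded (fun n => e n * factor_prod l G n) N
    (4 * N%:R * iter_sqrt (size l).+1 (mean_diff (size l).+1 G m + m%:R / N%:R)).
Proof.
move=> m0 mN ok pG G1 eD e1.
have N0 : (0 < N)%N by apply: leq_trans mN.
have mp : 0 < m%:R :> R by rewrite ltr0n.
have Np : 0 < N%:R :> R by rewrite ltr0n.
set x := fun h : nat => mean_diff (size l) (diff_mul h%:Z G) m + m%:R / N%:R.
have x0 h : 0 <= x h by rewrite addr_ge0 ?mean_diff_ge0 // divr_ge0 ?ler0n.
apply: (eq_sums_bounded (F := fun n => 1 * (e n * factor_prod l G n))) => [n|]; first by rewrite mul1r.
apply: (sums_bounded_le _ (@vdc_step R (fun=> 1) (fun n => e n * factor_prod l G n) 1 m N (fun h => 4 * N%:R * iter_sqrt (size l) (x h)) m0 _ _ _ _)); last 4 first.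
- by rewrite muln1.
- by [].
- by move=> n; rewrite nrm1.
- move=> h hm; rewrite muln1.
  apply: (eq_sums_bounded (F := fun n => (e h%:Z)^*%C * diff_mul h%:Z (factor_prod l G) n)).
    move=> n; rewrite /diff_mul eD !rmorphM /=.
    have ee : e n * (e n)^*%C = 1 by rewrite mulcJ e1 expr1n.
    by rewrite -[in LHS](mul1r (e h%:Z)^*%C) -ee; ring.
  apply: sums_bounded_unit; first by rewrite nrmJ.
  apply: eq_sums_bounded (fsym (diff_mul_factor_prod _ _ _)) _.
  have := vdc_iter m0 N0 (admissible_diff_mul_seq h%:Z ok) (periodic_diff_mul h%:Z pG) (diff_mul_le1 h%:Z G1).
  by rewrite /diff_mul_seq size_map.
rewrite -mulr_sumr.
have -> : 4 * N%:R * (4 * N%:R * (\sum_(0 <= i < m) iter_sqrt (size l) (x i)) / m%:R) =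
   (4 * N%:R) ^+ 2 * ((\sum_(0 <= i < m) iter_sqrt (size l) (x i)) / m%:R) by ring.
have N4 : 0 <= 4 * N%:R :> R by rewrite mulr_ge0 ?ler0n.
rewrite sqrtrM ?exprn_ge0 // sqrtr_sqr (ger0_norm N4).
rewrite ler_wpM2l // ler_wsqrtr //.
apply: le_trans (iter_sqrt_avg _ m0 x0) _; apply: iter_sqrt_le.
  by rewrite divr_ge0 ?ler0n // sumr_ge0.
rewrite /x big_split /= sumr_const_nat subn0 mulrDl lerD2l.
by rewrite -(mulr_natr (m%:R / N%:R) m) mulfK ?gt_eqF.
Qed.

End Iteration.

(** * Multiplicativity of the averages *)

Lemma sum_nat_mul (V : nmodType) (u : nat -> V) a b :
  \sum_(0 <= n < a * b) u n = \sum_(0 <= i < a) \sum_(0 <= j < b) u (i + a * j)%N.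
Proof.
elim: b => [|b IH].
  by rewrite muln0 big_geq // big1 // => i _; rewrite big_geq.
rewrite mulnS addnC (@big_cat_nat _ _ _ (a * b)%N) ?leq_addr //= IH.
rewrite -{1}[(a * b)%N in X in _ + X]add0n big_addn addKn -big_split /=.
by apply: eq_bigr => i _; rewrite big_nat_recr.
Qed.

Lemma sum_periodic_mul (A : comNzRingType) (F G : int -> A) a b : (0 < a)%N -> (0 < b)%N ->
  coprime a b -> periodic a F -> periodic b G ->
  \sum_(0 <= n < a * b) F n%:Z * G n%:Z = (\sum_(0 <= i < a) F i%:Z) * (\sum_(0 <= j < b) G j%:Z).
Proof.
move=> a0 b0 cop pF pG; rewrite sum_nat_mul mulr_suml; apply: eq_bigr => i _.
rewrite -(sum_periodic_affine i%:Z b0 cop pG) mulr_sumr; apply: eq_bigr => j _.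
by rewrite PoszD PoszM periodic_mul.
Qed.

Section MeanDiffMul.
Variable R : realType.
Implicit Types F G : int -> R[i].

(** Differencing a product differences both factors by the same shift, so [sum_periodic_mul] splits
    the complete sum and, level by level, each average over shifts. *)
Lemma mean_diff_mul k F G a b : (0 < a)%N -> (0 < b)%N -> coprime a b -> periodic a F -> periodic b G ->
  mean_diff k (fun n => F n * G n) (a * b) = mean_diff k F a * mean_diff k G b.
Proof.
move=> a0 b0 cop; elim: k F G => [|k IH] F G pF pG /=.
  have I0 H m : interval_sum H 0 m = \sum_(0 <= i < m) (H i%:Z : R[i]).
    by apply: eq_bigr => i _; rewrite add0r.
  by rewrite mulrACA -invfM -natrM -nrmM !I0 (sum_periodic_mul a0 b0 cop pF pG).
rewrite mulrACA -invfM -natrM; congr (_ / _).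
rewrite -(sum_periodic_mul a0 b0 cop (periodic_mean_diff k pF) (periodic_mean_diff k pG)).
apply: eq_bigr => l _; rewrite -IH; try exact: periodic_diff_mul.
by apply: eq_mean_diff => n; rewrite /diff_mul rmorphM /= mulrACA.
Qed.

Lemma mean_diff_le1 k F m : (0 < m)%N -> (forall n, nrm (F n) <= 1) -> mean_diff k F m <= 1.
Proof.
move=> m0; have mp : 0 < m%:R :> R by rewrite ltr0n.
elim: k F => [|k IH] F F1 /=.
  by rewrite ler_pdivrMr // mul1r interval_sum_le.
rewrite ler_pdivrMr // mul1r; apply: le_trans (ler_sum _ (fun l _ => IH _ (diff_mul_le1 _ F1))) _.
by rewrite sumr_const_nat subn0.
Qed.

End MeanDiffMul.

(** * Dirichlet characters and their components *)

Section Dirichlet.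
Variables (R : realType) (q : nat).
Hypothesis q0 : (0 < q)%N.
Variable chi : dirichlet_char R q.

Lemma dchar_periodic : periodic q chi. Proof. exact: dirichlet_periodic. Qed.

Lemma dchar1 : chi 1 = 1.
Proof.
have c1 : chi 1 != 0 by rewrite dirichlet_support coprimezE coprime1n.
by apply: (mulfI c1); rewrite mulr1 -dirichlet_mul mulr1.
Qed.

Lemma dchar_eqmod m n : (q%:Z %| m - n)%Z -> chi m = chi n.
Proof.
move=> /dvdzP[k mn]; rewrite -(subrK n m) mn addrC mulrC.
exact: (periodic_mul _ _ dchar_periodic).
Qed.

Lemma dcharX m n : chi (m ^+ n) = chi m ^+ n.
Proof. by elim: n => [|n IH]; rewrite ?dchar1 // !exprS dirichlet_mul IH. Qed.

Lemma dchar_eq0 n : ~~ coprimez n q%:Z -> chi n = 0.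
Proof. by move=> h; apply/eqP; move: h; rewrite -(dirichlet_support chi) negbK. Qed.

Lemma dchar_nrm1 n : coprimez n q%:Z -> nrm (chi n) = 1.
Proof.
move=> cop; pose m := `|(n %% q%:Z)%Z|%N.
have qn0 : q%:Z != 0 by rewrite eqz_nat -lt0n.
have mE : m%:Z = (n %% q%:Z)%Z by rewrite gez0_abs ?modz_ge0.
have chim : chi n = chi m%:Z by rewrite mE (periodic_modz _ dchar_periodic).
have copm : coprime m q.
  by have : coprimez m%:Z q%:Z by rewrite -(dirichlet_support chi) -chim dirichlet_support.
have e : chi n ^+ totient q = 1.
  rewrite chim -dcharX -dchar1; apply: dchar_eqmod.
  rewrite -eqz_mod_dvd; have := Euler_exp_totient copm => E.
  have -> : m%:Z ^+ totient q = (m ^ totient q)%N%:Z.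
    by elim: (totient q) => //= k IH; rewrite exprS expnS PoszM IH.
  by rewrite (modz_nat _ q) (modz_nat 1 q) E.
have := congr1 (@nrm R) e; rewrite nrmX nrm1 => /eqP.
rewrite pexprn_eq1 ?nrm_ge0 // => /orP[|/eqP //].
by rewrite eqn0Ngt totient_gt0 q0.
Qed.

Lemma dchar_nrm_le1 n : nrm (chi n) <= 1.
Proof.
have [/dchar_nrm1 -> //|/dchar_eq0 ->] := boolP (coprimez n q%:Z).
by rewrite nrm0.
Qed.

End Dirichlet.

Section Component.
Variables (R : realType) (q d e : nat) (chi : dirichlet_char R q) (u : int).
Hypothesis q0 : (0 < q)%N.
Hypothesis qde : q = (d * e)%N.
Hypothesis cop : coprime d e.
Hypothesis ud : (d%:Z %| u - 1)%Z.
Hypothesis ue : (e%:Z %| u)%Z.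

Lemma dvd_qde x : (d%:Z %| x)%Z -> (e%:Z %| x)%Z -> (q%:Z %| x)%Z.
Proof. by move=> dx ex; rewrite qde PoszM Gauss_dvdz ?dx. Qed.

(** The argument is congruent to n modulo d and to 1 modulo e, so this is the component of [chi]
    modulo d. *)
Definition char_comp_fun (n : int) := chi (u * n + (1 - u)).

Lemma char_comp_periodic n : char_comp_fun (n + d%:Z) = char_comp_fun n.
Proof.
apply: dchar_eqmod; rewrite (_ : _ - _ = u * d%:Z); last by ring.
by apply: dvd_qde; [apply: dvdz_mull | apply: dvdz_mulr].
Qed.

Lemma char_comp_mul m n : char_comp_fun (m * n) = char_comp_fun m * char_comp_fun n.
Proof.
rewrite -dirichlet_mul; apply: dchar_eqmod.
rewrite (_ : _ - _ = (u * (u - 1)) * (m + n - m * n - 1)); last by ring.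
by apply: dvd_qde; apply: dvdz_mulr; [apply: dvdz_mull | apply: dvdz_mulr].
Qed.

Lemma coprimez_eqmod (m n k : int) : (k %| m - n)%Z -> coprimez m k = coprimez n k.
Proof.
move=> /dvdzP[c E]; rewrite /coprimez -(subrK n m) E addrC.
by rewrite gcdzC [gcdz n k]gcdzC addrC gcdzMDl.
Qed.

Lemma char_comp_support n : (char_comp_fun n != 0) = coprimez n d%:Z.
Proof.
rewrite dirichlet_support qde PoszM coprimezMr.
rewrite (@coprimez_eqmod _ n d%:Z); last first.
  by rewrite (_ : _ - n = (u - 1) * (n - 1)) ?dvdz_mulr //; ring.
rewrite (@coprimez_eqmod _ 1 e%:Z); last first.
  by rewrite (_ : _ - 1 = u * (n - 1)) ?dvdz_mulr //; ring.
by rewrite [coprimez 1 _]coprimezE coprime1n andbT.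
Qed.

Definition char_comp : dirichlet_char R d := DirichletChar char_comp_periodic char_comp_mul char_comp_support.

End Component.

(** * Characters of prime modulus *)

Lemma sqrtC_nat (R : realType) (n : nat) : sqrtC (n%:R : R[i]) = (Num.sqrt (n%:R : R))%:C%C.
Proof.
apply/eqP; rewrite -(@eqrXn2 _ 2) ?sqrtC_ge0 ?ler0n ?lecR ?sqrtr_ge0 //.
by rewrite sqrtCK -rmorphXn /= sqr_sqrtr ?ler0n // rmorph_nat.
Qed.

Section PrimeModulus.
Variables (R : realType) (p : nat).
Hypothesis p_prime : prime p.
Hypothesis p_odd : (2 < p)%N.
Variable psi : dirichlet_char R p.
Variable n0 : int.
Hypothesis n0_cop : coprimez n0 p%:Z.
Hypothesis n0_psi : psi n0 != 1.

Let p0 : (0 < p)%N. Proof. exact: prime_gt0. Qed.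

Definition Fp_char (x : 'F_p) : R[i] := psi (nat_of_ord x)%:Z.

Lemma Fp_charE (n : int) : Fp_char (n%:~R) = psi n.
Proof.
apply: dchar_eqmod; rewrite (dvdz_pcharf (pchar_Fp p_prime)).
by rewrite intrB -pmulrn natr_Zp subrr.
Qed.

Lemma Fp_char0 : Fp_char 0 = 0.
Proof.
apply: dchar_eq0; rewrite /= coprimezE /= /coprime gcd0n.
by case: eqP p_odd => // ->.
Qed.

Lemma Fp_char1 : Fp_char 1 = 1.
Proof. by rewrite -[1]/((1 : int)%:~R) Fp_charE dchar1. Qed.

Lemma Fp_charM : {morph Fp_char : x y / x * y}.
Proof.
move=> x y; have E z : z = ((nat_of_ord z)%:Z)%:~R :> 'F_p by rewrite -pmulrn natr_Zp.
by rewrite {1}(E x) {1}(E y) -intrM Fp_charE dirichlet_mul.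
Qed.

(* On units conjugation is inversion, that is the power p - 2, which also fits at 0. *)
Lemma Fp_char_conj x : (Fp_char x)^*%C = Fp_char x ^+ (p - 2).
Proof.
have [->|x0] := eqVneq x 0; first by rewrite Fp_char0 conjc0 expr0n; case: (p - 2)%N (subn_gt0 2 p); rewrite ?p_odd //.
have XX n : Fp_char (x ^+ n) = Fp_char x ^+ n.
  by elim: n => [|n IH]; rewrite ?Fp_char1 // !exprS Fp_charM IH.
have Xp1' : Fp_char x ^+ p.-1 = 1.
  rewrite -XX -Fp_char1; congr Fp_char; apply: (mulfI x0); rewrite mulr1 -exprS prednK //.
  by have := expf_card x; rewrite card_Fp.
have Xn1 : nrm (Fp_char x) = 1.
  have := congr1 (@nrm R) Xp1'; rewrite nrmX nrm1 => /eqP.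
  rewrite pexprn_eq1 ?nrm_ge0 // => /orP[/eqP|/eqP //]; move: p_odd; lia.
have Xn0 : Fp_char x != 0 by apply: contra_eq_neq Xn1 => ->; rewrite nrm0 eq_sym oner_eq0.
apply: (mulfI Xn0); rewrite mulcJ Xn1 expr1n -exprS.
by have -> : (p - 2).+1 = p.-1 by [lia]; rewrite Xp1'.
Qed.

(** A class closed under differencing, because conjugation is a power by [Fp_char_conj]. The new
    exponents are [diff_exponents], and the number of factors at most doubles. *)
Definition Fp_char_prod (E : 'F_p -> nat) (n : int) : R[i] := \prod_b Fp_char (b + n%:~R) ^+ E b.
Definition diff_exponents (h : int) (E : 'F_p -> nat) (b : 'F_p) : nat := (E b + (p - 2) * E (b - h%:~R)%R)%N.

Lemma diff_mul_Fp_char_prod E h : diff_mul h (Fp_char_prod E) =1 Fp_char_prod (diff_exponents h E).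
Proof.
move=> n; rewrite /diff_mul /Fp_char_prod rmorph_prod /=.
have -> : \prod_(b : 'F_p) (Fp_char (b + (n + h)%:~R) ^+ E b)^*%C =
   \prod_(b : 'F_p) Fp_char (b + n%:~R) ^+ ((p - 2) * E (b - h%:~R)%R).
  rewrite [RHS](reindex_inj (addIr (h%:~R : 'F_p))) /=; apply: eq_bigr => b _.
  by rewrite rmorphXn /= Fp_char_conj addrK -exprM intrD addrA addrAC.
by rewrite -big_split /=; apply: eq_bigr => b _; rewrite -exprD.
Qed.

Lemma Fp_char_prod_nrm_le1 E n : nrm (Fp_char_prod E n) <= 1.
Proof.
rewrite /Fp_char_prod; elim/big_rec: _ => [|b y _ y1]; first by rewrite nrm1.
by rewrite nrmM mulr_ile1 ?nrm_ge0 // nrmX exprn_ile1 ?nrm_ge0 // dchar_nrm_le1.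
Qed.

Definition num_factors (E : 'F_p -> nat) := #|[pred b | E b != 0%N]|.

Lemma num_factors_diff h E : (num_factors (diff_exponents h E) <= 2 * num_factors E)%N.
Proof.
apply: (@leq_trans #|predU [pred b | E b != 0%N] [pred b | E (b - h%:~R)%R != 0%N]|).
  apply: subset_leq_card; apply/fintype.subsetP => b; rewrite !inE /diff_exponents addn_eq0 negb_and.
  by case/orP => [-> //|]; rewrite muln_eq0 negb_or => /andP[_ ->]; rewrite orbT.
have cB : #|[pred b | E (b - h%:~R)%R != 0%N]| = num_factors E.
  rewrite /num_factors -!sum1_card [RHS](reindex_inj (addIr (- h%:~R : 'F_p))) /=.
  by apply: eq_bigl => b; rewrite !inE.
have := cardUI [pred b | E b != 0%N] [pred b | E (b - h%:~R)%R != 0%N].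
by rewrite cB -/(num_factors E) addnn -mul2n => <-; apply: leq_addr.
Qed.

Lemma sum_Fp (V : nmodType) (f : 'F_p -> V) : \sum_(0 <= i < p) f (i%:Z)%:~R = \sum_x f x.
Proof.
rewrite -{1}(Fp_cast p_prime) big_mkord; apply: eq_bigr => i _.
by rewrite -pmulrn natr_Zp.
Qed.

Lemma Fp_char_prod_complete E : E 0 = 1%N -> mean_diff 0 (Fp_char_prod E) p <= (num_factors E)%:R / Num.sqrt p%:R.
Proof.
move=> E0 /=; have pp : 0 < p%:R :> R by rewrite ltr0n.
have sp : 0 < Num.sqrt p%:R :> R by rewrite sqrtr_gt0.
have pE : p%:R = Num.sqrt p%:R * Num.sqrt p%:R :> R by rewrite -expr2 sqr_sqrtr ?ler0n.
suff H : nrm (interval_sum (Fp_char_prod E) 0 p) <= (num_factors E)%:R * Num.sqrt p%:R.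
  rewrite ler_pdivrMr // {2}pE mulrA divfK ?gt_eqF //.
have -> : interval_sum (Fp_char_prod E) 0 p = \sum_x \prod_b Fp_char (b - x) ^+ E b.
  rewrite [RHS](reindex_inj (@oppr_inj 'F_p)) /= -sum_Fp; apply: eq_bigr => i _.
  by rewrite add0r /Fp_char_prod; under [RHS]eq_bigr do rewrite opprK.
have n1 : n0%:~R != 0 :> 'F_p.
  apply: contraTneq n0_cop => nz; rewrite -(dirichlet_support psi) -Fp_charE nz Fp_char0 eqxx //.
have := @weil_mulchar R 'F_p _ Fp_char Fp_char0 Fp_char1 Fp_charM n0%:~R n1 _ E (num_factors E) E0 (leqnn _).
rewrite card_Fp // Fp_charE => /(_ p_prime n0_psi).
by rewrite sqrtC_nat nrmE -(rmorph_nat (real_complex R)) -rmorphM lecR.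
Qed.

(* A difference of a product with E 0 = 1 is again of that form unless the shift -l is
   in the support of E; these few shifts are bounded trivially. *)
Lemma mean_diff_Fp_char_prod k E s : E 0 = 1%N -> (num_factors E <= s)%N ->
  mean_diff k (Fp_char_prod E) p <= (s * (2 ^ k.+1).-1)%:R / Num.sqrt p%:R.
Proof.
have pp : 0 < p%:R :> R by rewrite ltr0n.
have sp : 0 < Num.sqrt p%:R :> R by rewrite sqrtr_gt0.
have pE : p%:R = Num.sqrt p%:R * Num.sqrt p%:R :> R by rewrite -expr2 sqr_sqrtr ?ler0n.
have sp1 : 1 <= Num.sqrt p%:R :> R by rewrite -{1}sqrtr1 ler_wsqrtr // ler1n.
elim: k E s => [|k IH] E s E0 sE.
  apply: le_trans (Fp_char_prod_complete E0) _; rewrite muln1 ler_pM2r ?invr_gt0 // ler_nat //.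
rewrite [mean_diff _ _ _]/=; set t := ((2 * s) * (2 ^ k.+1).-1)%N.
apply: le_trans (_ : (\sum_(0 <= l < p) ((E (- (l%:Z)%:~R) != 0%N)%:R + t%:R / Num.sqrt p%:R)) / p%:R <= _).
  rewrite ler_pM2r ?invr_gt0 //; apply: ler_sum => l _.
  rewrite (eq_mean_diff _ _ (diff_mul_Fp_char_prod E l%:Z)).
  have [El|El] := eqVneq (E (- (l%:Z)%:~R)) 0%N.
    rewrite add0r; apply: IH.
      by rewrite /diff_exponents sub0r El muln0 addn0.
    by apply: leq_trans (num_factors_diff _ _) _; rewrite leq_mul2l.
  apply: le_trans (mean_diff_le1 _ p0 (Fp_char_prod_nrm_le1 _)) _.
  by rewrite lerDl divr_ge0 ?ler0n ?ltW.
rewrite big_split /= sumr_const_nat subn0.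
have -> : \sum_(0 <= l < p) (E (- (l%:Z)%:~R) != 0%N)%:R = (num_factors E)%:R :> R.
  rewrite (sum_Fp (fun x => (E (- x) != 0%N)%:R)) -(reindex_inj (@oppr_inj 'F_p) (P := xpredT) (F := fun x => (E x != 0%N)%:R)) /=.
  by rewrite -natr_sum /num_factors -sum1_card [in RHS]big_mkcond /=; congr (_%:R); apply: eq_bigr => x _; rewrite inE; case: ifP.
rewrite mulrDl -(mulr_natr (t%:R / Num.sqrt p%:R) p) mulfK ?gt_eqF //.
(* The degenerate shifts cost at most s / p, hence at most s / sqrt p. Together with t this is s + 2
   s (2 ^ (k + 1) - 1) = s (2 ^ (k + 2) - 1). *)
apply: le_trans (_ : s%:R / Num.sqrt p%:R + t%:R / Num.sqrt p%:R <= _).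
  rewrite lerD2r {1}pE invfM mulrA; apply: le_trans (_ : (num_factors E)%:R / Num.sqrt p%:R <= _).
    by rewrite ler_piMr ?divr_ge0 ?ler0n ?(ltW sp) // invf_le1.
  by rewrite ler_pM2r ?invr_gt0 // ler_nat.
rewrite -mulrDl -natrD ler_pM2r ?invr_gt0 // ler_nat /t.
have : (0 < 2 ^ k.+1)%N by rewrite expn_gt0.
rewrite (expnS 2 k.+1); move: (2 ^ k.+1)%N => w w0.
have -> : (2 * s * w.-1 = s * (2 * w.-1))%N by rewrite mulnA [(s * 2)%N]mulnC.
by rewrite -{1}[s]muln1 -mulnDr leq_mul2l; apply/orP; right; lia.
Qed.

Lemma mean_diff_prime_odd k : mean_diff k psi p <= (2 ^ k.+1)%:R / Num.sqrt p%:R.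
Proof.
pose E (b : 'F_p) : nat := (b == 0).
have E0 : E 0 = 1%N by rewrite /E eqxx.
have sE : (num_factors E <= 1)%N.
  rewrite /num_factors -(card1 (0 : 'F_p)); apply: subset_leq_card; apply/fintype.subsetP => b.
  by rewrite !inE /E; case: (b == 0).
have eqF : psi =1 Fp_char_prod E.
  move=> n; rewrite /Fp_char_prod (bigD1 0) //= big1 => [|b /negPf b0]; last by rewrite /E b0 expr0.
  by rewrite E0 expr1 mulr1 add0r Fp_charE.
rewrite (eq_mean_diff _ _ eqF); apply: le_trans (mean_diff_Fp_char_prod k E0 sE) _.
by rewrite mul1n ler_pM2r ?invr_gt0 ?sqrtr_gt0 ?ltr0n // ler_nat leq_pred.
Qed.

End PrimeModulus.

(** For p = 2 the power p - 2 no longer represents conjugation at 0, but there the trivial bound 1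
    is already below 2 ^ (k + 1) / sqrt 2. *)
Lemma mean_diff_prime (R : realType) p (psi : dirichlet_char R p) n0 k : prime p ->
  coprimez n0 p%:Z -> psi n0 != 1 -> mean_diff k psi p <= (2 ^ k.+1)%:R / Num.sqrt p%:R.
Proof.
move=> pp c0 p1; case: (ltnP 2 p) => p2; first exact: (mean_diff_prime_odd pp p2 c0 p1).
have p2' : p = 2%N by move: (prime_gt1 pp) p2; lia.
apply: le_trans (mean_diff_le1 _ (prime_gt0 pp) (dchar_nrm_le1 (prime_gt0 pp) psi)) _.
have sp : 0 < Num.sqrt p%:R :> R by rewrite sqrtr_gt0 ltr0n prime_gt0.
rewrite ler_pdivlMr // mul1r expnS natrM.
apply: le_trans (_ : 2 * 1 <= _); last by rewrite ler_wpM2l // ler1n expn_gt0.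
rewrite mulr1 -[leRHS](ger0_norm (ler0n _ 2)) -sqrtr_sqr ler_wsqrtr //.
by rewrite p2' -natrX ler_nat.
Qed.

(** * Characters of squarefree modulus *)

Section Grouping.
Local Open Scope nat_scope.

Definition seq_prod (l : seq nat) := \prod_(p <- l) p.

Lemma seq_prod_gt0 l : all (leq 1) l -> 0 < seq_prod l.
Proof.
by elim: l => [|p l IH] /=; rewrite /seq_prod ?big_nil // big_cons muln_gt0 => /andP[-> /IH].
Qed.

(** The shortest prefix whose product reaches Z overshoots by at most its last factor. *)
Lemma prefix_product (P Z : nat) l : 0 < Z -> 0 < P -> all (fun p => p <= P) l -> Z <= seq_prod l ->
  exists l1 l2, [/\ l = l1 ++ l2, Z <= seq_prod l1 & seq_prod l1 <= Z * P].
Proof.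
move=> Z0 P0; elim/last_ind: l => [|l p IH] allP Zl.
  by exists [::], [::]; split=> //; rewrite /seq_prod big_nil muln_gt0 Z0.
move: allP; rewrite all_rcons => /andP[pP lP].
case: (leqP Z (seq_prod l)) => h; last first.
  exists (rcons l p), [::]; split=> //; first by rewrite cats0.
  by rewrite /seq_prod -cats1 big_cat /= big_seq1 leq_mul // ltnW.
have [l1 [l2 [E h1 h2]]] := IH lP h.
by exists l1, (rcons l2 p); split=> //; rewrite E -rcons_cat.
Qed.

(** Greedy grouping from the right: the head group is the one still being filled, so it alone may
    stay below Y, and a number joins it only while it does. *)
Lemma group_product (P Y : nat) l : 0 < Y -> all (fun p => p <= P) l ->
  exists gs : seq (seq nat), [/\ flatten gs = l, all (fun g => seq_prod g <= Y * P) gs &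
    all (fun g => Y <= seq_prod g) (behead gs)].
Proof.
move=> Y0; elim: l => [|p l IH] /=; first by exists [::].
move=> /andP[pP /IH[[|g gs] /= [fl h1 h2]]].
  exists [:: [:: p]]; split=> //=; first by rewrite -fl.
  by rewrite andbT /seq_prod big_seq1 (leq_trans pP) // leq_pmull.
case: (leqP Y (seq_prod g)) => gY.
  exists ([:: p] :: g :: gs); split=> //=; first by rewrite fl.
    by rewrite h1 andbT /seq_prod big_seq1 (leq_trans pP) // leq_pmull.
  by rewrite gY h2.
exists ((p :: g) :: gs); split=> //=; first by rewrite fl.
move/andP: h1 => [_ ->]; rewrite andbT /seq_prod big_cons mulnC leq_mul // ltnW //.
Qed.

Lemma seq_prod_flatten gs : seq_prod (flatten gs) = \prod_(g <- gs) seq_prod g.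
Proof. by rewrite /seq_prod big_flatten. Qed.

Lemma size_groups (Y : nat) gs : all (leq 1) (flatten gs) -> all (fun g => Y <= seq_prod g) (behead gs) ->
  Y ^ (size gs).-1 <= seq_prod (flatten gs).
Proof.
case: gs => [|g gs] /=; first by rewrite /seq_prod big_nil.
rewrite all_cat => /andP[g1 _] h; rewrite /seq_prod big_cat /= -/(seq_prod g) -/(seq_prod (flatten gs)) seq_prod_flatten.
apply: leq_trans (leq_pmull _ (seq_prod_gt0 g1)).
by elim: gs h => [|g' gs IH] /=; rewrite ?big_nil // expnS big_cons => /andP[h /IH]; apply: leq_mul.
Qed.

Lemma seq_prod_primes n : 0 < n -> squarefree n -> seq_prod (primes n) = n.
Proof.
move=> n0 sq; rewrite [RHS](prod_prime_decomp n0) prime_decompE big_map /=.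
apply: eq_big_seq => p; rewrite mem_primes => /and3P[pp _ pn].
suff -> : logn p n = 1 by rewrite expn1.
apply/eqP; rewrite eqn_leq; apply/andP; split; last by rewrite -pfactor_dvdn ?expn1.
rewrite leqNgt; apply/negP => l2.
have : p ^ 2 %| n by rewrite pfactor_dvdn.
by move=> /sq p1; rewrite p1 in pp.
Qed.

End Grouping.

Section Squarefree.
Variables (R : realType) (q : nat).
Hypothesis q0 : (0 < q)%N.
Hypothesis sqf : squarefree q.
Variable chi : dirichlet_char R q.

Lemma coprime_div_prime p : p \in primes q -> coprime p (q %/ p).
Proof.
rewrite mem_primes => /and3P[pp _ pq]; rewrite prime_coprime //.
apply/negP => /dvdnP[k E]; have : (p ^ 2 %| q)%N.
  by rewrite -(divnK pq) E -mulnA dvdn_mull.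
by move=> /sqf p1; rewrite p1 in pp.
Qed.

(* Congruent to 1 modulo p and to 0 modulo q / p. *)
Definition crt_idem p : int := zchinese p%:Z (q %/ p)%N%:Z 1 0.

Lemma crt_idem_modl p : p \in primes q -> (p%:Z %| crt_idem p - 1)%Z.
Proof.
move=> pq; rewrite -eqz_mod_dvd; apply/eqP; apply: zchinese_modl.
by rewrite coprimezE /= coprime_div_prime.
Qed.

Lemma crt_idem_modr p : p \in primes q -> ((q %/ p)%N%:Z %| crt_idem p)%Z.
Proof.
move=> pq; rewrite -[crt_idem p]subr0 -eqz_mod_dvd; apply/eqP; apply: zchinese_modr.
by rewrite coprimezE /= coprime_div_prime.
Qed.

Definition local_char p (n : int) : R[i] := chi (crt_idem p * n + (1 - crt_idem p)).

Lemma dvd_primes_dvd (x : int) : (forall p, p \in primes q -> (p%:Z %| x)%Z) -> (q%:Z %| x)%Z.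
Proof.
move=> H; rewrite dvdzE /= -(seq_prod_primes q0 sqf) /seq_prod.
have : forall p, p \in primes q -> (p %| `|x|)%N by move=> p /H; rewrite dvdzE.
have := primes_uniq q; have : all prime (primes q) by apply/allP => p; rewrite mem_primes => /andP[].
elim: (primes q) => [|p l IH] /=; first by rewrite big_nil dvd1n.
move=> /andP[pp lp] /andP[pl ul] h; rewrite big_cons Gauss_dvd; last first.
  rewrite prime_coprime //; apply/negP; rewrite Euclid_dvd_prod // big_has => /hasP[r rl pr]; move/allP/(_ r rl): lp => rp.
  by move: pl; rewrite (eqP (_ : p == r)) ?rl // -dvdn_prime2.
by rewrite h ?mem_head // IH // => r rl; apply: h; rewrite inE rl orbT.
Qed.

Lemma prod_eq1_mod (k : int) (l : seq nat) (f : nat -> int) :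
  (forall p, p \in l -> (k %| f p - 1)%Z) -> (k %| \prod_(p <- l) f p - 1)%Z.
Proof.
elim: l => [|p l IH] h; first by rewrite big_nil subrr dvdz0.
rewrite big_cons (_ : _ - 1 = f p * (\prod_(r <- l) f r - 1) + (f p - 1)); last by ring.
by rewrite rpredD ?dvdz_mull ?h ?mem_head // IH // => r rl; apply: h; rewrite inE rl orbT.
Qed.

Lemma prod_local_char n : chi n = \prod_(p <- primes q) local_char p n.
Proof.
have chi_prod (l : seq nat) (f : nat -> int) : chi (\prod_(p <- l) f p) = \prod_(p <- l) chi (f p).
  elim: l => [|p l IH]; first by rewrite !big_nil dchar1.
  by rewrite !big_cons dirichlet_mul IH.
rewrite -chi_prod; apply: dchar_eqmod; apply: dvd_primes_dvd => p pq.
rewrite (big_rem p) //=; set X := \prod_(r <- _) _.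
rewrite (_ : n - _ = (crt_idem p - 1) * (1 - n) * X - n * (X - 1)); last by ring.
apply: rpredB; first by do 2 apply: dvdz_mulr; apply: crt_idem_modl.
apply: dvdz_mull; apply: prod_eq1_mod => r; rewrite rem_filter ?primes_uniq // mem_filter => /andP[/= rp rq].
rewrite (_ : _ - 1 = crt_idem r * (n - 1)); last by ring.
apply: dvdz_mulr; apply: dvdz_trans (crt_idem_modr rq); rewrite dvdzE /=.
move: pq rq; rewrite !mem_primes => /and3P[pp _ pq] /and3P[rr _ rq].
have : (p %| r * (q %/ r))%N by rewrite mulnC divnK.
by rewrite Euclid_dvdM // dvdn_prime2 // eq_sym (negPf rp).
Qed.

Lemma local_charE p : p \in primes q -> exists psi : dirichlet_char R p, psi =1 local_char p.
Proof.
move=> pq; have qE : q = (p * (q %/ p))%N by move: pq; rewrite mem_primes => /and3P[_ _ h]; rewrite mulnC divnK.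
by exists (char_comp chi qE (coprime_div_prime pq) (crt_idem_modl pq) (crt_idem_modr pq)).
Qed.

Lemma local_char_nrm_le1 p n : nrm (local_char p n) <= 1.
Proof. exact: dchar_nrm_le1. Qed.

Lemma local_char_periodic p : p \in primes q -> periodic p (local_char p).
Proof. by move=> /local_charE[psi E] n; rewrite -!E dirichlet_periodic. Qed.

Hypothesis prim : primitive chi.

(** If the component at p were trivial, [chi] would be induced by its component modulo q / p, built
    from the complementary idempotent [1 - crt_idem p]. *)
Lemma local_char_nontrivial p : p \in primes q -> exists2 n, coprimez n p%:Z & local_char p n != 1.
Proof.
move=> pq; apply: contrapT => H.
have triv n : coprimez n p%:Z -> local_char p n = 1.
  by move=> cop; apply: contrapT => /eqP ne; apply: H; exists n.
move: (pq); rewrite mem_primes => /and3P[pp _ pdq].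
have qE : q = ((q %/ p) * p)%N by rewrite divnK.
have cop : coprime (q %/ p) p by rewrite coprime_sym coprime_div_prime.
have d1 : ((q %/ p)%N%:Z %| (1 - crt_idem p) - 1)%Z.
  by rewrite addrAC subrr add0r rpredN crt_idem_modr.
have d2 : (p%:Z %| 1 - crt_idem p)%Z by rewrite -opprB rpredN crt_idem_modl.
apply: (prim (d := (q %/ p)%N)); first by rewrite {2}qE dvdn_mulr.
  by rewrite ltn_Pdiv ?prime_gt1.
exists (char_comp chi qE cop d1 d2) => n cn.
have := triv n; rewrite qE PoszM coprimezMr in cn; move/andP: cn => [_ cp] /(_ cp) t1.
rewrite /= /char_comp_fun -[RHS]mul1r -{1}t1 /local_char -dirichlet_mul; apply: dchar_eqmod.
rewrite (_ : n - _ = (crt_idem p * (crt_idem p - 1)) * (1 - n) ^+ 2); last by ring.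
have qE' : q = (p * (q %/ p))%N by rewrite mulnC divnK.
apply: (dvd_qde qE'); first by rewrite coprime_sym.
  by apply: dvdz_mulr; apply: dvdz_mull; apply: crt_idem_modl.
by apply: dvdz_mulr; apply: dvdz_mulr; apply: crt_idem_modr.
Qed.

Definition local_prod (g : seq nat) (n : int) := \prod_(p <- g) local_char p n.

Lemma local_prod_nrm_le1 g n : nrm (local_prod g n) <= 1.
Proof.
rewrite /local_prod; elim/big_rec: _ => [|p y _ y1]; first by rewrite nrm1.
by rewrite nrmM mulr_ile1 ?nrm_ge0 ?local_char_nrm_le1.
Qed.

Lemma local_prod_periodic g : {subset g <= primes q} -> periodic (seq_prod g) (local_prod g).
Proof.
move=> sub n; apply: eq_big_seq => p pg; rewrite /seq_prod (big_rem p) //= PoszM.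
exact: (periodic_mul _ _ (local_char_periodic (sub p pg))).
Qed.

Lemma coprime_seq_prod (g1 g2 : seq nat) : {subset g1 <= primes q} -> {subset g2 <= primes q} ->
  {in g1, forall p, p \notin g2} -> coprime (seq_prod g1) (seq_prod g2).
Proof.
move=> s1 s2 dis; have one p : p \in primes q -> p \notin g2 -> coprime p (seq_prod g2).
  rewrite mem_primes => /andP[pp _]; elim: g2 s2 {dis} => [|r g IH] s2; first by rewrite /seq_prod big_nil coprimen1.
  rewrite inE negb_or /seq_prod big_cons coprimeMr => /andP[pr pg].
  rewrite [X in _ && X]IH ?andbT //; last by move=> t tg; apply: s2; rewrite inE tg orbT.
  rewrite prime_coprime // dvdn_prime2 //.
  by have := s2 r (mem_head _ _); rewrite mem_primes => /andP[].
elim: g1 s1 dis => [|p g IH] s1 dis; first by rewrite /seq_prod big_nil coprime1n.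
rewrite /seq_prod big_cons coprimeMl one ?s1 ?dis ?mem_head //=.
by apply: IH => t tg; [apply: s1 | apply: dis]; rewrite inE tg orbT.
Qed.

Lemma mean_diff_local_prod k g : {subset g <= primes q} -> uniq g ->
  mean_diff k (local_prod g) (seq_prod g) <= (2 ^ (k.+1 * size g))%:R / Num.sqrt (seq_prod g)%:R.
Proof.
elim: g => [|p g IH] sub ug.
  rewrite /seq_prod big_nil muln0 expn0 sqrtr1 divr1; apply: mean_diff_le1 => // n.
  exact: local_prod_nrm_le1.
have {ug}[pg ug] : p \notin g /\ uniq g by apply/andP.
have subg : {subset g <= primes q} by move=> r rg; apply: sub; rewrite inE rg orbT.
have pq : p \in primes q by apply: sub; rewrite mem_head.
have pp : prime p by move: pq; rewrite mem_primes => /andP[].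
have pr : all (leq 1) g.
  by apply/allP => r /subg; rewrite mem_primes => /andP[/prime_gt0].
have E : local_prod (p :: g) =1 (fun n => local_char p n * local_prod g n) by move=> n; rewrite /local_prod big_cons.
rewrite (eq_mean_diff _ _ E) /seq_prod big_cons -/(seq_prod g) mean_diff_mul ?(prime_gt0 pp) ?(seq_prod_gt0 pr) //; last 3 first.
- have := @coprime_seq_prod [:: p] g; rewrite {1}/seq_prod big_seq1; apply => //.
    by move=> r; rewrite inE => /eqP ->.
  by move=> r; rewrite inE => /eqP ->.
- exact: local_char_periodic.
- exact: local_prod_periodic.
have [psi psiE] := local_charE pq; have [n0 c0 n1] := local_char_nontrivial pq.
have Tp : mean_diff k (local_char p) p <= (2 ^ k.+1)%:R / Num.sqrt p%:R.
  by rewrite -(eq_mean_diff _ _ psiE); apply: (mean_diff_prime k pp c0); rewrite psiE.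
rewrite natrM sqrtrM ?ler0n // invfM mulnS expnD natrM mulrACA.
by rewrite ler_pM ?mean_diff_ge0 // IH.
Qed.

Lemma factor_prod_groups gs g0 :
  factor_prod [seq (seq_prod g, local_prod g) | g <- gs] (local_prod g0) =1 local_prod (flatten gs ++ g0).
Proof.
elim: gs => //= g gs IH n; rewrite IH /local_prod -catA [in RHS]big_cat //.
Qed.

Lemma iter_sqrt_le1 k (x : R) : 0 <= x -> x <= 1 -> iter_sqrt k x <= 1.
Proof.
by move=> x0 x1; elim: k => //= k IH; rewrite -[leRHS]sqrtr1 ler_wsqrtr.
Qed.

(** Allows the actual number of square roots to be replaced by an upper bound for it. *)
Lemma iter_sqrt_mono j k (x : R) : (j <= k)%N -> 0 <= x -> x <= 1 -> iter_sqrt j x <= iter_sqrt k x.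
Proof.
move=> jk x0 x1; rewrite -(subnKC jk); elim: (k - j)%N => [|d IH]; first by rewrite addn0.
apply: le_trans IH _; rewrite addnS /=; set y := iter_sqrt _ _.
have y0 : 0 <= y by apply: iter_sqrt_ge0.
have y1 : y <= 1 by apply: iter_sqrt_le1.
rewrite -{1}[y]ger0_norm // -sqrtr_sqr ler_wsqrtr // expr2 ler_piMl //.
Qed.

(** Origin of [x]: m >= Y ^ 2 makes 1 / sqrt m at most 1 / Y, each prime of m costs a power of 2
    with exponent at most k + 4, and m <= Y ^ 3 bounds the cost m / N of the incomplete period by Y
    ^ (-3). With N = Y ^ 6 there is room for the shifts, as m times any other group is at most Y ^
    5. Only one group may be smaller than Y, so q <= Y ^ k bounds the number of groups by k + 1; the
    twist adds one square root. *)
Theorem sums_bounded_twist (k Y : nat) (e : int -> R[i]) (x : R := (2 ^ (k.+4 * size (primes q)))%:R / Y%:R + Y%:R^-1 ^+ 3) :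
  (1 < Y)%N -> all (fun p => (p <= Y)%N) (primes q) -> (Y ^ 2 <= q)%N -> (q <= Y ^ k)%N -> x <= 1 ->
  (forall n m, e (n + m) = e n * e m) -> (forall n, nrm (e n) = 1) ->
  sums_bounded (fun n => e n * chi n) (Y ^ 6) (4 * (Y ^ 6)%:R * iter_sqrt k.+2 x).
Proof.
move=> Y1 pY Y2q qYk x1 eD e1.
have Y0 : (0 < Y)%N by apply: ltnW.
have Yp : 0 < Y%:R :> R by rewrite ltr0n.
have prE := seq_prod_primes q0 sqf.
have pr1 : all (leq 1) (primes q) by apply/allP => r; rewrite mem_primes => /andP[/prime_gt0].
have [||g0 [l2 [El g0l g0u]]] := @prefix_product Y (Y ^ 2) (primes q) _ Y0 pY.
- by rewrite expn_gt0 Y0.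
- by rewrite prE.
have pY2 : all (fun p => (p <= Y)%N) l2 by move: pY; rewrite El all_cat => /andP[].
have [gs [fl gsu gsl]] := group_product Y0 pY2.
have sub0 : {subset g0 <= primes q} by move=> p pg; rewrite El mem_cat pg.
have sub2 : {subset l2 <= primes q} by move=> p pg; rewrite El mem_cat pg orbT.
have uq := primes_uniq q; rewrite El cat_uniq in uq; move/and3P: uq => [u0 dis u2].
have pr2 : all (leq 1) l2 by move: pr1; rewrite El all_cat => /andP[].
have pr0 : all (leq 1) g0 by move: pr1; rewrite El all_cat => /andP[].
set m := seq_prod g0 in g0l g0u.
have m0 : (0 < m)%N by apply: seq_prod_gt0.
have mY3 : (m <= Y ^ 3)%N by rewrite expnSr.
have sgs : (size gs <= k.+1)%N.
  have h : (Y ^ (size gs).-1 <= Y ^ k)%N.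
    apply: leq_trans (size_groups _ gsl) _; first by rewrite fl.
    apply: leq_trans qYk; rewrite fl -prE El /seq_prod big_cat /= leq_pmull //.
  by rewrite leq_exp2l // in h; case: (size gs) h.
have subgs g : g \in gs -> {subset g <= l2} by move=> gg p pg; rewrite -fl; apply/flattenP; exists g.
have ok : admissible m (Y ^ 6) [seq (seq_prod g, local_prod g) | g <- gs].
  move: subgs gsu; clear fl gsl sgs.
  elim: gs => //= g gs IH subgs /andP[gu gsu]; split.
  - by apply: local_prod_periodic => p pg; apply: sub2; apply: (subgs g); rewrite ?mem_head.
  - exact: local_prod_nrm_le1.
  - apply: leq_trans (leq_mul mY3 gu) _.
    by rewrite mulnn -expnD leq_pexp2l.
  - apply: coprime_seq_prod => // [p pg|p pg].
      by apply: sub2; apply: (subgs g); rewrite ?mem_head.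
    apply: contra dis => p0; apply/hasP; exists p => //.
    by apply: (subgs g); rewrite ?mem_head.
  - by apply: IH => // g' gg; apply: subgs; rewrite inE gg orbT.
have mN : (m <= Y ^ 6)%N by apply: leq_trans mY3 _; rewrite leq_exp2l.
have main := @vdc_twist R m (Y ^ 6) _ (local_prod g0) e m0 mN ok (local_prod_periodic sub0) (local_prod_nrm_le1 g0) eD e1.
rewrite size_map in main.
apply: (eq_sums_bounded (F := fun n => e n * factor_prod [seq (seq_prod g, local_prod g) | g <- gs] (local_prod g0) n)).
  move=> n; rewrite factor_prod_groups fl prod_local_char El; congr (_ * _).
  by rewrite /local_prod; apply: perm_big; rewrite perm_catC.
apply: sums_bounded_le main; rewrite ler_wpM2l ?mulr_ge0 ?ler0n //.
have N0 : 0 < (Y ^ 6)%:R :> R by rewrite ltr0n expn_gt0 Y0.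
set y := mean_diff _ _ _ + _.
have y0 : 0 <= y by rewrite addr_ge0 ?mean_diff_ge0 // divr_ge0 ?ler0n.
have yx : y <= x.
  apply: lerD.
    apply: le_trans (mean_diff_local_prod _ sub0 u0) _; apply: ler_pM; rewrite ?ler0n ?invr_ge0 ?sqrtr_ge0 //.
      rewrite ler_nat leq_exp2l // leq_mul //; first by rewrite !ltnS leqW.
      by rewrite El size_cat leq_addr.
    rewrite lef_pV2 ?posrE ?sqrtr_gt0 ?ltr0n // -[Y%:R]ger0_norm ?ler0n // -sqrtr_sqr ler_wsqrtr //.
    by rewrite -natrX ler_nat.
  rewrite ler_pdivrMr // natrX exprVn (_ : Y%:R ^+ 6 = Y%:R ^+ 3 * Y%:R ^+ 3); last by rewrite -exprD.
  by rewrite mulKf ?expf_neq0 ?gt_eqF // -natrX ler_nat.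
apply: le_trans (iter_sqrt_le _ y0 yx) _; apply: iter_sqrt_mono => //.
exact: le_trans yx.
Qed.

End Squarefree.

(** * Gauss sums and partial summation *)

Section Trig.
Import numFieldNormedType.Exports.
Local Open Scope classical_set_scope.
Local Open Scope ring_scope.
Variable R : realType.
Implicit Types x t : R.

Lemma sin_mean x : 0 <= x -> exists2 c, 0 <= c <= x & sin x = cos c * x.
Proof.
move=> x0.
have cs : {within `[0, x], continuous (@sin R)}.
  by apply: continuous_subspaceT => y; apply: continuous_sin.
have [c cx] := MVT_segment x0 (fun y _ => is_derive_sin y) cs.
by rewrite sin0 !subr0 => E; exists c => //; move: cx; rewrite in_itv.
Qed.

Lemma sin_le x : 0 <= x -> sin x <= x.
Proof. by move=> x0; have [c _ ->] := sin_mean x0; rewrite ler_piMl // cos_le1. Qed.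

(** A weak Jordan inequality. In sin x = 2 sin(x / 2) cos(x / 2) the mean value theorem turns sin(x
    / 2) into a cosine times x / 2; both cosines are at least cos(pi / 4), whose square is 1 / 2. *)
Lemma sin_ge_half x : 0 <= x <= pi / 2 -> x / 2 <= sin x.
Proof.
move=> /andP[x0 xpi]; set k := cos (pi / 4 : R).
have p0 : 0 < pi :> R := pi_gt0 R.
have k2 : k ^+ 2 = 1 / 2.
  have := cos_mulr2n (pi / 4 : R); have -> : pi / 4 *+ 2 = pi / 2 :> R by rewrite -mulr_natr; field.
  by rewrite cos_pihalf -/k -mulr_natr => h; lra.
have k0 : 0 <= k by apply: cos_ge0_pihalf; apply/andP; split; lra.
have cosk y : 0 <= y -> y <= pi / 4 -> k <= cos y.
  move=> y0 yk; rewrite leNgt; apply/negP.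
  by rewrite ltr_cos ?in_itv /=; last 2 [by apply/andP; split; lra]; lra.
have h0 : 0 <= x / 2 by lra.
have [c /andP[c0 cx] sE] := sin_mean h0.
have -> : x = (x / 2) *+ 2 by rewrite -mulr_natr; field.
rewrite sin_mulr2n sE -mulr_natr.
have h1 : k <= cos (x / 2) by apply: cosk; lra.
have h2 : k <= cos c by apply: cosk; lra.
have : k * (k * (x / 2)) <= cos (x / 2) * (cos c * (x / 2)).
  by apply: ler_pM => //; [apply: mulr_ge0 | apply: ler_wpM2r].
by rewrite mulrA -expr2 k2; lra.
Qed.

Definition cis t : R[i] := (cos t +i* sin t)%C.

Lemma cisD s t : cis (s + t) = cis s * cis t.
Proof.
rewrite /cis cosD sinD; simpc; congr (_ +i* _)%C.
by rewrite [in RHS]addrC; ring.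
Qed.

Lemma cis0 : cis 0 = 1.
Proof. by rewrite /cis cos0 sin0. Qed.

Lemma nrm_cis t : nrm (cis t) = 1.
Proof. by rewrite /cis /= cos2Dsin2 sqrtr1. Qed.

Lemma conj_cis t : (cis t)^*%C = cis (- t).
Proof. by rewrite /cis cosN sinN. Qed.

Lemma nrm_cisB1 t : nrm (cis t - 1) = 2 * `|sin (t / 2)|.
Proof.
have E : cos t = 1 - 2 * sin (t / 2) ^+ 2.
  rewrite -{1}[t](_ : (t / 2) *+ 2 = t); last by rewrite -mulr_natr; field.
  by rewrite cos_mulr2n -mulr_natr cos2sin2; ring.
have -> : cis t - 1 = ((cos t - 1) +i* sin t)%C by rewrite /cis; simpc.
rewrite /=.
have -> : (cos t - 1) ^+ 2 + sin t ^+ 2 = (2 * sin (t / 2)) ^+ 2.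
  by have := cos2Dsin2 t => h; have -> : (cos t - 1) ^+ 2 + sin t ^+ 2 = (cos t ^+ 2 + sin t ^+ 2) + 1 - 2 * cos t by [ring]; rewrite h E; ring.
by rewrite sqrtr_sqr normrM ger0_norm.
Qed.

Lemma nrm_cisB1_le t : 0 <= t -> t <= pi *+ 2 -> nrm (cis t - 1) <= t.
Proof.
move=> t0 tp; rewrite nrm_cisB1 ger0_norm.
  have h : 0 <= t / 2 by lra.
  by have := sin_le h; lra.
by apply: sin_ge0_pi; move: tp; rewrite -mulr_natr => tp; apply/andP; split; lra.
Qed.

Lemma nrm_cisB1_ge t : 0 <= t -> t <= pi -> t / 2 <= nrm (cis t - 1).
Proof.
move=> t0 tp; rewrite nrm_cisB1.
have h : 0 <= t / 2 <= pi / 2 by apply/andP; split; lra.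
by have := sin_ge_half h; have := ler_norm (sin (t / 2)); lra.
Qed.

Lemma sum_inv_le_ln (n : nat) : (0 < n)%N ->
  \sum_(1 <= b < n.+1) (b%:R : R)^-1 <= 1 + ln n%:R.
Proof.
elim: n => // -[_ _|n IH _]; first by rewrite big_nat1 invr1 ln1 addr0.
rewrite big_nat_recr //=; have {}IH := IH isT.
suff h : n.+2%:R^-1 <= ln n.+2%:R - ln n.+1%:R :> R.
  apply: le_trans (lerD IH h) _.
  by rewrite -addrA [ln n.+1%:R + _]addrC subrK.
have p2 : 0 < n.+2%:R :> R by rewrite ltr0n.
have p1 : 0 < n.+1%:R :> R by rewrite ltr0n.
have := @le_ln1Dx R (- n.+2%:R^-1).
have -> : 1 - n.+2%:R^-1 = n.+1%:R / n.+2%:R :> R.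
  have E : n.+1%:R = n.+2%:R - 1 :> R by rewrite -(natr1 n.+1) addrK.
  by rewrite E mulrBl divff ?gt_eqF // mul1r.
rewrite ln_div ?posrE // ltrN2 invf_lt1 // ltr1n => /(_ isT) h.
by rewrite -[leRHS]opprB lerNr.
Qed.

End Trig.

Lemma abel_sum (C : comNzRingType) (u g : nat -> C) m (U := fun b => \sum_(1 <= i < b.+1) u i) :
  (0 < m)%N ->
  \sum_(1 <= b < m.+1) u b * g b = U m * g m + \sum_(1 <= b < m) U b * (g b - g b.+1).
Proof.
elim: m => // -[_ _|m IH _]; first by rewrite /U !big_nat1 big_geq // addr0.
have US : U m.+2 = U m.+1 + u m.+2 by rewrite /U big_nat_recr.
rewrite big_nat_recr //= IH // [X in _ = _ + X]big_nat_recr //= US.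
ring.
Qed.

(** Rounding L up to a multiple of N at most doubles it. *)
Lemma interval_sum_long (R : realType) (F : int -> R[i]) N (mu : R) a L : (0 < N)%N -> (N <= L)%N ->
  sums_bounded F N (N%:R * mu) -> nrm (interval_sum F a L) <= 2 * L%:R * mu.
Proof.
move=> N0 NL bF; have Np : 0 < N%:R :> R by rewrite ltr0n.
have mu0 : 0 <= mu by have := sums_bounded_ge0 bF; rewrite pmulr_rge0.
have blocks t b : nrm (interval_sum F b (t * N)%N) <= t%:R * (N%:R * mu).
  elim: t b => [|t IH] b; first by rewrite mul0n mul0r /interval_sum big_geq // nrm0.
  rewrite mulSn interval_sum_cat; apply: le_trans (nrmD _ _) _.
  by rewrite -natr1 mulrDl mul1r addrC lerD // bF.
rewrite (divn_eq L N) interval_sum_cat; apply: le_trans (nrmD _ _) _.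
apply: le_trans (lerD (blocks _ _) (bF _ _ (ltnW (ltn_pmod L N0)))) _.
rewrite -divn_eq -[X in _ + X]mul1r -mulrDl mulrA ler_wpM2r //.
rewrite natr1 -!natrM ler_nat.
have t1 : (1 <= L %/ N)%N by rewrite divn_gt0.
apply: leq_trans (_ : 2 * (L %/ N * N) <= _)%N; last by rewrite leq_mul2l leq_divM orbT.
by rewrite mulnA leq_mul2r; apply/orP; right; lia.
Qed.

(** * Gauss sums and the Polya expansion *)

Section Gauss.
Variables (R : realType) (q : nat).
Hypothesis q1 : (1 < q)%N.
Let q0 : (0 < q)%N := ltnW q1.
Let qp : 0 < q%:R :> R. Proof. by rewrite ltr0n. Qed.

Definition add_char_angle : R := pi *+ 2 / q%:R.
Definition add_char (n : int) : R[i] := cis (n%:~R * add_char_angle).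

Lemma add_char_angle_gt0 : 0 < add_char_angle.
Proof. by rewrite divr_gt0 // pmulrn_lgt0 // pi_gt0. Qed.

Lemma add_charD m n : add_char (m + n) = add_char m * add_char n.
Proof. by rewrite /add_char intrD mulrDl cisD. Qed.

Lemma add_char0 : add_char 0 = 1. Proof. by rewrite /add_char mul0r cis0. Qed.

Lemma add_char_nrm n : nrm (add_char n) = 1. Proof. exact: nrm_cis. Qed.

Lemma add_char_conj n : (add_char n)^*%C = add_char (- n).
Proof. by rewrite /add_char conj_cis intrN mulNr. Qed.

Lemma add_char_periodic : periodic q add_char.
Proof.
move=> n; rewrite add_charD (_ : add_char q%:Z = 1) ?mulr1 // /add_char /add_char_angle -pmulrn mulrC divfK ?gt_eqF //.
by rewrite /cis cos2pi sin2pi.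
Qed.

Lemma add_charM (n : int) (k : nat) : add_char (n * k%:Z) = add_char n ^+ k.
Proof.
elim: k => [|k IH]; first by rewrite mulr0 add_char0.
by rewrite -addn1 PoszD mulrDr mulr1 add_charD IH addn1 exprSr.
Qed.

Lemma add_charB1_sym n : nrm (add_char (- n) - 1) = nrm (add_char n - 1).
Proof. by rewrite -add_char_conj -[RHS]nrmJ rmorphB rmorph1. Qed.

Lemma add_char_neq1 (b : nat) : (0 < b)%N -> (b < q)%N -> add_char b%:Z != 1.
Proof.
move=> b0 bq; rewrite -subr_eq0; apply/negP => /eqP h.
have := nrm_cisB1 (b%:R * add_char_angle); rewrite -[cis _]/(add_char b%:Z) h nrm0 => /esym /eqP.
rewrite mulf_eq0 pnatr_eq0 /= normr_eq0 => /eqP s0.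
have : 0 < sin (b%:R * add_char_angle / 2); last by rewrite s0 ltxx.
have bp : 0 < b%:R :> R by rewrite ltr0n.
apply: sin_gt0_pi; apply/andP; split; first by rewrite divr_gt0 // mulr_gt0 // add_char_angle_gt0.
rewrite /add_char_angle -(mulr_natr pi 2).
have -> : b%:R * (pi * 2 / q%:R) / 2 = pi * (b%:R / q%:R) :> R by field; rewrite gt_eqF.
by rewrite gtr_pMr ?pi_gt0 // ltr_pdivrMr // mul1r ltr_nat.
Qed.

Lemma add_char_orth (a b : nat) : (a < q)%N -> (b < q)%N ->
  \sum_(0 <= n < q) add_char ((a%:Z - b%:Z) * n%:Z) = if a == b then q%:R else 0.
Proof.
move=> aq bq; case: eqVneq => [->|ab].
  under eq_bigr do rewrite subrr mul0r add_char0.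
  by rewrite sumr_const_nat subn0.
have ne : add_char (a%:Z - b%:Z) != 1.
  case: (ltngtP a b) ab => // h _.
    have := @add_char_neq1 (b - a)%N; rewrite subn_gt0 => /(_ h (leq_ltn_trans (leq_subr _ _) bq)).
    rewrite -subzn ?(ltnW h) // -opprB; apply: contra => /eqP e1.
    by rewrite -add_char_conj e1 conjc1.
  have := @add_char_neq1 (a - b)%N; rewrite subn_gt0 => /(_ h (leq_ltn_trans (leq_subr _ _) aq)).
  by rewrite -subzn ?(ltnW h).
under eq_bigr do rewrite add_charM; rewrite big_mkord.
apply: (mulfI (x := add_char (a%:Z - b%:Z) - 1)); first by rewrite subr_eq0.
rewrite -subrX1 -add_charM mulr0 mulrC -[_ * _]add0r (periodic_mul _ _ add_char_periodic) add_char0 subrr //.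
Qed.

Lemma parseval (c : nat -> R[i]) :
  \sum_(0 <= n < q) nrm (\sum_(0 <= a < q) c a * add_char (a%:Z * n%:Z)) ^+ 2 =
  q%:R * \sum_(0 <= a < q) nrm (c a) ^+ 2.
Proof.
apply: complexI; rewrite rmorph_sum rmorphM rmorph_sum /=.
under eq_bigr do rewrite -mulcJ conj_sum mulr_suml.
rewrite exchange_big_nat /= mulr_sumr; apply: eq_big_nat => a /andP[_ aq].
under eq_bigr do rewrite mulr_sumr.
rewrite exchange_big_nat /=.
transitivity (\sum_(0 <= b < q) c a * (c b)^*%C * (if a == b then q%:R else 0)).
  apply: eq_big_nat => b /andP[_ bq]; rewrite -add_char_orth // mulr_sumr; apply: eq_bigr => n _.
  by rewrite conjM add_char_conj mulrBl add_charD mulrACA.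
rewrite (bigD1_seq a) ?mem_index_iota ?iota_uniq //= eqxx big1 ?addr0; last first.
  by move=> b ba; rewrite eq_sym (negPf ba) mulr0.
by rewrite mulcJ rmorph_nat mulrC.
Qed.

Hypothesis sqf : squarefree q.
Variable chi : dirichlet_char R q.
Hypothesis prim : primitive chi.

Definition gauss_sum := \sum_(0 <= a < q) (chi a%:Z)^*%C * add_char a%:Z.

Lemma sum_conj_affine (G : int -> R[i]) (c : int) : coprimez c q%:Z -> periodic q G ->
  \sum_(0 <= a < q) G (c * a%:Z) = \sum_(0 <= a < q) G a%:Z.
Proof.
move=> cop pG; pose c' := `|(c %% q%:Z)%Z|%N.
have qn0 : q%:Z != 0 by rewrite eqz_nat -lt0n.
have cE : c'%:Z = (c %% q%:Z)%Z by rewrite gez0_abs ?modz_ge0.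
have cop' : coprime c' q.
  have : coprimez c'%:Z q%:Z.
    rewrite (@coprimez_eqmod _ c) // cE -eqz_mod_dvd modz_mod //.
  by rewrite coprimezE.
rewrite -(sum_periodic_affine 0 q0 cop' pG); apply: eq_bigr => a _.
rewrite add0r PoszM cE -[RHS](periodic_mul _ ((c %/ q%:Z)%Z * a%:Z) pG); congr G.
by rewrite {1}(divz_eq c q%:Z); ring.
Qed.

(* For n not coprime to q, the component of chi at a prime p dividing n is non trivial,
   and the right-hand side is invariant under multiplication by one of its values. *)
Lemma char_gauss_sum (n : nat) : chi n%:Z * gauss_sum = \sum_(0 <= a < q) (chi a%:Z)^*%C * add_char (a%:Z * n%:Z).
Proof.
have perG : periodic q (fun a => (chi a)^*%C * add_char a).
  by move=> a; rewrite dirichlet_periodic add_char_periodic.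
have [cop|ncop] := boolP (coprimez n%:Z q%:Z).
  rewrite /gauss_sum -(sum_conj_affine cop perG) mulr_sumr; apply: eq_bigr => a _.
  rewrite dirichlet_mul conjM !mulrA mulcJ (dchar_nrm1 q0 chi cop) expr1n mul1r.
  by rewrite [n%:Z * _]mulrC.
rewrite (dchar_eq0 _ ncop) mul0r; symmetry.
have [p pq pn] : exists2 p, p \in primes q & (p %| n)%N.
  move: ncop; rewrite coprimezE /= /coprime => g1.
  exists (pdiv (gcdn n q)).
    rewrite mem_primes q0 pdiv_prime ?(dvdn_trans (pdiv_dvd _)) ?dvdn_gcdr //.
    by rewrite ltn_neqAle eq_sym g1 gcdn_gt0 q0 orbT.
  by rewrite (dvdn_trans (pdiv_dvd _)) ?dvdn_gcdl.
have [n1 c1 ne1] := local_char_nontrivial q0 sqf prim pq.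
pose c := crt_idem q p * n1 + (1 - crt_idem q p).
have cq : coprimez c q%:Z.
  rewrite -(dirichlet_support chi) -/(local_char chi p n1); have [psi psiE] := local_charE sqf chi pq.
  by rewrite -psiE dirichlet_support.
set S := \sum_(_ <= _ < _) _.
have perH : periodic q (fun a => (chi a)^*%C * add_char (a * n%:Z)).
  by move=> a; rewrite dirichlet_periodic mulrDl (periodic_mul _ _ add_char_periodic).
have : (chi c)^*%C * S = S.
  rewrite -[RHS](sum_conj_affine cq perH) mulr_sumr; apply: eq_bigr => a _.
  rewrite dirichlet_mul conjM -mulrA; congr (_ * (_ * _)).
  have [z Ez] : exists z, (c - 1) * n%:Z = q%:Z * z.
    have /dvdzP[z1 z1E] := crt_idem_modr sqf pq; have /dvdnP[z2 z2E] := pn.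
    have pd : (p %| q)%N by move: pq; rewrite mem_primes => /and3P[].
    have qE : q%:Z = (q %/ p)%N%:Z * p%:Z by rewrite -PoszM divnK.
    exists (z1 * z2%:Z * (n1 - 1)); rewrite /c z1E z2E qE PoszM; ring.
  rewrite -(periodic_mul (a%:Z * n%:Z) (z * a%:Z) add_char_periodic); congr add_char.
  by rewrite mulrA -Ez; ring.
move/eqP; rewrite -subr_eq0 -{2}[S]mul1r -mulrBl mulf_eq0 => /orP[|/eqP //].
rewrite subr_eq0 => /eqP h; case/negP: ne1; rewrite /local_char -/c.
by rewrite -[chi c]conjcK h conjc1.
Qed.

(** Parseval for the conjugate of [chi]: by [char_gauss_sum] its transform at every n is chi(n)
    times the Gauss sum, so the square sums of [chi] cancel. *)
Lemma nrm_gauss_sum : nrm gauss_sum = Num.sqrt q%:R.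
Proof.
have P := parseval (fun a => (chi a%:Z)^*%C).
have E : \sum_(0 <= n < q) nrm (\sum_(0 <= a < q) (chi a%:Z)^*%C * add_char (a%:Z * n%:Z)) ^+ 2
    = nrm gauss_sum ^+ 2 * \sum_(0 <= n < q) nrm (chi n%:Z) ^+ 2.
  by rewrite mulr_sumr; apply: eq_bigr => n _; rewrite -char_gauss_sum nrmM exprMn mulrC.
rewrite E in P.
have S0 : 0 < \sum_(0 <= n < q) nrm (chi n%:Z) ^+ 2.
  rewrite (bigD1_seq 1%N) ?mem_index_iota ?iota_uniq //= dchar1 nrm1 expr1n.
  by rewrite ltr_pwDl // sumr_ge0 // => n _; apply: sqr_ge0.
have P2 : nrm gauss_sum ^+ 2 = q%:R.
  apply: (mulIf (lt0r_neq0 S0)); rewrite P; congr (_ * _).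
  by apply: eq_bigr => n _; rewrite nrmJ.
by rewrite -P2 sqrtr_sqr ger0_norm ?nrm_ge0.
Qed.

Variables (N : nat) (mu : R).
Hypothesis N0 : (0 < N)%N.
Hypothesis Hbnd : forall y : int, sums_bounded (fun n => add_char (n * y) * chi n) N (N%:R * mu).

Lemma mu_ge0 : 0 <= mu.
Proof. by have := sums_bounded_ge0 (Hbnd 0); rewrite pmulr_rge0 // ltr0n. Qed.

Definition half_bound : R := q%:R * (2 + ln N%:R + 2 * mu * (1 + ln q%:R)).

Lemma nrm_add_charB1_ge (s : int) (b : nat) : `|s|%N = 1%N -> (2 * b <= q)%N ->
  b%:R * add_char_angle / 2 <= nrm (add_char (s * b%:Z) - 1).
Proof.
move=> s1 bq; have -> : nrm (add_char (s * b%:Z) - 1) = nrm (add_char b%:Z - 1).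
  case: s s1 => [n /= ->|n [->]]; first by rewrite mul1r.
  by rewrite mulN1r add_charB1_sym.
apply: nrm_cisB1_ge; first by rewrite mulr_ge0 ?ler0n ?ltW ?add_char_angle_gt0.
rewrite /add_char_angle -(mulr_natr pi 2).
have -> : b%:R * (pi * 2 / q%:R) = pi * ((2 * b)%:R / q%:R) :> R by rewrite natrM; field; rewrite gt_eqF.
by rewrite ger_pMr ?pi_gt0 // ler_pdivrMr // mul1r ler_nat.
Qed.

(** Partial summation against the kernel 1 / (e(b) - 1), of size q / b with increments q / b ^ 2 as
    long as b <= q / 2. The partial sums are at most b for b < N, which costs log N, and at most 2 b
    mu beyond, which costs mu log q. The sign s serves the residues on either side of 0. *)
Lemma half_sum_bound (s y : int) m : `|s|%N = 1%N -> (2 * m <= q)%N ->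
  nrm (\sum_(1 <= b < m.+1) (chi (s * b%:Z))^*%C * add_char (s * b%:Z * y) * (add_char (s * b%:Z) - 1)^-1) <= half_bound.
Proof.
move=> s1 mq; have mu0 := mu_ge0.
have lnN : 0 <= ln N%:R :> R by rewrite ln_ge0 // ler1n.
have lnq : 0 <= ln q%:R :> R by rewrite ln_ge0 // ler1n.
have tp := add_char_angle_gt0.
case: (posnP m) => [->|m0].
  rewrite big_geq // nrm0 mulr_ge0 ?ler0n // !addr_ge0 // !mulr_ge0 // addr_ge0 //.
pose u b : R[i] := (chi (s * b%:Z))^*%C * add_char (s * b%:Z * y).
pose g b : R[i] := (add_char (s * b%:Z) - 1)^-1.
pose U b := \sum_(1 <= i < b.+1) u i.
rewrite (@abel_sum _ u g m m0) -/(U m).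
have qt : q%:R * add_char_angle = pi *+ 2 by rewrite /add_char_angle mulrC divfK ?gt_eqF.
have pi2 : 2 <= pi :> R := pi_ge2 R.
have ge b : (0 < b)%N -> (2 * b <= q)%N -> 2 * b%:R / q%:R <= nrm (add_char (s * b%:Z) - 1).
  move=> b0 bq; apply: le_trans (nrm_add_charB1_ge s1 bq).
  have -> : 2 * b%:R / q%:R = b%:R * (4 / q%:R) / 2 :> R by field; rewrite gt_eqF.
  rewrite ler_pM2r ?invr_gt0 //.
  rewrite ler_wpM2l ?ler0n // /add_char_angle ler_pM2r ?invr_gt0 // -(mulr_natr pi 2); lra.
have gle b : (0 < b)%N -> (2 * b <= q)%N -> nrm (g b) <= q%:R / b%:R.
  move=> b0 bq; have bp : 0 < b%:R :> R by rewrite ltr0n.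
  rewrite /g nrmV -[q%:R / _]invrK lef_pV2 ?posrE ?invr_gt0 ?divr_gt0 //; last first.
    by apply: lt_le_trans (ge b b0 bq); rewrite divr_gt0 // mulr_gt0.
  apply: le_trans (ge b b0 bq); rewrite invf_div ler_pM2r ?invr_gt0 // ler_peMl ?ltW //; lra.
have gB b : (0 < b)%N -> (2 * b.+1 <= q)%N -> nrm (g b - g b.+1) <= q%:R / b%:R ^+ 2.
  move=> b0 bq; have bq' : (2 * b <= q)%N by apply: leq_trans bq; rewrite leq_mul2l leqnSn orbT.
  have bp : 0 < b%:R :> R by rewrite ltr0n.
  have x1 : 0 < b%:R * add_char_angle / 2 by rewrite divr_gt0 // mulr_gt0.
  have h1 := nrm_add_charB1_ge s1 bq'.
  have h2 : b%:R * add_char_angle / 2 <= nrm (add_char (s * b.+1%:Z) - 1).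
    apply: le_trans (nrm_add_charB1_ge s1 bq); rewrite ler_pM2r ?invr_gt0 // ler_pM2r // ler_nat leqnSn //.
  have n1 : add_char (s * b%:Z) - 1 != 0.
    by apply: contraTneq h1 => ->; rewrite nrm0 -ltNge.
  have n2 : add_char (s * b.+1%:Z) - 1 != 0.
    by apply: contraTneq h2 => ->; rewrite nrm0 -ltNge.
  have d : add_char (s * b.+1%:Z) = add_char (s * b%:Z) * add_char s.
    by rewrite -addn1 PoszD mulrDr mulr1 add_charD.
  have -> : g b - g b.+1 = add_char (s * b%:Z) * (add_char s - 1) / ((add_char (s * b%:Z) - 1) * (add_char (s * b.+1%:Z) - 1)).
    by rewrite /g mulrBr mulr1 -d; field; rewrite n1 n2.
  rewrite !nrmM nrmV nrmM add_char_nrm mul1r.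
  have es : nrm (add_char s - 1) <= add_char_angle.
    have -> : nrm (add_char s - 1) = nrm (add_char 1 - 1).
      by case: (s) s1 => [n /= ->|n [->]] //; rewrite NegzE add_charB1_sym.
    rewrite /add_char mul1r; apply: nrm_cisB1_le; first exact: ltW.
    by rewrite -qt ler_peMl ?ler1n // ltW.
  apply: le_trans (_ : add_char_angle / ((b%:R * add_char_angle / 2) * (b%:R * add_char_angle / 2)) <= _).
    have p1 := lt_le_trans x1 h1; have p2 := lt_le_trans x1 h2.
    apply: ler_pM; [exact: nrm_ge0 | by rewrite invr_ge0 mulr_ge0 ?nrm_ge0 | exact: es |].
    rewrite lef_pV2 ?posrE; [|exact: (mulr_gt0 p1 p2) | exact: (mulr_gt0 x1 x1)].
    by apply: ler_pM => //; apply: ltW.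
  have -> : add_char_angle / ((b%:R * add_char_angle / 2) * (b%:R * add_char_angle / 2)) = (4 / (q%:R * add_char_angle)) * (q%:R / b%:R ^+ 2).
    by field; rewrite !gt_eqF.
  rewrite ler_piMl ?divr_ge0 ?ler0n ?exprn_ge0 // qt -(mulr_natr pi 2) ler_pdivrMr; lra.
have U1 b : nrm (U b) <= b%:R.
  apply: le_trans (nrm_sum _ _ _) _; apply: le_trans (_ : \sum_(1 <= i < b.+1) 1 <= _).
    by apply: ler_sum => i _; rewrite nrmM nrmJ add_char_nrm mulr1 dchar_nrm_le1.
  by rewrite sumr_const_nat subn1.
(* Conjugating the hypothesis at frequency -y gives it for the conjugate of [chi] at frequency y;
   for s = -1 the sum is one over the interval from -b to -1, read backwards. *)
have U2 b : (N <= b)%N -> nrm (U b) <= 2 * b%:R * mu.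
  move=> Nb; have bF : sums_bounded (fun n => (chi n)^*%C * add_char (n * y)) N (N%:R * mu).
    move=> a L LN; have := Hbnd (- y) a LN.
    rewrite -[X in X <= _ -> _]nrmJ /interval_sum conj_sum; congr (nrm _ <= _).
    by apply: eq_bigr => i _; rewrite conjM add_char_conj mulrN opprK mulrC.
  have [sE|sE] : s = 1 \/ s = -1.
    by case: (s) s1 => [n /= ->|n /= [->]]; [left | right].
    have := interval_sum_long 1 N0 Nb bF; congr (nrm _ <= _); rewrite /interval_sum /U big_add1 /=.
    by apply: eq_bigr => i _; rewrite /u sE mul1r -add1n PoszD.
  have := interval_sum_long (- b%:Z) N0 Nb bF; congr (nrm _ <= _).
  rewrite /interval_sum /U big_add1 /= big_nat_rev /= add0n; apply: eq_big_nat => i /andP[_ ib].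
  by rewrite /u sE mulN1r -subzn // addKr.
apply: le_trans (nrmD _ _) _; rewrite nrmM.
apply: le_trans (_ : q%:R + \sum_(1 <= b < m) q%:R * ((if (b < N)%N then b%:R^-1 else 0) + 2 * mu * b%:R^-1) <= _).
  apply: lerD.
    apply: le_trans (_ : m%:R * (q%:R / m%:R) <= _).
      by apply: ler_pM; rewrite ?nrm_ge0 // gle.
    by rewrite mulrC divfK // pnatr_eq0 -lt0n.
  apply: le_trans (nrm_sum _ _ _) _; apply: ler_sum_nat => b /andP[b0 bm].
  have bp : 0 < b%:R :> R by rewrite ltr0n.
  rewrite nrmM; apply: le_trans (_ : nrm (U b) * (q%:R / b%:R ^+ 2) <= _).
    rewrite ler_wpM2l ?nrm_ge0 // gB //; apply: leq_trans mq; by rewrite leq_mul2l bm orbT.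
  have -> : nrm (U b) * (q%:R / b%:R ^+ 2) = q%:R * (nrm (U b) / b%:R * b%:R^-1).
    by field; rewrite gt_eqF.
  rewrite ler_wpM2l ?ler0n //; case: ltnP => bN.
    apply: le_trans (_ : b%:R^-1 <= _); last by rewrite lerDl mulr_ge0 ?invr_ge0 ?ler0n // mulr_ge0.
    by rewrite ler_piMl ?invr_ge0 ?ler0n // ler_pdivrMr // mul1r U1.
  rewrite add0r ler_wpM2r ?invr_ge0 ?ler0n // ler_pdivrMr //.
  by have := U2 b bN; rewrite [2 * mu * _]mulrAC.
rewrite -mulr_sumr /half_bound -{1}[q%:R]mulr1 -mulrDr ler_wpM2l ?ler0n //.
rewrite big_split /= -mulr_sumr.
have s1' : \sum_(1 <= b < m) (if (b < N)%N then b%:R^-1 else 0) <= 1 + ln N%:R :> R.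
  apply: le_trans (sum_inv_le_ln R N0).
  apply: le_trans (_ : \sum_(1 <= b < m + N.+1) (if (b < N)%N then b%:R^-1 else 0) <= _).
    rewrite [leRHS](@big_cat_nat _ _ _ m) ?leq_addr //= lerDl sumr_ge0 // => b _.
    by case: ifP; rewrite ?invr_ge0 ?ler0n.
  rewrite (@big_cat_nat _ _ _ N.+1) ?leq_addl //= [X in _ + X]big_nat_cond [X in _ + X]big1 ?addr0.
    by apply: ler_sum => b _; case: ifP; rewrite ?invr_ge0 ?ler0n.
  by move=> b /andP[/andP[bN _] _]; rewrite ltnNge (ltnW bN).
have s2' : \sum_(1 <= b < m) b%:R^-1 <= 1 + ln q%:R :> R.
  apply: le_trans (sum_inv_le_ln R q0).
  rewrite [leRHS](@big_cat_nat _ _ _ m) //=; last by apply: leq_trans (leqnSn _); apply: leq_trans mq; rewrite leq_pmull.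
  by rewrite lerDl sumr_ge0 // => b _; rewrite invr_ge0 ler0n.
have := ler_wpM2l (mulr_ge0 (ler0n _ 2) mu0) s2'; lra.
Qed.

(** The geometric series in n leaves one sum over residues for each end point, and each splits at q
    / 2: four half sums, divided by the modulus sqrt q of the Gauss sum. *)
Theorem polya_expansion_bound (X : nat) :
  nrm (\sum_(1 <= n < X.+1) chi n%:Z) <= 4 * Num.sqrt q%:R * (2 + ln N%:R + 2 * mu * (1 + ln q%:R)).
Proof.
have sp : 0 < Num.sqrt q%:R :> R by rewrite sqrtr_gt0.
have qE : q%:R = Num.sqrt q%:R * Num.sqrt q%:R :> R by rewrite -expr2 sqr_sqrtr ?ler0n.
set S := \sum_(_ <= _ < _) _.
pose w (y a : int) := (chi a)^*%C * add_char (a * y) * (add_char a - 1)^-1.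
have perw y : periodic q (w y).
  by move=> a; rewrite /w dirichlet_periodic mulrDl (periodic_mul _ _ add_char_periodic) add_char_periodic.
have ST : S * gauss_sum = \sum_(1 <= a < q) w X.+1%:Z a%:Z - \sum_(1 <= a < q) w 1 a%:Z.
  rewrite mulr_suml; under eq_bigr do rewrite char_gauss_sum.
  rewrite exchange_big_nat /= big_ltn // [X in X + _]big1 ?add0r; last first.
    move=> n _; rewrite (dchar_eq0 chi) ?conjc0 ?mul0r //.
    by rewrite coprimezE /= /coprime gcd0n; case: (q) q1 => [|[]].
  rewrite -sumrB; apply: eq_big_nat => a /andP[a0 aq].
  rewrite -mulr_sumr /w -mulrBl -mulrBr -mulrA; congr (_ * _).
  have en1 : add_char a%:Z - 1 != 0 by rewrite subr_eq0 add_char_neq1.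
  under eq_bigr do rewrite add_charM.
  rewrite mulr1 add_charM; apply: (mulIf en1); rewrite divfK // mulr_suml.
  under eq_bigr do rewrite mulrBr mulr1 -exprSr.
  by rewrite telescope_sumr.
have wle y : nrm (\sum_(1 <= a < q) w y a%:Z) <= 2 * half_bound.
  pose h := (q %/ 2)%N.
  have hq : (2 * h <= q)%N by rewrite mulnC leq_divM.
  have h1 : (h.+1 <= q)%N by rewrite ltn_Pdiv.
  rewrite (@big_cat_nat _ _ _ h.+1) //=; apply: le_trans (nrmD _ _) _.
  rewrite mulr2n mulrDl !mul1r; apply: lerD.
    have := @half_sum_bound 1 y h erefl hq; congr (nrm _ <= _); apply: eq_bigr => b _.
    by rewrite /w mul1r.
  have hq2 : (2 * (q - h.+1) <= q)%N.
    have := ltn_ceil q (isT : 0 < 2)%N; rewrite -/h; lia.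
  have -> : \sum_(h.+1 <= a < q) w y a%:Z = \sum_(0 <= i < q - h.+1) w y (-1 * i.+1%:Z).
    rewrite big_nat_rev /= -{1}[h.+1]add0n big_addn; apply: eq_big_nat => i /andP[_ iq].
    rewrite -(perw y (-1 * i.+1%:Z)); congr (w y _).
    rewrite mulN1r addrC subzn; last lia.
    by congr Posz; lia.
  by have := @half_sum_bound (-1) y (q - h.+1) erefl hq2; rewrite big_add1.
have : nrm S * Num.sqrt q%:R <= 4 * half_bound.
  rewrite -nrm_gauss_sum -nrmM ST; apply: le_trans (nrmD _ _) _; rewrite nrmN.
  by have := wle X.+1%:Z; have := wle 1; lra.
rewrite -ler_pdivlMr // => /le_trans; apply; rewrite ler_pdivrMr // /half_bound.
by rewrite {1}qE le_eqVlt; apply/orP; left; apply/eqP; ring.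
Qed.

End Gauss.

(** * Choice of the parameters *)

Section Numeric.
Variable R : realType.

(** From exp(1 / 64) <= 64 / 63 by six squarings with rounding. The value 11 / 4 separates e from
    log 17, so that log log log q has a positive lower bound for q >= 17. *)
Lemma expR1_lt : expR 1 < 11 / 4 :> R.
Proof.
have sq (x y z : R) : expR x <= y -> 0 <= y -> y ^+ 2 <= z -> expR (x *+ 2) <= z.
  move=> xy y0 yz; apply: le_trans yz; rewrite mulr2n expRD -expr2.
  by rewrite lerXn2r ?nnegrE ?expR_ge0.
have h : expR (1 / 64) <= 64 / 63 :> R.
  have := expR_ge1Dx (- (1 / 64) : R); rewrite expRN => h.
  rewrite -[leLHS]invrK -[leRHS]invrK lef_pV2 ?posrE ?invr_gt0 ?expR_gt0 //; lra.
have h1 : expR ((1 / 64) *+ 2) <= 1032 / 1000 :> R by apply: (sq _ _ _ h); lra.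
have h2 := sq _ _ ((1065 + 3 / 100) / 1000) h1 ltac:(lra) ltac:(lra).
have h3 := sq _ _ ((1134 + 3 / 10) / 1000) h2 ltac:(lra) ltac:(lra).
have h4 := sq _ _ ((1286 + 64 / 100) / 1000) h3 ltac:(lra) ltac:(lra).
have h5 := sq _ _ ((1655 + 45 / 100) / 1000) h4 ltac:(lra) ltac:(lra).
have h6 := sq _ _ (2741 / 1000) h5 ltac:(lra) ltac:(lra).
move: h6; rewrite -!mulrnA (_ : 1 / 64 *+ _ = 1 :> R); first by lra.
by rewrite -mulr_natr; field.
Qed.

Lemma expR1_le : expR 1 <= 11 / 4 :> R. Proof. exact/ltW/expR1_lt. Qed.

Lemma expR1_ge2 : 2 <= expR 1 :> R.
Proof. by have := expR_ge1Dx (1 : R); lra. Qed.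

Lemma lnlnln_pos : 0 < ln (ln (11 / 4)) :> R.
Proof.
have h : 1 < ln (11 / 4) :> R; last by apply: ln_gt0.
by rewrite -[X in X < _](expRK 1) ltr_ln ?posrE ?expR_gt0 ?expR1_lt // divr_gt0.
Qed.

Lemma ln17_ge : 11 / 4 <= ln 17 :> R.
Proof.
rewrite -[leLHS]expRK ler_ln ?posrE ?expR_gt0 //.
rewrite -(@ler_pXn2r _ 4) ?nnegrE ?expR_ge0 // -expRM_natl.
have -> : 4%:R * (11 / 4) = 11%:R * 1 :> R by field.
rewrite expRM_natl; set e := expR 1.
have e0 : 0 <= e by apply: expR_ge0.
have e1 : e <= 11 / 4 := expR1_le.
have e2 : e ^+ 2 <= (756 + 25 / 100) / 100 by rewrite expr2; nra.
have e4 : e ^+ 4 <= (5719 + 31 / 100) / 100 by rewrite (exprM e 2 2) expr2; have := exprn_ge0 2 e0; nra.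
have e8 : e ^+ 8 <= 3271.
  rewrite (exprM e 4 2) expr2; have := exprn_ge0 4 e0; nra.
have -> : e ^+ 11 = e ^+ 8 * (e ^+ 2 * e) by rewrite -exprSr -exprD.
have e3 : e ^+ 2 * e <= 208 / 10 by have := exprn_ge0 2 e0; nra.
have -> : 17 ^+ 4 = 289 * 289 :> R by ring.
have := exprn_ge0 8 e0; have : 0 <= e ^+ 2 * e by rewrite mulr_ge0 ?exprn_ge0.
nra.
Qed.

Variables (L eps s : R) (k : nat).
Hypothesis s10 : 10 <= s.
Hypothesis LE : L = expR (s ^+ 2).
Hypothesis eps_ge : s^-1 <= eps.
Hypothesis k_le : k%:R <= eps^-1 + 1.

Lemma eps_inv_le : eps^-1 <= s.
Proof.
have h10 := s10; have s0 : 0 < s by lra.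
by rewrite -[leRHS]invrK lef_pV2 ?posrE ?invr_gt0 // (lt_le_trans _ eps_ge) ?invr_gt0.
Qed.

(** exp(s ^ 2) >= exp(10 s). Three of the ten factors exp s give s ^ 2 exp s, and the remaining
    exp(7 s) >= 1 + 7 s gives the constant 71. *)
Lemma L_ge : 71 * s ^+ 2 * expR s <= L.
Proof.
have h10 := s10.
have h1 : expR (s + s + s + 7 * s) <= L.
  by rewrite LE ler_expR; nra.
apply: le_trans h1; rewrite !expRD.
have es : s <= expR s by have := expR_ge1Dx s; lra.
have e7 : 71 <= expR (7 * s) by have := expR_ge1Dx (7 * s); lra.
have -> : 71 * s ^+ 2 * expR s = expR s * s * s * 71 by ring.
have e0 : 0 <= expR s by apply: expR_ge0.
have s0 : 0 <= s by lra.
by apply: ler_pM; rewrite ?mulr_ge0 //; apply: ler_pM; rewrite ?mulr_ge0 //; apply: ler_wpM2l.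
Qed.

Lemma epsL_ge1 : 1 <= eps * L.
Proof.
have h10 := s10; have s0 : 0 < s by lra.
have e1 : 1 <= expR s by have := expR_ge1Dx s; lra.
apply: le_trans (_ : s^-1 * (71 * s ^+ 2 * expR s) <= _).
  have -> : s^-1 * (71 * s ^+ 2 * expR s) = 71 * s * expR s by field; rewrite gt_eqF.
  nra.
by apply: ler_pM; rewrite ?invr_ge0 ?mulr_ge0 ?exprn_ge0 ?expR_ge0 ?(ltW s0) // L_ge.
Qed.

(** As k <= s + 1 and 4 e <= 11, the exponent 2 ^ (k + 2) is at most 11 exp s; with log(1 / eps) <=
    s the right-hand side is at least exp(- 11 s exp s). The left-hand side is smaller because
    [eps * L] is at least 71 s exp s. The 2 ^ (k + 2)-th root is thus affordable exactly because 1 /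
    eps stays below s. *)
Lemma exp_decay : 2 * expR (- (eps * L / 4)) <= eps ^+ (2 ^ k.+2).
Proof.
have h10 := s10; have s0 : 0 < s by lra.
have eps0 : 0 < eps by apply: lt_le_trans eps_ge; rewrite invr_gt0.
have es1 : 1 <= expR s by have := expR_ge1Dx s; lra.
have lneps : - ln eps <= s.
  rewrite -lnV ?posrE //; apply: le_trans (eps_inv_le).
  by apply/ltW/ln_sublinear; rewrite invr_gt0.
have two_k : (2 ^ k.+2)%:R <= 11 * expR s :> R.
  have : (2 ^ k)%:R <= expR k%:R :> R.
    rewrite natrX -[k%:R]mulr1 expRM_natl lerXn2r ?nnegrE ?expR_ge0 //; exact: expR1_ge2.
  have : expR k%:R <= expR (1 + s) by rewrite ler_expR; have := eps_inv_le; have := k_le; lra.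
  rewrite expRD !expnS !natrM => h1 h2.
  have := expR1_le; have := expR_ge0 s; nra.
have key : 1 + 11 * expR s * s <= eps * L / 4.
  have h : s^-1 * (71 * s ^+ 2 * expR s) <= eps * L.
    by apply: ler_pM; rewrite ?invr_ge0 ?mulr_ge0 ?exprn_ge0 ?expR_ge0 ?(ltW s0) // L_ge.
  have E : s^-1 * (71 * s ^+ 2 * expR s) = 71 * (expR s * s) by field; rewrite gt_eqF.
  rewrite E in h; have : 10 <= expR s * s by nra.
  rewrite -mulrA; lra.
have -> : eps ^+ (2 ^ k.+2) = expR ((2 ^ k.+2)%:R * ln eps) by rewrite expRM_natl lnK.
apply: le_trans (_ : expR (1 - eps * L / 4) <= _).
  by rewrite expRD ler_wpM2r ?expR_ge0 // expR1_ge2.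
rewrite ler_expR.
have : (2 ^ k.+2)%:R * (- ln eps) <= 11 * expR s * s.
  apply: le_trans (_ : (2 ^ k.+2)%:R * s <= _); first by rewrite ler_wpM2l ?ler0n.
  by rewrite ler_wpM2r // ltW.
rewrite mulrN; lra.
Qed.

End Numeric.

Lemma prime_dvd_seq_prod p l : prime p -> all prime l -> (p %| seq_prod l)%N -> p \in l.
Proof.
move=> pp lp; rewrite /seq_prod Euclid_dvd_prod // big_has => /hasP[r rl].
by rewrite dvdn_prime2 // ?(allP lp) // => /eqP ->.
Qed.

Lemma size_divisors_seq_prod l : all prime l -> uniq l -> (2 ^ size l <= size (divisors (seq_prod l)))%N.
Proof.
elim: l => [|p l IH] /=; first by rewrite /seq_prod big_nil.
move=> /andP[pp lp] /andP[pl ul]; have {}IH := IH lp ul.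
have m0 : (0 < seq_prod l)%N.
  by apply: seq_prod_gt0; apply/allP => r /(allP lp) /prime_gt0.
rewrite /seq_prod big_cons -/(seq_prod l).
have ndvd d : d \in divisors (seq_prod l) -> ~~ (p %| d)%N.
  rewrite -dvdn_divisors // => dm; apply: contra pl => pd.
  by apply: prime_dvd_seq_prod => //; apply: dvdn_trans dm.
apply: (@leq_trans (size (divisors (seq_prod l) ++ [seq (p * d)%N | d <- divisors (seq_prod l)]))).
  by rewrite size_cat size_map addnn -mul2n expnS leq_mul2l IH orbT.
apply: uniq_leq_size.
  rewrite cat_uniq divisors_uniq map_inj_uniq ?divisors_uniq ?andbT /=; last first.
    by move=> a b /eqP; rewrite eqn_pmul2l ?prime_gt0 // => /eqP.
  apply/hasPn => _ /mapP[d dm ->]; apply: contraTN (dvdn_mulr d (dvdnn p)) => /ndvd //.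
have pm0 : (0 < p * seq_prod l)%N by rewrite muln_gt0 prime_gt0.
move=> d; rewrite mem_cat => /orP[|/mapP[d' dm ->]]; rewrite -dvdn_divisors //.
  by rewrite -dvdn_divisors // => dm; apply: dvdn_mull.
by rewrite -dvdn_divisors // in dm; apply: dvdn_mul.
Qed.

(** Converts the powers of 2 lost at each prime into powers of d(q). *)
Lemma num_divisors_ge q : (0 < q)%N -> squarefree q -> (2 ^ size (primes q) <= num_divisors q)%N.
Proof.
move=> q0 sq; rewrite /num_divisors -{2}(seq_prod_primes q0 sq); apply: size_divisors_seq_prod.
  by apply/allP => p; rewrite mem_primes => /andP[].
exact: primes_uniq.
Qed.

(** * Bounds for large and for small values of the bracket *)

Section Final.
Variables (R : realType) (q : nat) (chi : dirichlet_char R q).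
Hypothesis q17 : (17 <= q)%N.
Hypothesis sqf : squarefree q.
Hypothesis prim : primitive chi.

Let q1 : (1 < q)%N. Proof. exact: leq_trans q17. Qed.
Let q0 : (0 < q)%N. Proof. exact: leq_trans q17. Qed.
Let L : R := ln q%:R.

Lemma lnq_ge : 11 / 4 <= L.
Proof. by apply: le_trans (ln17_ge R) _; rewrite ler_ln ?posrE ?ltr0n // ler_nat. Qed.

(** The expansion with the trivial input N = 1, mu = 1; it settles the theorem when the bracket is
    bounded below. *)
Lemma polya_vinogradov X :
  nrm (\sum_(1 <= n < X.+1) chi n%:Z) <= 24 * (Num.sqrt q%:R * L).
Proof.
have H : forall y : int, sums_bounded (fun n => add_char R q (n * y) * chi n) 1 (1%:R * 1).
  move=> y a M M1; rewrite mulr1; apply: le_trans (interval_sum_le _ _ _) _; last by rewrite ler_nat.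
  by move=> n; rewrite nrmM add_char_nrm mul1r dchar_nrm_le1.
have := @polya_expansion_bound R q q1 sqf chi prim 1 1 isT H X; rewrite ln1 -/L => h.
apply: le_trans h _; have := lnq_ge; have := sqrtr_ge0 (q%:R : R); nra.
Qed.

Lemma smooth_bound (s eps : R) X : 10 <= s -> L = expR (s ^+ 2) -> s^-1 <= eps -> eps <= 1 / 4 ->
  ln (max_pdiv q * num_divisors q)%:R <= eps ^+ 4 * L ->
  nrm (\sum_(1 <= n < X.+1) chi n%:Z) <= 120 * (eps * (Num.sqrt q%:R * L)).
Proof.
move=> s10 LE epss eps4 lnPd; have L1 := lnq_ge.
have Lp : 0 < L by lra.
have eps0 : 0 < eps by apply: lt_le_trans epss; rewrite invr_gt0; lra.
have ei4 : 4 <= eps^-1 by rewrite -[leLHS]invrK lef_pV2 ?posrE ?invr_gt0 //; lra.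
have eL1 : 1 <= eps * L := epsL_ge1 s10 LE epss.
(* The least integer exceeding 1 / eps, so that [w] = q ^ (1 / k) lies between exp(eps L / 2) and
   exp(eps L). [Y] is the least integer exceeding [w], whence q <= Y ^ k and Y <= 2 w. *)
pose k := (Num.truncn eps^-1).+1.
have ei0 : 0 <= eps^-1 by lra.
have /andP[tr1 tr2] := truncn_itv ei0.
have kgt : eps^-1 < k%:R by [].
have kle : k%:R <= eps^-1 + 1 by rewrite /k -natr1 lerD2r.
have kp : 0 < k%:R :> R by rewrite ltr0n.
have k_eps : 1 <= k%:R * eps by rewrite -ler_pdivrMr // mul1r ltW.
have k_eps2 : k%:R * eps <= 5 / 4.
  have := ler_wpM2r (ltW eps0) kle; rewrite mulrDl mulVf ?gt_eqF //; lra.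
set w := expR (L / k%:R).
have w1 : 1 <= w by have := expR_ge1Dx (L / k%:R); have := divr_ge0 (ltW Lp) (ltW kp); rewrite /w; lra.
pose Y := (Num.truncn w).+1.
have w0 : 0 <= w by lra.
have /andP[yw1 yw2] := truncn_itv w0.
have Yw : w <= Y%:R by apply: ltW.
have Yw2 : Y%:R <= 2 * w by rewrite /Y -natr1; lra.
have Yp : 0 < Y%:R :> R by rewrite ltr0n.
have Y1 : (1 < Y)%N by rewrite /Y ltnS truncn_ge_nat.
have lnw : ln w = L / k%:R by rewrite expRK.
have Lk_le : L / k%:R <= eps * L.
  rewrite ler_pdivrMr //; have -> : eps * L * k%:R = L * (k%:R * eps) by ring.
  by rewrite ler_peMr // ltW.
have Lk_ge : eps * L / 2 <= L / k%:R.
  rewrite ler_pdivlMr //.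
  have -> : eps * L / 2 * k%:R = L * (k%:R * eps) / 2 by ring.
  have := ler_wpM2l (ltW Lp) k_eps2; lra.
have e2 : eps ^+ 2 <= 1 / 16 by rewrite expr2; nra.
have e3 : eps ^+ 3 <= 1 / 64 by rewrite exprSr; nra.
have e4L : eps ^+ 4 * L <= eps * L / 64.
  have -> : eps ^+ 4 * L = eps ^+ 3 * (eps * L) by ring.
  have := ler_wpM2r (le_trans ler01 eL1) e3; lra.
have P0 : (0 < max_pdiv q)%N by apply: max_pdiv_gt0.
have d2 : (2 ^ size (primes q) <= num_divisors q)%N by apply: num_divisors_ge.
have d0 : (0 < num_divisors q)%N by apply: leq_trans d2; rewrite expn_gt0.
have lnPd' : ln (max_pdiv q)%:R + ln (num_divisors q)%:R <= eps ^+ 4 * L.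
  by move: lnPd; rewrite natrM lnM ?posrE ?ltr0n.
have lnP0 : 0 <= ln (max_pdiv q)%:R :> R by rewrite ln_ge0 // ler1n.
have lnd0 : 0 <= ln (num_divisors q)%:R :> R by rewrite ln_ge0 // ler1n.
have pY : all (fun p => (p <= Y)%N) (primes q).
  apply/allP => p pq; apply: leq_trans (max_pdiv_max pq) _.
  rewrite -(ler_nat R); apply: le_trans Yw; rewrite -[leLHS]lnK ?posrE ?ltr0n // ler_expR.
  lra.
have lnq : q%:R = expR L :> R by rewrite lnK // posrE ltr0n.
have Y2q : (Y ^ 2 <= q)%N.
  rewrite -(ler_nat R) natrX lnq.
  have L4 : 4 <= L by rewrite LE; have := expR_ge1Dx (s ^+ 2); nra.
  have YY : Y%:R ^+ 2 <= (2 * w) ^+ 2 by rewrite lerXn2r ?nnegrE //; lra.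
  apply: le_trans YY _; rewrite exprMn -expRM_natl.
  have two : 2 ^+ 2 <= expR (2%:R * 1) :> R.
    by rewrite expRM_natl lerXn2r ?nnegrE ?expR_ge0 // expR1_ge2.
  apply: le_trans (ler_wpM2r (expR_ge0 _) two) _; rewrite -expRD ler_expR.
  have := ler_wpM2r (ltW Lp) eps4; lra.
have qYk : (q <= Y ^ k)%N.
  rewrite -(ler_nat R) natrX lnq; have -> : L = k%:R * (L / k%:R) by rewrite mulrC divfK ?gt_eqF.
  by rewrite expRM_natl lerXn2r ?nnegrE ?expR_ge0.
set om := size (primes q).
pose x : R := (2 ^ (k.+4 * om))%:R / Y%:R + Y%:R^-1 ^+ 3.
have Yinv : Y%:R^-1 <= expR (- (eps * L / 2)).
  apply: (@le_trans _ _ w^-1); first by rewrite lef_pV2 ?posrE //; lra.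
  by rewrite /w -expRN ler_expR lerN2.
have Yi0 : 0 <= Y%:R^-1 :> R by rewrite invr_ge0.
(* The factor 2 ^ ((k + 4) om) is at most d(q) ^ (k + 4). Since log d(q) <= eps ^ 4 L and (k + 4)
   eps <= 9 / 4, it is at most exp(eps L / 4), which uses up half of the exponent gained from 1 /
   Y. *)
have xle : x <= 2 * expR (- (eps * L / 4)).
  have dk : (2 ^ (k.+4 * om))%:R <= expR (eps * L / 4).
    rewrite mulnC expnM natrX.
    apply: (@le_trans _ _ ((num_divisors q)%:R ^+ k.+4)).
      by rewrite lerXn2r ?nnegrE ?ler0n // ler_nat.
    rewrite -[X in X ^+ _]lnK ?posrE ?ltr0n // -expRM_natl ler_expR.
    have d4 : ln (num_divisors q)%:R <= eps ^+ 4 * L by lra.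
    apply: le_trans (ler_wpM2l (ler0n _ _) d4) _.
    have -> : k.+4%:R * (eps ^+ 4 * L) = (k.+4%:R * eps) * eps ^+ 3 * L by ring.
    have k4 : k.+4%:R * eps <= 9 / 4 by rewrite -(addn4 k) natrD mulrDl; lra.
    have e20 := exprn_ge0 2 (ltW eps0).
    have h2 : k.+4%:R * eps * eps ^+ 2 <= 1 / 4.
      by apply: le_trans (ler_wpM2r e20 k4) _; lra.
    have := ler_wpM2r (le_trans ler01 eL1) h2.
    have -> : k.+4%:R * eps * eps ^+ 2 * (eps * L) = k.+4%:R * eps * eps ^+ 3 * L by ring.
    lra.
  have Y3 : Y%:R^-1 ^+ 3 <= expR (- (eps * L / 4)).
    apply: (@le_trans _ _ Y%:R^-1).
      by rewrite -[leRHS]expr1 ler_wiXn2l // invf_le1 // ltW // ltr1n.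
    apply: le_trans Yinv _; rewrite ler_expR; lra.
  rewrite /x [leRHS]mulrDl mul1r lerD //.
  apply: le_trans (ler_pM (ler0n _ _) Yi0 dk Yinv) _.
  rewrite -expRD ler_expR; lra.
have decay := exp_decay s10 LE epss kle.
have epsp : eps ^+ (2 ^ k.+2) <= 1 by apply: exprn_ile1; lra.
have x0 : 0 <= x by rewrite addr_ge0 ?divr_ge0 ?exprn_ge0 ?invr_ge0 ?ler0n.
have x1 : x <= 1 by apply: le_trans xle (le_trans decay epsp).
have rtx : iter_sqrt k.+2 x <= eps.
  apply: le_trans (iter_sqrt_le _ x0 (le_trans xle decay)) _.
  have E m : iter_sqrt m (eps ^+ (2 ^ m)) = eps.
    elim: m => [|m IH]; first by rewrite expn0 expr1.
    rewrite /iter_sqrt iterSr expnSr exprM sqrtr_sqr ger0_norm ?exprn_ge0 ?(ltW eps0) //.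
  by rewrite E.
pose mu : R := 4 * eps.
have H y : sums_bounded (fun n => add_char R q (n * y) * chi n) (Y ^ 6) ((Y ^ 6)%:R * mu).
  have eD n m : add_char R q ((n + m) * y) = add_char R q (n * y) * add_char R q (m * y) by rewrite mulrDl add_charD.
  have := @sums_bounded_twist R q q0 sqf chi prim k Y (fun n => add_char R q (n * y)) Y1 pY Y2q qYk x1 eD (fun n => add_char_nrm _ _ _).
  apply: sums_bounded_le; rewrite /mu mulrA [_ * 4]mulrC ler_wpM2l ?mulr_ge0 ?ler0n //.
have Y6 : (0 < Y ^ 6)%N by rewrite expn_gt0.
have := @polya_expansion_bound R q q1 sqf chi prim (Y ^ 6) mu Y6 H X; rewrite -/L => h.
apply: le_trans h _.
have lnY : ln (Y ^ 6)%:R <= 6 + 6 * (eps * L).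
  rewrite natrX lnXn // -[ln _ *+ _]mulr_natl.
  have ln2 : ln Y%:R <= 1 + L / k%:R.
    rewrite -[leRHS]expRK ler_ln ?posrE ?expR_gt0 // expRD.
    apply: le_trans Yw2 _; rewrite ler_wpM2r ?expR_ge0 //; exact: expR1_ge2.
  have -> : 6 + 6 * (eps * L) = 6%:R * (1 + eps * L) by ring.
  by rewrite ler_wpM2l ?ler0n //; apply: le_trans ln2 _; rewrite lerD2l.
have sq0 := sqrtr_ge0 (q%:R : R).
(* With log N <= 6 + 6 eps L and mu = 4 eps, all terms of the expansion are bounded by multiples of
   eps L because [1 <= eps * L]; their total is at most 30 eps L. *)
have -> : 120 * (eps * (Num.sqrt q%:R * L)) = 4 * Num.sqrt q%:R * (30 * (eps * L)) by ring.
rewrite ler_wpM2l ?mulr_ge0 // /mu; nra.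
Qed.

End Final.

Theorem theorem1 (R : realType) :
  exists C : R, 0 < C /\
    forall (q : nat), (16 <= q)%N -> squarefree q ->
    forall (chi : dirichlet_char R q), primitive chi ->
    forall (x : R), 1 <= x ->
      Normc.normc (char_sum chi x) <=
        C * (Num.sqrt q%:R * ln q%:R *
          ((ln (ln (ln q%:R)) / ln (ln q%:R)) `^ (1 / 2)
           + ((ln (ln (ln q%:R))) ^+ 2
                * ln ((max_pdiv q * num_divisors q)%N%:R)
              / ln q%:R) `^ (1 / 4))).
Proof.
have u0p := lnlnln_pos R; set u0 : R := ln (ln (11 / 4)) in u0p.
(* If the bracket is at least [c0], the Polya-Vinogradov inequality suffices, with constant 24 / c0.
   Below [c0], the first entry of the minimum gives eps <= 1 / 4, and the second, through u / t < u0
   / 100 and u >= u0, gives log log q >= 100, that is s >= 10. *)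
pose c0 : R := Num.min (1 / 4) (Num.sqrt (u0 / 100)).
have c0p : 0 < c0 by rewrite lt_min sqrtr_gt0 !divr_gt0.
exists (24 / c0 + 120); split; first by rewrite addr_gt0 ?divr_gt0.
move=> q q16 sqf chi prim x _; rewrite /char_sum.
have q17 : (17 <= q)%N.
  by move: q16; rewrite leq_eqVlt => /orP[/eqP E|//]; have := sqf 4%N; rewrite -E => /(_ isT).
move: (Num.truncn x) => X.
have L1 := lnq_ge R q17; set L := ln q%:R in L1 *.
have l11 : 1 < ln (11 / 4) :> R.
  by rewrite -[X in X < _](expRK 1) ltr_ln ?posrE ?expR_gt0 ?expR1_lt // divr_gt0.
set t := ln L; have t1 : ln (11 / 4) <= t by rewrite ler_ln ?posrE ?divr_gt0 //; lra.
set u := ln t; have u1 : u0 <= u by rewrite ler_ln ?posrE //; lra.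
set A := _ `^ (1 / 2); set B := _ `^ (1 / 4).
have A0 : 0 <= A := powR_ge0 _ _.
have B0 : 0 <= B := powR_ge0 _ _.
have Lp : 0 < L by lra.
have tp : 0 < t by lra.
have up : 0 < u by lra.
have A2 : A ^+ 2 = u / t.
  rewrite -powR_mulrn // -powRrM mul1r mulVf // powRr1 //.
  by rewrite divr_ge0 // ltW.
have P0 : (0 < max_pdiv q)%N by apply: max_pdiv_gt0.
have q0 : (0 < q)%N by exact: leq_trans q17.
have d0 : (0 < num_divisors q)%N.
  by apply: leq_trans (num_divisors_ge q0 sqf); rewrite expn_gt0.
have lnPd0 : 0 <= ln (max_pdiv q * num_divisors q)%:R :> R.
  by rewrite ln_ge0 // ler1n muln_gt0 P0.
have B4 : B ^+ 4 = u ^+ 2 * ln (max_pdiv q * num_divisors q)%:R / L.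
  rewrite -powR_mulrn // -powRrM mul1r mulVf // powRr1 //.
  by rewrite divr_ge0 ?(ltW Lp) // mulr_ge0 // sqr_ge0.
have V0 : 0 <= Num.sqrt q%:R * L by rewrite mulr_ge0 // ltW.
case: (lerP c0 (A + B)) => hc.
  apply: le_trans (polya_vinogradov q17 sqf prim X) _; rewrite -/L.
  rewrite [leLHS]mulrC [leRHS]mulrCA ler_wpM2l //.
  have := ler_wpM2l (_ : 0 <= 24 / c0) hc; rewrite divfK ?gt_eqF // => h.
  apply: le_trans (h _) _; first by rewrite divr_ge0 // ltW.
  by rewrite ler_wpM2r ?addr_ge0 // lerDl.
have cA : A < c0 by lra.
have ut : u / t < u0 / 100.
  rewrite -A2 -[ltRHS]sqr_sqrtr ?divr_ge0 ?(ltW u0p) //.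
  rewrite ltrXn2r ?nnegrE ?sqrtr_ge0 //.
  by apply: lt_le_trans cA _; rewrite /c0 ge_min lexx orbT.
have t100 : 100 <= t by move: ut; rewrite ltr_pdivrMr //; nra.
have u_ge1 : 1 <= u.
  rewrite -[leLHS]expRK ler_ln ?posrE ?expR_gt0 //.
  by apply: le_trans (expR1_le R) _; lra.
pose s := Num.sqrt t.
have s2 : s ^+ 2 = t by rewrite sqr_sqrtr // ltW.
have s10 : 10 <= s.
  by rewrite -(@ler_pXn2r _ 2) ?nnegrE ?sqrtr_ge0 // s2; lra.
have LE : L = expR (s ^+ 2) by rewrite s2 lnK // posrE.
have sA : s^-1 <= A + B.
  apply: (@le_trans _ _ A); last by rewrite lerDl.
  rewrite -(@ler_pXn2r _ 2) ?nnegrE ?invr_ge0 ?sqrtr_ge0 // A2 exprVn s2.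
  by rewrite ler_peMl // invr_ge0 ltW.
have eps4 : A + B <= 1 / 4.
  by apply: le_trans (ltW hc) _; rewrite /c0 ge_min lexx.
have lnPd : ln (max_pdiv q * num_divisors q)%:R <= (A + B) ^+ 4 * L.
  apply: (@le_trans _ _ (B ^+ 4 * L)); last first.
    by rewrite ler_wpM2r ?(ltW Lp) // lerXn2r ?nnegrE ?addr_ge0 // lerDr.
  rewrite B4 divfK ?gt_eqF // ler_peMl ?exprn_ege1 //.
apply: le_trans (smooth_bound q17 sqf prim X s10 LE sA eps4 lnPd) _; rewrite -/L.
rewrite [_ * (A + B)]mulrC ler_wpM2r ?mulr_ge0 ?addr_ge0 ?(ltW Lp) //.
by rewrite lerDr divr_ge0 // ltW.
Qed.
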